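(* Let $S$ be a bounded open set in $E$ such that, for any $\gamma^*\in\Gamma_F^*$ with $P_{\gamma^*}\cap S\neq\emptyset$, the intersection $P_{\gamma^*}\cap S$ is a rectangular parallelepiped in $P_{\gamma^*}$ each of whose edges is parallel either to $F\cap V^\bot$ or to $H$. Suppose that the lattice $\Gamma^\bot$ in $V^\bot$ is in good position with respect to $P_{\gamma^*}\cap S$ for every such $\gamma^*$. Then $$R_\varepsilon(S)=O\left(|\log\varepsilon|^{n-r-1}\right),\qquad\varepsilon\to0.$$
   Context: $E$ is a finite-dimensional real vector space with inner product $(\cdot,\cdot)$, $n=\dim E$; $F\subset E$ is a $p$-dimensional linear subspace and $H=F^\bot$ its orthogonal complement, of dimension $q$, $p+q=n$. For $\varepsilon>0$, $T_\varepsilon:E\to E$ is the linear map with $T_\varepsilon(x)=x$ for $x\in F$ and $T_\varepsilon(x)=\varepsilon^{-1}x$ for $x\in H$. $\Gamma\subset E$ is a (full rank) lattice. For a bounded set $S\subset E$, $n_\varepsilon(S)=\#(T_\varepsilon(S)\cap\Gamma)$. $\Gamma^*=\{\gamma^*\in E:(\gamma^*,\Gamma)\subset\mathbb Z\}$ is the dual lattice of $\Gamma$; $\Gamma_F=\Gamma^*\cap F$; $V$ is the linear span of $\Gamma_F$ in $E$, $r=\dim V$. $\Gamma_F$ is a lattice in $V$, and $\Gamma_F^*=\{x\in V:(x,\Gamma_F)\subset\mathbb Z\}\subset V$ is its dual lattice in $V$. $V^\bot$ is the orthogonal complement of $V$ in $E$, and $\Gamma^\bot=\Gamma\cap V^\bot$,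 which is a lattice in $V^\bot$. For $x\in V$, $P_x=x+V^\bot$, identified with $V^\bot$ by translation by $x$. $\mathrm{vol}_{n-r}$ is Euclidean volume on $P_{\gamma^*}$, and $\mathrm{vol}(V^\bot/\Gamma^\bot)$ is the covolume of $\Gamma^\bot$ in $V^\bot$. The remainder is $$R_\varepsilon(S)=n_\varepsilon(S)-\frac{\varepsilon^{-q}}{\mathrm{vol}(V^\bot/\Gamma^\bot)}\sum_{\gamma^*\in\Gamma_F^*}\mathrm{vol}_{n-r}(P_{\gamma^*}\cap S).$$ Good position: let $K$ be a rectangular parallelepiped in a $d$-dimensional Euclidean space $\mathcal E$ and let $\mathbf e=(e_1,\dots,e_d)$ be an orthonormal basis of $\mathcal E$ such that the edges of $K$ are parallel to $e_1,\dots,e_d$. For $X\in\mathcal E$ put $\operatorname{Nm}_{\mathbf e}X=\prod_{j=1}^d(X,e_j)$. A lattice $L$ in $\mathcal E$ is in good position with respect to $K$ if $\inf_{X\in L\setminus\{0\}}|\operatorname{Nm}_{\mathbf e}X|>0$. *)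

(* Defs.v *)
From HB Require Import structures.
From mathcomp Require Import all_boot all_order all_algebra.
From mathcomp Require Import finmap.
From mathcomp Require Import all_classical all_reals all_analysis.
Set Implicit Arguments.
Unset Strict Implicit.
Unset Printing Implicit Defensive.
Import Order.TTheory GRing.Theory Num.Theory.
Import numFieldNormedType.Exports.
Local Open Scope classical_set_scope.
Local Open Scope ring_scope.

(* Throughout, [E] is a finite-dimensional real vector space ([vectType R]) and
   [dot] its inner product. A [vectType] carries no topology, so bounded and
   open sets are spelled out with the Euclidean norm. *)
Section Euclidean.
Variables (R : realType) (E : vectType R) (dot : {dot E for idfun}).

Definition enorm (x : E) : R := Num.sqrt (dot x x).

Definition ebounded (S : set E) : Prop :=
  exists M : R, forall x, S x -> enorm x <= M.

Definition eopen (S : set E) : Prop :=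
  forall x, S x -> exists2 rho : R, 0 < rho &
    forall y, enorm (y - x) < rho -> S y.

Definition orthobasis (W : {vspace E}) (e : (\dim W).-tuple E) : Prop :=
  basis_of W e /\ orthonormal dot e.

(* The rectangular parallelepiped with corner [c], edge directions [e_j] and
   edge lengths [l_j]. It is taken relatively open in [c + W]: it is only used
   for slices of an open set and for coverings. *)
Definition cuboid d (c : E) (e : d.-tuple E) (l : 'I_d -> R) : set E :=
  [set c + \sum_(j < d) t j *: tnth e j |
     t in [set t : 'I_d -> R | forall j, 0 < t j < l j]].

Definition cuboid_along (W : {vspace E}) (e : (\dim W).-tuple E) (K : set E)
    : Prop :=
  exists (c : E) (l : 'I_(\dim W) -> R), (forall j, 0 < l j) /\ K = cuboid c e l.

(* Euclidean [\dim W]-dimensional volume on the translates of [W]: Lebesgue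
   outer measure, i.e. the infimum of the total volume of countable coverings
   by parallelepipeds of the translates of [W]. All orientations are allowed,
   so that no basis has to be chosen; this does not change the infimum. The
   coverings are indexed by subsets of [nat] because, when [\dim W = 0], a
   parallelepiped is a point, of volume 1, and finite coverings are needed. *)
Definition vol (W : {vspace E}) (A : set E) : \bar R :=
  ereal_inf [set v : \bar R |
    exists (D : set nat) (c : nat -> E) (e : nat -> (\dim W).-tuple E)
           (l : nat -> 'I_(\dim W) -> R),
      [/\ forall k, orthobasis (e k),
          forall k j, 0 < l k j,
          A `<=` \bigcup_(k in D) cuboid (c k) (e k) (l k) &
          v = \esum_(k in D) (\prod_(j < \dim W) l k j)%:E]].

Definition zspan d (b : d.-tuple E) : set E :=
  [set \sum_(i < d) (z i)%:~R *: tnth b i | z in [set: 'I_d -> int]].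

Definition fundamental_cell d (b : d.-tuple E) : set E :=
  [set \sum_(i < d) t i *: tnth b i |
     t in [set t : 'I_d -> R | forall i, 0 <= t i < 1]].

Definition lattice_in (W : {vspace E}) (L : set E) : Prop :=
  exists b : (\dim W).-tuple E, basis_of W b /\ L = zspan b.

(* Volume of the fundamental cell of a [Z]-basis of [L]; it does not depend on
   the basis. *)
Definition covolume (W : {vspace E}) (L : set E) : R :=
  xget 0 [set v : R | exists b : (\dim W).-tuple E,
    [/\ basis_of W b, L = zspan b & v = fine (vol W (fundamental_cell b))]].

Definition dual_in (W : {vspace E}) (L : set E) : set E :=
  [set x | x \in W /\ forall g, L g -> dot x g \is a Num.int].

(* The linear span of an arbitrary set, as the least subspace containing it. *)
Definition span_set (A : set E) : {vspace E} :=
  xget 0%VS [set U : {vspace E} | (forall x, A x -> x \in U) /\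
    forall U' : {vspace E}, (forall x, A x -> x \in U') -> (U <= U')%VS].

Definition Nm d (e : d.-tuple E) (x : E) : R := \prod_(j < d) dot x (tnth e j).

(* [L] is a lattice in [W] and [K] a parallelepiped in a translate of [W]. The
   infimum is taken in [\bar R], so that it is [+oo] when [W] is trivial. *)
Definition good_position (W : {vspace E}) (L K : set E) : Prop :=
  exists e : (\dim W).-tuple E,
    [/\ orthobasis e, cuboid_along e K &
        (0 < ereal_inf [set (`|Nm e x|%R)%:E | x in L `\ 0%R])%E].

Section Remainder.
Variables (F : {vspace E}) (Gamma : set E).

Definition Hperp : {vspace E} := orthov dot F.

Definition stretch (eps : R) (x : E) : E :=
  daddv_pi F Hperp x + eps^-1 *: daddv_pi Hperp F x.

Definition npoints (eps : R) (S : set E) : nat :=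
  #|` fset_set ((stretch eps @` S) `&` Gamma)|%fset.

Definition GammaF : set E := dual_in fullv Gamma `&` [set x | x \in F].

Definition V : {vspace E} := span_set GammaF.

Definition GammaF_dual : set E := dual_in V GammaF.

Definition Vperp : {vspace E} := orthov dot V.

Definition Gamma_perp : set E := Gamma `&` [set x | x \in Vperp].

Definition slice (x : E) : set E := [set x + y | y in [set y | y \in Vperp]].

(* The sum has finite support when [S] is bounded. *)
Definition remainder (S : set E) (eps : R) : R :=
  (npoints eps S)%:R -
  eps ^- \dim Hperp / covolume Vperp Gamma_perp *
  \sum_(g \in GammaF_dual) fine (vol Vperp (slice g `&` S)).

End Remainder.
End Euclidean.

(* Main.v *)
Require Import Defs.
From mathcomp Require Import all_boot all_order all_algebra.
From mathcomp Require Import finmap.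
From mathcomp Require Import all_classical all_reals all_analysis.
From mathcomp Require Import zify ring lra.
Set Implicit Arguments.
Unset Strict Implicit.
Unset Printing Implicit Defensive.
Import Order.TTheory GRing.Theory Num.Theory.
Import numFieldNormedType.Exports.
Local Open Scope classical_set_scope.
Local Open Scope ring_scope.

(** Projecting [Gamma] orthogonally onto [V] sends it onto [GammaF_dual]
    ([proj_dual], [lift_dual]), and the fibre over [g] is a translate of
    [Gamma_perp] lying in [slice g].  As [V] is contained in [F], [stretch eps]
    preserves every slice, and it multiplies by [eps^-1] those edges of a box in
    the slice that lie in [Hperp].  Hence [npoints eps S] is a finite sum, over
    the [g] whose slice meets [S], of the number of points of a translate of
    [Gamma_perp] in a box of volume [eps ^- q * vol (slice g `&` S)], and the
    main term collects the volumes of these boxes divided by the covolume.  A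
    box determines its edge directions up to sign and order ([box_edges]), so
    the frame of good position, in which the norm form is bounded below, has its
    vectors in [F] or [Hperp], like the given one.  Everything is thus reduced
    to one lattice: if the norm form is bounded below on the nonzero points of a
    lattice of rank [d], a box of volume below [2 ^+ m.+1] contains
    [volume / covolume] points up to an error [O(m.+1 ^ (d - 1))]
    ([lattice_count]), where [m] is of the order of [- ln eps].  When [d = 0]
    the count is exact.

    The lattice count has two halves.  The counts in the translates of a fixed
    box average to [volume / covolume], so that some translate contains at least,
    and some at most, about that number ([density_lower], [density_upper]).  It
    remains to show that two translates of a box contain the same number of
    points up to [O(m.+1 ^ (d - 1))] ([box_discrepancy]).  A box of volume [a]
    contains [O(a + 1)] points, because two points in a thin slab of it would
    have a difference of small norm ([admissible_count]).  By a pigeonhole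
    argument in the spirit of Minkowski, there are [d] independent lattice
    vectors about as long as the edges of the box scaled to volume 1
    ([short_vectors]).  The sum over the lattice of a smooth bump is periodic
    along each of them, and its differences of order [2 d] along them are tiny;
    a periodic function with tiny differences is almost constant
    ([periodic_osc]).  So for smooth bumps on boxes of volume [a >= 1] the sums
    over two translates differ by [O(1 / a)] ([smooth_osc]).  Finally the
    indicator of an interval is a smooth bump plus smooth bumps of width [2 ^- j]
    near both ends ([chi_decomp]).  Replacing the indicators one edge at a time,
    the first edge yields a geometric sum of the bounds [2 ^+ j / a], which is
    bounded, and each other edge a sum over at most [m.+1] scales, hence the
    power [d - 1] ([osc_induction]).

    The volume is an outer measure defined by coverings with boxes of all
    orientations, so its value on a box needs proof ([vol_cuboid]).  By
    compactness the unit cube has positive volume [q]; refining each box of a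
    near-optimal covering by small copies of that covering gives [q <= q * q],
    so that [q = 1]. *)

(** * Smoothness measured by finite differences *)

Section SmoothDifferences.
Variable R : realType.

Definition shiftdiff (h : R) (f : R -> R) : R -> R := fun x => f (x + h) - f x.

(** Smoothness of order [s] at frequency [lam], through finite differences
    rather than derivatives: a difference commutes with sums over a lattice,
    with no question of differentiating under the sum. *)
Fixpoint sd (s : nat) (C lam : R) (f : R -> R) : Prop :=
  (forall x, `|f x| <= C) /\
  match s with
  | 0 => True
  | s'.+1 => forall h, sd s' (C * lam * `|h|) lam (shiftdiff h f)
  end.

Lemma sd_bound s C lam f x : sd s C lam f -> `|f x| <= C.
Proof. by case: s => [|s] [H _]. Qed.

Lemma sd_ge0 s C lam f : sd s C lam f -> 0 <= C.
Proof. by move=> /(sd_bound 0); apply: le_trans. Qed.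

Lemma sd_ext s C lam f g : f =1 g -> sd s C lam f -> sd s C lam g.
Proof. by move=> /funext ->. Qed.

Lemma sd_le s C C' lam f : 0 <= lam -> C <= C' -> sd s C lam f -> sd s C' lam f.
Proof.
move=> lam0; elim: s C C' f => [|s IH] C C' f CC' /= [Hf Hs]; split=> //.
- by move=> x; apply: le_trans CC'.
- by move=> x; apply: le_trans CC'.
move=> h; apply: IH (Hs h); rewrite -!mulrA ler_wpM2r //.
by rewrite mulr_ge0.
Qed.

Lemma sd_lam s C lam lam' f : 0 <= lam <= lam' -> sd s C lam f -> sd s C lam' f.
Proof.
move=> /andP[l0 ll]; elim: s C f => [|s IH] C f /= [Hf Hs]; split=> // h.
have C0 : 0 <= C by apply: le_trans (Hf 0).
apply: (@sd_le _ (C * lam * `|h|)); first exact: le_trans ll.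
  by rewrite ler_wpM2r // ler_wpM2l.
exact: IH.
Qed.

Lemma sd_drop s C lam f : sd s.+1 C lam f -> sd s C lam f.
Proof.
elim: s C f => [|s IH] C f /= [Hf Hs]; split=> // h.
by apply: IH; apply: Hs.
Qed.

Lemma sd_shift s C lam f a : sd s C lam f -> sd s C lam (fun x => f (x + a)).
Proof.
elim: s C f => [|s IH] C f /= [Hf Hs]; split=> // h.
have := IH _ _ (Hs h); apply: sd_ext => x; rewrite /shiftdiff.
by congr (f _ - _); ring.
Qed.

Lemma sd_add s C1 C2 lam f g :
  sd s C1 lam f -> sd s C2 lam g -> sd s (C1 + C2) lam (fun x => f x + g x).
Proof.
elim: s C1 C2 f g => [|s IH] C1 C2 f g /= [Hf Hs] [Hg Hs']; split=> //.
- by move=> x; apply: le_trans (ler_normD _ _) _; apply: lerD.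
- by move=> x; apply: le_trans (ler_normD _ _) _; apply: lerD.
move=> h; rewrite !mulrDl; have := IH _ _ _ _ (Hs h) (Hs' h).
by apply: sd_ext => x; rewrite /shiftdiff; ring.
Qed.

Lemma sd_scale s C lam f k : sd s C lam f -> sd s (`|k| * C) lam (fun x => k * f x).
Proof.
elim: s C f => [|s IH] C f /= [Hf Hs]; split=> //.
- by move=> x; rewrite normrM ler_wpM2l.
- by move=> x; rewrite normrM ler_wpM2l.
move=> h; rewrite -!mulrA; have := IH _ _ (Hs h); rewrite !mulrA.
by apply: sd_ext => x; rewrite /shiftdiff mulrBr.
Qed.

(** The Leibniz rule for one difference has two terms, whence the factor [2 ^+
    s]. *)
Lemma sd_mul s C1 C2 lam f g : 0 <= lam ->
  sd s C1 lam f -> sd s C2 lam g -> sd s (2 ^+ s * (C1 * C2)) lam (fun x => f x * g x).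
Proof.
move=> l0; elim: s C1 C2 f g => [|s IH] C1 C2 f g.
  move=> /= [Hf _] [Hg _]; split=> // x.
  by rewrite expr0 mul1r normrM ler_pM.
move=> Hf Hg.
have C10 := sd_ge0 Hf; have C20 := sd_ge0 Hg.
split=> [x|h].
  rewrite normrM; apply: (@le_trans _ _ (C1 * C2)).
    by rewrite ler_pM // ?(sd_bound _ Hf) ?(sd_bound _ Hg).
  by rewrite ler_peMl ?mulr_ge0 // exprn_ege1 // ler1n.
have H1 := IH _ _ _ _ (proj2 Hf h) (sd_drop Hg).
have H2 := IH _ _ _ _ (sd_shift h (sd_drop Hf)) (proj2 Hg h).
have := sd_add H1 H2.
rewrite (_ : _ + _ = 2 ^+ s.+1 * (C1 * C2) * lam * `|h|); last by rewrite exprS; ring.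
by apply: sd_ext => x; rewrite /shiftdiff; ring.
Qed.

Lemma sd_cst s C lam : 0 <= lam -> sd s `|C| lam (fun=> C).
Proof.
move=> l0; have H0 : forall s, sd s 0 lam (fun=> 0).
  elim=> [|s' IH] /=; split=> //; try by move=> ?; rewrite normr0.
  by move=> h; rewrite !mul0r; apply: sd_ext IH => x; rewrite /shiftdiff subrr.
case: s => [|s] /=; split=> // h.
apply: (@sd_le _ 0) => //; first by rewrite !mulr_ge0.
by apply: sd_ext (H0 s) => x; rewrite /shiftdiff subrr.
Qed.

Lemma sd_affine s C f lam k : sd s C 1 f -> `|k| <= lam ->
  forall a, sd s C lam (fun x => f (k * x + a)).
Proof.
move=> Hf kl a; apply: (@sd_lam _ _ `|k|); first by rewrite kl andbT.
elim: s C f Hf => [|s IH] C f /= [Hf Hs]; split=> // h.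
have := IH _ _ (Hs (k * h)); rewrite normrM mulr1 -mulrA.
by apply: sd_ext => x; rewrite /shiftdiff; congr (f _ - _); ring.
Qed.

(** Restates smoothness at a high frequency as smoothness at frequency 1 with
    a larger constant. *)
Lemma sd_unscale s C k f : 1 <= k -> sd s C k f -> sd s (C * k ^+ s) 1 f.
Proof.
move=> k1; have k0 : 0 <= k by apply: le_trans k1.
elim: s C f => [|s IH] C f Hf.
  by split=> // x; rewrite mulr1; case: Hf.
have C0 := sd_ge0 Hf; split=> [x|h].
  by apply: le_trans (sd_bound x Hf) _; rewrite ler_peMr // exprn_ege1.
have := IH _ _ (proj2 Hf h); congr (sd _ _ _ _); rewrite exprS; ring.
Qed.

Lemma sd_prod (I : Type) (r : seq I) s A lam (f : I -> R -> R) : 0 <= lam -> 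
  (forall i, sd s A lam (f i)) ->
  sd s ((2 ^+ s * A) ^+ size r) lam (fun x => \prod_(i <- r) f i x).
Proof.
move=> l0 H; elim: r => [|i r IH].
  rewrite expr0; have := sd_cst s 1 l0; rewrite normr1.
  by apply: sd_ext => x; rewrite big_nil.
have := sd_mul l0 (H i) IH; rewrite mulrA -exprS.
by apply: sd_ext => x; rewrite big_cons.
Qed.

Lemma sd_iter s C lam f h : sd s C lam f ->
  forall x, `|iter s (shiftdiff h) f x| <= C * (lam * `|h|) ^+ s.
Proof.
elim: s C f => [|s IH] C f /=; first by move=> [H _] x; rewrite mulr1.
move=> [_ Hs] x; rewrite -iterS iterSr.
by apply: le_trans (IH _ _ (Hs h) x) _; rewrite exprS; rewrite !mulrA.
Qed.

Lemma mvt (F f : R -> R) : (forall x : R, is_derive x (1 : R) F (f x)) ->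
  forall a b, a < b -> exists2 c, a < c < b & F b - F a = f c * (b - a).
Proof.
move=> dF a b ab.
have cF : {within `[a, b], continuous F}.
  apply/continuous_subspaceT => y.
  by apply: differentiable_continuous; apply/derivable1_diffP; apply: ex_derive.
have [c] := MVT ab (fun x _ => dF x) cF.
by rewrite in_itv /= => cab ?; exists c.
Qed.

Lemma mvt_lip C (F f : R -> R) : (forall x : R, is_derive x (1 : R) F (f x)) ->
  (forall x, `|f x| <= C) -> forall h x, `|shiftdiff h F x| <= C * `|h|.
Proof.
move=> dF bf h x; rewrite /shiftdiff.
have key a b : a < b -> `|F b - F a| <= C * `|b - a|.
  by move=> /(mvt dF)[c _ ->]; rewrite normrM ler_wpM2r.
case: (ltrgt0P h) => [h0|h0|->].
- have := key x (x + h); rewrite ltrDl => /(_ h0).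
  by rewrite (_ : x + h - x = h) ?(gtr0_norm h0) //; ring.
- have := key (x + h) x; rewrite gtrDl => /(_ h0).
  by rewrite distrC (_ : x - (x + h) = - h) ?normrN ?(ltr0_norm h0) //; ring.
- by rewrite addr0 subrr normr0 mulr0.
Qed.

(** By the mean value theorem a difference with step [h] is [h] times a value
    of the derivative, so each derivative is worth one order of differences. *)
Lemma sd_deriv s C (F f : R -> R) : (forall x : R, is_derive x (1 : R) F (f x)) ->
  (forall x, `|F x| <= C) -> sd s C 1 f -> sd s.+1 C 1 F.
Proof.
elim: s C F f => [|s IH] C F f dF bF Hf.
  split=> // h; split=> // x; rewrite mulr1.
  by apply: (mvt_lip dF); case: Hf.
split=> // h.
apply: (IH _ _ (shiftdiff h f)).
- move=> x; apply: is_deriveB.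
  have H1 : is_derive x (1 : R) (fun x => x + h) 1.
    exact: (@is_derive_shift R x 1 h).
  have := @is_derive1_comp R F (shift h) x _ _ (dF (x + h)) H1.
  by rewrite mulr1.
- by move=> x; rewrite mulr1; apply: (mvt_lip dF); case: Hf.
- exact: (proj2 Hf h).
Qed.

(** Each truncated power is the derivative of the next: smoothness of any
    finite order is obtained from piecewise polynomials alone. *)
Definition tpow (n : nat) (t : R) : R := (Num.max t 0) ^+ n / n`!%:R.

Lemma tpow_le0 n t : t <= 0 -> tpow n.+1 t = 0.
Proof. by move=> t0; rewrite /tpow max_r // expr0n /= mul0r. Qed.

Lemma is_derive_tpow n (t : R) : is_derive t (1 : R) (tpow n.+2) (tpow n.+1 t).
Proof.
have [t0|t0|t0] := ltrgt0P t.
- have E : \forall x \near t, (n.+2`!%:R^-1 *: (id : R -> R) ^+ n.+2) x = tpow n.+2 x.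
    near=> x; have x0 : 0 < x by near: x; exact: lt_nbhsr.
    rewrite /tpow max_l ?(ltW x0) // mulrC.
    have F k : ((id : R -> R) ^+ k) x = x ^+ k.
      by elim: k => // k IH; rewrite !exprS -IH.
    by rewrite -F.
  apply: (near_eq_is_derive E).
  apply: is_derive_eq; rewrite /tpow max_l ?(ltW t0) //.
  rewrite [n.+2`!]factS natrM /GRing.scale /=.
  by rewrite invfM mulr1 mulrACA mulVf ?pnatr_eq0 // mul1r mulrC.
- have E : \forall x \near t, (cst 0 : R -> R) x = tpow n.+2 x.
    near=> x; have x0 : x < 0 by near: x; exact: lt_nbhsl.
    by rewrite tpow_le0 ?ltW.
  apply: (near_eq_is_derive E).
  by rewrite (tpow_le0 _ (ltW t0)); exact: is_derive_cst.
- subst t; rewrite tpow_le0 //.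
  have H : (fun h : R => h^-1 *: (tpow n.+2 (h *: 1 + 0) - tpow n.+2 0)) @ 0^' --> (0 : R).
    apply/cvgr0Pnorm_le => e e0; near=> h.
    have h1 : `|h| < 1 by near: h; apply: dnbhs0_lt.
    have he : `|h| < e by near: h; apply: dnbhs0_lt.
    have h0 : h != 0 by near: h; exact: nbhs_dnbhs_neq.
    rewrite [tpow _ 0]tpow_le0 // subr0 addr0 /GRing.scale /= mulr1.
    have [hn|hp] := leP h 0; first by rewrite tpow_le0 // mulr0 normr0 ltW.
    rewrite /tpow max_l ?(ltW hp) // exprS !mulrA mulVf // mul1r.
    rewrite normrM normrX normrV ?unitfE ?pnatr_eq0 -?lt0n ?fact_gt0 // normr_nat.
    apply: (@le_trans _ _ (`|h| ^+ n.+1)).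
      by rewrite ler_piMr ?exprn_ge0 // invf_le1 ?ltr0n ?ler1n fact_gt0.
    apply: le_trans (ltW he); rewrite exprS ler_piMr // exprn_ile1 //.
    exact: ltW.
  apply: DeriveDef.
  + by apply: cvgP H.
  + by apply: cvg_lim H.
Unshelve. all: by end_near.
Qed.

Definition backdiff (f : R -> R) : R -> R := fun t => f t - f (t - 1).

Lemma is_derive_backdiff (F f : R -> R) : (forall x : R, is_derive x (1 : R) F (f x)) ->
  forall x : R, is_derive x (1 : R) (backdiff F) (backdiff f x).
Proof.
move=> dF x; apply: is_deriveB.
have H1 := @is_derive_shift R x 1 (- 1).
have := @is_derive1_comp R F (shift (- 1)) x _ _ (dF (x - 1)) H1.
by rewrite mulr1.
Qed.

Lemma iter_backdiff_deriv n (F f : R -> R) : (forall x : R, is_derive x (1 : R) F (f x)) ->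
  forall x : R, is_derive x (1 : R) (iter n backdiff F) (iter n backdiff f x).
Proof. by move=> dF; elim: n => //= n IH x; apply: is_derive_backdiff. Qed.

(** The primitive of a cardinal B-spline, rising from 0 at 0 to 1 at [n]. *)
Definition sstep (n : nat) : R -> R := iter n backdiff (tpow n).

(** The derivative of [sstep n.+2] is the backward difference of [sstep n.+1],
    so that [sstep n.+2 t] is a value of [sstep n.+1] between [t - 1] and [t];
    all four properties follow by induction. *)
Lemma sstepP n : [/\ sd n.+1 (2 ^+ n) 1 (sstep n.+1),
  forall t, t <= 0 -> sstep n.+1 t = 0,
  forall t, n.+1%:R <= t -> sstep n.+1 t = 1 &
  forall t, 0 <= sstep n.+1 t <= 1].
Proof.
elim: n => [|n [IH1 IH2 IH3 IH4]].
  have E t : sstep 1 t = Num.max t 0 - Num.max (t - 1) 0.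
    by rewrite /sstep /= /backdiff /tpow !expr1 !factS fact0 muln1 !divr1.
  have B t : 0 <= sstep 1 t <= 1.
    rewrite E; case: (leP t 0) => t0; case: (leP (t - 1) 0) => t1; lra.
  split=> //.
  - split=> [x|h].
      by rewrite expr0; have /andP[? ?] := B x; rewrite ger0_norm.
    split=> // x; rewrite expr0 !mul1r /shiftdiff !E.
    rewrite ler_norml.
    have ha : - `|h| <= h <= `|h| by rewrite -ler_norml.
    have ha0 := normr_ge0 h.
    case: (leP x 0) => ?; case: (leP (x - 1) 0) => ?;
    case: (leP (x + h) 0) => ?; case: (leP (x + h - 1) 0) => ?; lra.
  - move=> t t0; rewrite E; case: (leP t 0) => ?; case: (leP (t - 1) 0) => ?; lra.
  - move=> t t0; rewrite E; case: (leP t 0) => ?; case: (leP (t - 1) 0) => ?; lra.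
have dI := iter_backdiff_deriv n.+1 (is_derive_tpow n).
have M t : exists2 c, t - 1 < c < t & sstep n.+2 t = sstep n.+1 c.
  have [|c ct E] := mvt dI (_ : t - 1 < t); first lra.
  exists c => //; rewrite {1}/sstep iterS {1}/backdiff E (_ : t - (t - 1) = 1) ?mulr1 //.
  by ring.
have B t : 0 <= sstep n.+2 t <= 1 by have [c _ ->] := M t.
split=> //.
- apply: (@sd_deriv _ _ _ (backdiff (sstep n.+1))).
  + by move=> x; apply: is_derive_backdiff; exact: dI.
  + move=> x; have /andP[? ?] := B x; rewrite ger0_norm //.
    by apply: le_trans (_ : 1 <= _) => //; rewrite exprn_ege1 // ler1n.
  + have := sd_add IH1 (sd_scale (-1) (sd_shift (- 1) IH1)).
    rewrite normrN1 mul1r (_ : _ + _ = 2 ^+ n.+1); last by rewrite exprS; ring.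
    by apply: sd_ext => x; rewrite mulN1r.
- by move=> t t0; have [c /andP[_ ct] ->] := M t; rewrite IH2 //; lra.
- move=> t t0; have [c /andP[ct _] ->] := M t; rewrite IH3 //.
  by move: t0; rewrite -[n.+2%:R]natr1; lra.
Qed.

(** The rise is confined to [0, 1/4] so that the two ends of the unit
    interval, seen at scale 1 or 2, do not interfere in [chi_decomp]. *)
Lemma smooth_step s : exists2 A, 1 <= A & exists theta : R -> R,
  [/\ sd s A 1 theta, forall t, t <= 0 -> theta t = 0,
      forall t, 1 / 4%:R <= t -> theta t = 1 & forall t, 0 <= theta t <= 1].
Proof.
have [H1 H2 H3 H4] := sstepP s.
set k : R := 4 * s.+1%:R.
have k1 : 1 <= k by rewrite /k -natrM ler1n.
exists (2 ^+ s * k ^+ s); first by rewrite mulr_ege1 // exprn_ege1 // ler1n.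
exists (fun t => sstep s.+1 (k * t)); split=> [|t t0|t t0|t]; last exact: H4.
- apply: sd_unscale => //.
  have := sd_affine (sd_drop H1) (_ : `|k| <= k) 0.
  rewrite ger0_norm ?lexx ?(le_trans _ k1) // => /(_ isT).
  by apply: sd_ext => x; rewrite addr0.
- by apply: H2; rewrite pmulr_rle0 // (lt_le_trans _ k1).
- apply: H3; rewrite /k; have : 0 < s.+1%:R :> R by rewrite ltr0n.
  by nra.
Qed.

End SmoothDifferences.

(** * Point sets with a lower bound for the norm form *)

Lemma uniq_size_inj (T : eqType) (F : finType) (f : T -> F) (s : seq T) :
  uniq s -> {in s &, injective f} -> (size s <= #|F|)%N.
Proof.
move=> us inj_f; rewrite -(size_map f) -(card_uniqP _) ?max_card //.
by rewrite map_inj_in_uniq.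
Qed.

Lemma truncn_close (R : realType) (u v : R) : 0 <= u -> 0 <= v ->
  Num.truncn u = Num.truncn v -> `|u - v| < 1.
Proof.
move=> /truncn_itv/andP[u1 u2] /truncn_itv/andP[v1 v2] E.
move: u1 u2; rewrite E -natr1 => u1 u2; move: v2; rewrite -natr1 => v2.
by rewrite ltr_norml; apply/andP; split; lra.
Qed.

Lemma finite_uniq_bound (T : choiceType) (A : set T) n :
  (forall s : seq T, uniq s -> {subset s <= A} -> (size s <= n)%N) -> finite_set A.
Proof.
move=> H; apply: contrapT => /(@infinite_set_fset _ _ n.+1)[B BA nB].
by have := H B (fset_uniq B); rewrite leqNgt nB => /(_ _)/negP; apply => // x xB;
  rewrite inE; apply: BA.
Qed.

(** The cardinality of a finite set; 0 on an infinite one. *)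
Definition cnt (T : choiceType) (A : set T) : nat := #|` fset_set A|%fset.

Definition hbox (R : realType) d (p a : 'I_d -> R) : set 'rV[R]_d :=
  [set x : 'rV_d | forall i, p i <= x 0 i < p i + a i].

Section Admissible.
Variables (R : realType) (d' : nat).
Local Notation d := d'.+1.
Variables (L : set 'rV[R]_d) (c : R).
Hypothesis c0 : 0 < c.
Hypothesis LB : forall x y, L x -> L y -> L (x - y).
Hypothesis LN : forall x, L x -> x != 0 -> c <= \prod_i `|x 0 i|.

Lemma admissible_sep x y : L x -> L y -> \prod_i `|x 0 i - y 0 i| < c -> x = y.
Proof.
move=> Lx Ly H; apply/eqP; rewrite -subr_eq0; apply/negPn/negP => /(LN (LB Lx Ly)).
rewrite leNgt (eq_bigr (fun i => `|x 0 i - y 0 i|)) ?H // => i _.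
by rewrite !mxE.
Qed.

(** If the first edge is cut into slightly more than [volume / c] parts, two
    points in the same slab would have a difference whose norm form is below
    [c]; so each slab contains at most one. *)
Lemma admissible_count p a (s : seq 'rV[R]_d) : (forall i, 0 < a i) -> uniq s ->
  {subset s <= L `&` hbox p a} -> (size s)%:R <= (\prod_i a i) / c + 1.
Proof.
move=> a0 us sL; set V := \prod_i a i.
have V0 : 0 < V by apply: prodr_gt0.
set K := Num.truncn (V / c).
have Vc0 : 0 <= V / c by rewrite divr_ge0 ?ltW.
have /andP[KV VK] := truncn_itv Vc0; rewrite -/K in KV VK.
pose f (x : 'rV[R]_d) : 'I_K.+1 := inord (Num.truncn (K.+1%:R * (x 0 0 - p 0) / a 0)).
apply: (@le_trans _ _ K.+1%:R); last by rewrite -natr1 lerD2r.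
rewrite ler_nat -[leqRHS]card_ord; apply: (@uniq_size_inj _ _ f) => //.
have K0 : 0 < K.+1%:R :> R by rewrite ltr0n.
have fK x : x \in s -> 0 <= K.+1%:R * (x 0 0 - p 0) / a 0 < K.+1%:R.
  move=> /sL; rewrite inE => -[_ /(_ 0)/andP[h1 h2]].
  rewrite divr_ge0 ?mulr_ge0 ?(ltW (a0 _)) ?subr_ge0 //=.
  by rewrite ltr_pdivrMr // ltr_pM2l //; lra.
move=> x y xs ys /(congr1 val) /=.
have /andP[x1 x2] := fK x xs; have /andP[y1 y2] := fK y ys.
rewrite !inordK ?truncn_lt_nat // => /(truncn_close x1 y1) xy.
have := sL x xs; have := sL y ys; rewrite !inE => -[Ly hy] [Lx hx].
apply: admissible_sep => //.
apply: (@le_lt_trans _ _ (V / K.+1%:R)); last first.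
  by rewrite ltr_pdivrMr // -ltr_pdivrMl // mulrC.
rewrite /V (bigD1 ord0) //= [X in _ <= X / _](bigD1 ord0) //= mulrAC ler_pM //.
- by apply: prodr_ge0.
- rewrite ler_pdivlMr //; apply: ltW; move: xy.
  rewrite -mulrBl -mulrBr normrM normfV (gtr0_norm (a0 _)) normrM normr_nat.
  rewrite ltr_pdivrMr // mul1r mulrC; congr (`| _ | * _ < _); ring.
- apply: ler_prod => i _; rewrite normr_ge0 /=.
  have /andP[? ?] := hx i; have /andP[? ?] := hy i.
  by rewrite ler_norml; apply/andP; split; lra.
Qed.

Lemma admissible_box_finite (p a : 'I_d -> R) : finite_set (L `&` hbox p a).
Proof.
have [a0|] := pselect (forall i, 0 < a i); last first.
  move=> /existsNP[i /negP]; rewrite -leNgt => ai.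
  rewrite (_ : _ `&` _ = set0) ?finite_set0 // -subset0 => x [_ /(_ i)]; lra.
apply: (@finite_uniq_bound _ _ (Num.truncn ((\prod_i a i) / c)).+1) => s us sL.
have := admissible_count a0 us sL; set v := _ / c => sv.
have : (size s)%:R < (Num.truncn v).+2%:R :> R.
  by apply: le_lt_trans sv _; rewrite -[ltRHS]natr1 ltrD2r truncnS_gt.
by rewrite ltr_nat.
Qed.

(** A finite sum in practice: [f] will have bounded support, and a box
    contains finitely many points of [L]. *)
Definition latsum (f : 'rV[R]_d -> R) : R := \sum_(x \in L) f x.

Lemma latsum_box p a f : (forall x, f x != 0 -> hbox p a x) ->
  latsum f = \sum_(x <- fset_set (L `&` hbox p a)) f x.
Proof.
move=> fs; rewrite -fsbig_finite; last exact: admissible_box_finite.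
rewrite /latsum; apply/esym/fsbig_widen; first by move=> x [].
by move=> x [Lx /= nb]; apply/eqP; apply: contraPT nb => /fs hx; apply.
Qed.

Lemma latsum_le F p a f : (forall i, 0 < a i) -> (forall x, f x != 0 -> hbox p a x) ->
  (forall x, `|f x| <= F) -> `|latsum f| <= F * ((\prod_i a i) / c + 1).
Proof.
move=> a0 fs fF; rewrite (latsum_box fs).
apply: le_trans (ler_norm_sum _ _ _) _.
apply: (@le_trans _ _ (\sum_(x <- fset_set (L `&` hbox p a)) F)).
  by apply: ler_sum.
rewrite big_const_seq count_predT iter_addr addr0 -mulr_natr.
rewrite ler_wpM2l ?(le_trans _ (fF 0)) //.
apply: (@admissible_count p) => //; first exact: fset_uniq.
by move=> x; rewrite in_fset_set //; exact: admissible_box_finite.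
Qed.

Lemma hbox_common (p1 a1 p2 a2 : 'I_d -> R) : exists p a, (forall i, 0 < a i) /\
  hbox p1 a1 `|` hbox p2 a2 `<=` hbox p a.
Proof.
exists (fun i => Num.min (p1 i) (p2 i)), (fun i => Num.max (p1 i + a1 i) (p2 i + a2 i) - Num.min (p1 i) (p2 i) +  `|Num.max (p1 i + a1 i) (p2 i + a2 i) - Num.min (p1 i) (p2 i)| + 1); split.
  move=> i; set z := _ - _; have : - z <= `|z| by rewrite -normrN ler_norm.
  by lra.
move=> x [] hx i; have := hx i => /andP[h1 h2]; set z := `| _ |;
  have z0 : 0 <= z by rewrite normr_ge0.
- rewrite ge_min h1 /=; have : p1 i + a1 i <= Num.max (p1 i + a1 i) (p2 i + a2 i) by rewrite le_max lexx.
  by lra.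
- rewrite ge_min h1 orbT /=; have : p2 i + a2 i <= Num.max (p1 i + a1 i) (p2 i + a2 i) by rewrite le_max lexx orbT.
  by lra.
Qed.

Definition bsupp (f : 'rV[R]_d -> R) := exists p a, forall x, f x != 0 -> hbox p a x.

Lemma bsuppD f g : bsupp f -> bsupp g -> bsupp (fun x => f x + g x).
Proof.
move=> [p1 [a1 H1]] [p2 [a2 H2]]; have [p [a [_ H]]] := hbox_common p1 a1 p2 a2.
exists p, a => x fg; apply: H; have [f0|f0] := eqVneq (f x) 0; last by left; apply: H1.
by right; apply: H2; move: fg; rewrite f0 add0r.
Qed.

Lemma bsuppZ k f : bsupp f -> bsupp (fun x => k * f x).
Proof.
move=> [p1 [a1 H1]]; exists p1, a1 => x kf; apply: H1; apply: contraNneq kf => ->.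
by rewrite mulr0.
Qed.

Lemma bsupp0 : bsupp (fun=> 0).
Proof. by exists (fun=> 0), (fun=> 0) => x /eqP. Qed.

Lemma latsum0 : latsum (fun=> 0) = 0. Proof. exact: fsbig1. Qed.

Lemma latsumD f g : bsupp f -> bsupp g -> latsum (fun x => f x + g x) = latsum f + latsum g.
Proof.
move=> [p1 [a1 H1]] [p2 [a2 H2]]; have [p [a [_ H]]] := hbox_common p1 a1 p2 a2.
have Hf x : f x != 0 -> hbox p a x by move=> ?; apply: H; left; apply: H1.
have Hg x : g x != 0 -> hbox p a x by move=> ?; apply: H; right; apply: H2.
rewrite (latsum_box Hf) (latsum_box Hg) -big_split; apply: latsum_box => x fg.
have [f0|] := eqVneq (f x) 0; last exact: Hf.
by apply: Hg; move: fg; rewrite f0 add0r.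
Qed.

Lemma latsumZ k f : latsum (fun x => k * f x) = k * latsum f.
Proof. by rewrite /latsum mulr_fsumr. Qed.

Lemma latsumB f g : bsupp f -> bsupp g -> latsum (fun x => f x - g x) = latsum f - latsum g.
Proof.
move=> Hf Hg; rewrite -mulN1r -latsumZ -latsumD //; last exact: bsuppZ.
by congr latsum; apply/funext => x; rewrite mulN1r.
Qed.

Lemma latsum_sum (I : Type) (r : seq I) (f : I -> 'rV[R]_d -> R) : (forall i, bsupp (f i)) ->
  bsupp (fun x => \sum_(i <- r) f i x) /\ latsum (fun x => \sum_(i <- r) f i x) = \sum_(i <- r) latsum (f i).
Proof.
move=> H; elim: r => [|i r [IH1 IH2]].
  rewrite big_nil (_ : (fun x => _) = (fun=> 0)) ?latsum0; last by apply/funext => x; rewrite big_nil.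
  by split=> //; exact: bsupp0.
rewrite (_ : (fun x => _) = (fun x => f i x + \sum_(j <- r) f j x)); last first.
  by apply/funext => x; rewrite big_cons.
by rewrite latsumD // big_cons IH2; split => //; apply: bsuppD.
Qed.

(** The source of periodicity: a sum over [L] does not change under
    translation by [L]. *)
Lemma latsum_shift v f : L v -> latsum (fun x => f (x + v)) = latsum f.
Proof.
move=> Lv; rewrite /latsum [RHS](@reindex_fsbig _ _ _ _ _ (fun x => x + v) L) //.
have L0 : L 0 by rewrite -(subrr v); apply: LB.
have LNv : L (- v) by rewrite -[- v]add0r; apply: LB.
split.
- by move=> x Lx /=; rewrite -[v]opprK; apply: LB.
- by move=> x y _ _; apply: addIr.
- by move=> x Lx; exists (x - v); rewrite ?subrK //; apply: LB.
Qed.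

Section Short.
Variable kap : R.
Hypothesis kap0 : 0 < kap.
Hypothesis Ldens : forall a : 'I_d -> R, (forall i, 0 < a i) -> exists p (s : seq 'rV[R]_d),
  [/\ uniq s, {subset s <= L `&` hbox p a} & kap * \prod_i a i <= (size s)%:R].

(** Suppose that the vectors of [L] in the box [T * w] are orthogonal to [v].
    The coordinate [i0] where [`|v i| * w i] is largest is then controlled by
    the others, so that two points of [L] in a translate of the box, lying in
    the same cell of a grid of mesh [eta * w i] in the other coordinates, have
    a difference of norm form below [c] and coincide. The translate would
    contain at most about [(2 T / eta) ^ (d - 1)] points, fewer than the [kap
    * T ^ d] that density provides for [T] large. *)
Lemma short_not_hyperplane : exists2 T, 1 <= T & forall w : 'I_d -> R,
  (forall i, 0 < w i) -> \prod_i w i = 1 -> forall v : 'rV[R]_d,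
  (forall x, L x -> (forall i, `|x 0 i| <= T * w i) -> \sum_i v 0 i * x 0 i = 0) -> v = 0.
Proof.
pose eta := Num.min 1 c / 2 / d%:R.
have d0 : 0 < d%:R :> R by rewrite ltr0n.
have m0 : 0 < Num.min 1 c by rewrite lt_min ltr01.
have eta0 : 0 < eta by rewrite !divr_gt0.
have etad : d%:R * eta = Num.min 1 c / 2 by rewrite /eta mulrC divfK // gt_eqF.
(* [eta] is chosen for the product of the coordinate bounds [d * eta * w i] to
   fall below [c]. *)
have etac : (d%:R * eta) ^+ d < c.
  rewrite etad; apply: (@le_lt_trans _ _ (Num.min 1 c / 2)).
    rewrite exprS ler_piMr ?divr_ge0 ?(ltW m0) // exprn_ile1 ?divr_ge0 ?(ltW m0) //.
    have : Num.min 1 c <= 1 by rewrite ge_min lexx.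
    have := m0; lra.
  have : Num.min 1 c <= c by rewrite ge_min lexx orbT.
  by lra.
have eta1 : eta <= 1.
  rewrite /eta ler_pdivrMr // mul1r; apply: (@le_trans _ _ 1); last by rewrite ler1n.
  have : Num.min 1 c <= 1 by rewrite ge_min lexx.
  by lra.
clearbody eta.
(* With this [T], [(2 T / eta) ^+ d'] is smaller than [kap * T ^+ d]. *)
pose T := 1 + (2 / eta) ^+ d' / kap.
have T1 : 1 <= T by rewrite lerDl divr_ge0 ?exprn_ge0 ?divr_ge0 // ltW.
exists T => // w w0 w1 v vH; apply/eqP/negPn/negP => vn0.
have T0 : 0 < T by apply: lt_le_trans T1.
have Tw0 i : 0 < T * w i by rewrite mulr_gt0.
have [p [s [us sL ds]]] := Ldens Tw0.
move: ds; rewrite big_split /= w1 mulr1 big_const_ord iter_mulr_1.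
apply/negP; rewrite -ltNge.
pose K := (Num.truncn (T / eta)).+1.
have KT : K%:R <= T / eta * 2.
  rewrite /K -natr1 mulr2n mulrDr !mulr1 lerD //; last by rewrite ler_pdivlMr // mul1r (le_trans eta1).
  by have /andP[] := truncn_itv (ltW (divr_gt0 T0 eta0)).
apply: (@le_lt_trans _ _ (K%:R ^+ d')); last first.
  apply: (@le_lt_trans _ _ ((T / eta * 2) ^+ d')).
    apply: lerXn2r => //; rewrite nnegrE ?ler0n //.
    by rewrite mulr_ge0 // divr_ge0 // ltW.
  rewrite (_ : T / eta * 2 = T * (2 / eta)); last by ring.
  rewrite exprMn exprS mulrA [ltRHS]mulrC ltr_pM2l ?exprn_gt0 //.
  rewrite [kap * T]mulrC -ltr_pdivrMr // /T.
  by set z := _ / kap; lra.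
rewrite -natrX ler_nat.
have -> : (K ^ d')%N = #|{ffun 'I_d' -> 'I_K}| by rewrite card_ffun !card_ord.
have [i0 _ i0max] : exists2 i0 : 'I_d, true & forall i, `|v 0 i| * w i <= `|v 0 i0| * w i0.
  case: (@Order.TotalTheory.arg_maxP _ _ 'I_d 0 predT (fun i => `|v 0 i| * w i)) => // i _ H.
  by exists i => // j; apply: H.
have vi0 : 0 < `|v 0 i0|.
  rewrite normr_gt0; apply: contraNneq vn0 => vi; apply/eqP/rowP => i; rewrite mxE.
  have := i0max i; rewrite vi normr0 mul0r => h.
  have /eqP : `|v 0 i| * w i = 0 by apply/le_anti; rewrite h mulr_ge0 // ltW.
  by rewrite mulf_eq0 normr_eq0 (gt_eqF (w0 i)) orbF => /eqP.
pose q (x : 'rV[R]_d) i := (x 0 i - p i) / (eta * w i).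
pose f (x : 'rV[R]_d) : {ffun 'I_d' -> 'I_K} := [ffun j => inord (Num.truncn (q x (lift i0 j)))].
apply: (@uniq_size_inj _ _ f) => // x y xs ys fxy.
have := sL x xs; have := sL y ys; rewrite !inE => -[Ly hy] [Lx hx].
have qb z i : hbox p (fun i => T * w i) z -> 0 <= q z i < K%:R.
  move=> /(_ i)/andP[h1 h2]; rewrite /q divr_ge0 ?subr_ge0 ?mulr_ge0 ?(ltW (w0 _)) ?(ltW eta0) //=.
  apply: (@le_lt_trans _ _ (T / eta)); last exact: truncnS_gt.
  rewrite ler_pdivrMr ?mulr_gt0 // mulrA divfK ?gt_eqF //; lra.
apply: admissible_sep => //.
have small i : i != i0 -> `|x 0 i - y 0 i| <= eta * w i.
  move=> ii0; have [j Ej] : exists j, i = lift i0 j.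
    by case: (unliftP i0 i) ii0 => [j ->|->]; [exists j | rewrite eqxx].
  have := congr1 (fun g : {ffun 'I_d' -> 'I_K} => val (g j)) fxy.
  rewrite !ffunE /= -Ej.
  have /andP[x1 x2] := qb x i hx; have /andP[y1 y2] := qb y i hy.
  rewrite !inordK ?truncn_lt_nat // => /(truncn_close x1 y1).
  rewrite /q -mulrBl normrM normfV (gtr0_norm (mulr_gt0 eta0 (w0 i))) ltr_pdivrMr ?mulr_gt0 // mul1r.
  by rewrite (_ : x 0 i - p i - (y 0 i - p i) = x 0 i - y 0 i); [move/ltW|ring].
have all i : `|x 0 i - y 0 i| <= d%:R * eta * w i.
  have [->|ii0] := eqVneq i i0; last first.
    apply: le_trans (small _ ii0) _; rewrite -mulrA ler_peMl ?mulr_ge0 ?(ltW (w0 _)) ?(ltW eta0) //.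
    by rewrite ler1n.
  have /vH : L (x - y) by apply: LB.
  have xyT i1 : `|(x - y) 0 i1| <= T * w i1.
    rewrite !mxE; have /andP[? ?] := hx i1; have /andP[? ?] := hy i1.
    by rewrite ler_norml; apply/andP; split; lra.
  move=> /(_ xyT); rewrite (bigD1 i0) //= => /eqP; rewrite addr_eq0 => /eqP E.
  rewrite -(ler_pM2l vi0) -normrM.
  have -> : `|v 0 i0 * (x 0 i0 - y 0 i0)| = `|v 0 i0 * (x - y) 0 i0| by rewrite !mxE.
  rewrite E normrN; apply: le_trans (ler_norm_sum _ _ _) _.
  apply: (@le_trans _ _ (\sum_(i < d | i != i0) eta * (`|v 0 i0| * w i0))).
    apply: ler_sum => i1 i1i0; rewrite normrM !mxE.
    apply: (@le_trans _ _ (`|v 0 i1| * (eta * w i1))); first by rewrite ler_wpM2l // small.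
    by rewrite mulrCA ler_wpM2l // ltW.
  rewrite sumr_const -[X in X <= _]mulr_natl (_ : `|v 0 i0| * (d%:R * eta * w i0) = d%:R * (eta * (`|v 0 i0| * w i0))); last by ring.
  rewrite ler_wpM2r ?mulr_ge0 ?(ltW (w0 _)) ?(ltW eta0) //.
  by rewrite ler_nat -[leqRHS]card_ord max_card.
apply: le_lt_trans etac.
apply: (@le_trans _ _ (\prod_i (d%:R * eta * w i))).
  by apply: ler_prod => i _; rewrite normr_ge0 all.
by rewrite big_split /= w1 mulr1 big_const_ord iter_mulr_1.
Qed.

(** A substitute for the theorem of Minkowski on successive minima: since the
    norm form is bounded below, the box [w] of volume 1 may be arbitrarily
    elongated and [T] still does not depend on it. *)
Lemma short_vectors : exists2 T, 1 <= T & forall w : 'I_d -> R,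
  (forall i, 0 < w i) -> \prod_i w i = 1 -> exists b : 'I_d -> 'rV[R]_d,
  [/\ forall j, L (b j), forall j i, `|b j 0 i| <= T * w i &
      forall v : 'rV[R]_d, exists u : 'I_d -> R, v = \sum_j u j *: b j].
Proof.
have [T T1 HT] := short_not_hyperplane; exists T => // w w0 w1.
pose B := L `&` [set x : 'rV[R]_d | forall i, `|x 0 i| <= T * w i].
have finB : finite_set B.
  apply: (@sub_finite_set _ _ (L `&` hbox (fun i => - (T * w i)) (fun i => 3 * (T * w i)))).
    move=> x [Lx /= hx]; split=> // i; have := hx i; rewrite ler_norml => /andP[? ?].
    have : 0 < T * w i by rewrite mulr_gt0 // (lt_le_trans _ T1).
    lra.
  exact: admissible_box_finite.
have [s sB] := (@finite_seqP _ B).1 finB.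
have Bs x : B x <-> x \in s by rewrite sB.
pose A : 'M[R]_(size s, d) := \matrix_(k, i) (nth 0 s k) 0 i.
have fullA : row_full A.
  rewrite -[row_full A]/(_ == _) -mxrank_tr; apply/negPn/negP => nf.
  have : kermx A^T != 0 by rewrite kermx_eq0.
  case/matrix0Pn => i0 [j0 vn0].
  have E : row i0 (kermx A^T) != 0.
    by apply: contraNneq vn0 => /rowP/(_ j0); rewrite !mxE => ->.
  move/eqP: E; apply; apply: (HT w w0 w1) => x Lx hx.
  have /Bs xs : B x by [].
  have : row i0 (kermx A^T) *m A^T = 0 by rewrite -row_mul mulmx_ker row0.
  have xk : (index x s < size s)%N by rewrite index_mem.
  move=> /rowP/(_ (Ordinal xk)); rewrite !mxE => H; rewrite -[RHS]H; apply: eq_bigr => i _.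
  by rewrite !mxE /= nth_index.
pose g := fullrankfun fullA; pose M : 'M[R]_d := rowsub g A.
have uM : M \in unitmx by rewrite -row_full_unit; exact: fullrowsub_full.
have rM j : row j M = nth 0 s (g j) by apply/rowP => i; rewrite !mxE.
exists (fun j => row j M); split.
- by move=> j; rewrite rM; have /Bs[] : nth 0 s (g j) \in s by rewrite mem_nth.
- move=> j i; rewrite rM; have /Bs[_] : nth 0 s (g j) \in s by rewrite mem_nth.
  by apply.
- move=> v; exists (fun j => (v *m invmx M) 0 j); rewrite -mulmx_sum_row.
  by rewrite mulmxKV.
Qed.
End Short.
End Admissible.

(** * Oscillation of smooth sums over a lattice *)

Section Periodic.
Variable R : realType.

Lemma sd_trunc s s' (C lam : R) f : (s' <= s)%N -> sd s C lam f -> sd s' C lam f.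
Proof.
move=> /subnK <-; elim: (s - s')%N => // n IH; rewrite addSn => /sd_drop; exact: IH.
Qed.

Lemma iter_shiftdiff_periodic n h (psi : R -> R) : (forall u, psi (u + 1) = psi u) ->
  forall u, iter n (shiftdiff h) psi (u + 1) = iter n (shiftdiff h) psi u.
Proof.
move=> per; elim: n => //= n IH u; rewrite /shiftdiff.
by rewrite (_ : u + 1 + h = u + h + 1) ?IH //; ring.
Qed.

Lemma iter_shiftdiff_supp n h (psi : R -> R) u : iter n (shiftdiff h) psi u != 0 ->
  exists2 k, (k <= n)%N & psi (u + k%:R * h) != 0.
Proof.
elim: n u => [|n IH] u /=; first by exists 0%N; rewrite // mul0r addr0.
rewrite /shiftdiff => H.
have [E|/IH[k kn Hk]] := eqVneq (iter n (shiftdiff h) psi (u + h)) 0.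
  have /IH[k kn Hk] : iter n (shiftdiff h) psi u != 0.
    by move: H; rewrite E sub0r oppr_eq0.
  by exists k => //; apply: leq_trans kn _.
exists k.+1 => //; move: Hk; congr (psi _ != 0); rewrite -natr1; ring.
Qed.

Lemma telescope_step (phi : R -> R) h n u :
  \sum_(k < n) shiftdiff h phi (u + k%:R * h) = phi (u + n%:R * h) - phi u.
Proof.
elim: n => [|n IH]; first by rewrite big_ord0 mul0r addr0 subrr.
rewrite big_ord_recr /= IH /shiftdiff -natr1 mulrDl mul1r !addrA; ring.
Qed.

Lemma step_bound (phi : R -> R) h B : (forall u, `|shiftdiff h phi u| <= B) ->
  forall n u, `|phi (u + n%:R * h) - phi u| <= n%:R * B.
Proof.
move=> H n u; rewrite -telescope_step; apply: le_trans (ler_norm_sum _ _ _) _.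
apply: le_trans (_ : \sum_(k < n) B <= _); first by apply: ler_sum.
by rewrite sumr_const card_ord mulr_natl.
Qed.

(** With step [h = 1 / N] the values of a difference of a 1-periodic function
    along one period sum to zero, so that each of them is at most [N] times
    the bound for the next difference. Descending from order [s.+1] to order 1
    costs the factor [N ^ s], which [h ^ s] compensates; adding up at most [N]
    first differences gives [D]. The Lipschitz constant [Lp] deals with points
    off the grid and disappears as [N] grows. *)
Lemma periodic_osc (psi : R -> R) s D Lp : 
  (forall u, psi (u + 1) = psi u) ->
  (forall h u, 0 < h <= 1 -> `|iter s.+1 (shiftdiff h) psi u| <= D * h ^+ s.+1) ->
  (forall h u, 0 < h <= 1 -> `|shiftdiff h psi u| <= Lp * h) ->
  forall u v, `|psi v - psi u| <= D.
Proof.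
move=> per HD HL u v.
have D0 : 0 <= D.
  have := HD 1 0; rewrite ltr01 lexx expr1n mulr1 => /(_ isT); exact: le_trans.
have Lp0 : 0 <= Lp.
  have := HL 1 0; rewrite ltr01 lexx mulr1 => /(_ isT); exact: le_trans.
have perz (z : int) w : psi (w + z%:~R) = psi w.
  have pn n w' : psi (w' + n%:R) = psi w'.
    by elim: n => [|n IH]; rewrite ?addr0 // -natr1 addrA per.
  case: z => n; first exact: pn.
  by rewrite NegzE mulrNz -[in RHS](subrK n.+1%:R w) pn.
rewrite -(perz (- Num.floor (v - u)) v); set v' := v + (- _)%:~R.
have v'E : v' = u + (v - u - (Num.floor (v - u))%:~R).
  by rewrite /v' mulrNz; ring.
have /andP[fl1 fl2] := floor_itv (v - u).
set t := v - u - _ in v'E; have t0 : 0 <= t by rewrite subr_ge0.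
have t1 : t < 1 by move: fl2; rewrite intrD /t; lra.
rewrite v'E; apply/ler_addgt0Pr => e e0.
pose N := (Num.truncn (Lp / e)).+1.
have N0 : 0 < N%:R :> R by rewrite ltr0n.
have NL : Lp / N%:R <= e.
  rewrite ler_pdivrMr // mulrC -ler_pdivrMr //; exact/ltW/truncnS_gt.
pose h : R := N%:R^-1.
have h01 : 0 < h <= 1 by rewrite invr_gt0 N0 invf_le1 // ler1n.
have Nh : N%:R * h = 1 by rewrite mulfV // gt_eqF.
have h0 : 0 <= h by case/andP: h01 => /ltW.
have down j w : (j <= s)%N -> `|iter (s - j).+1 (shiftdiff h) psi w| <= D * h ^+ (s - j).+1.
  elim: j w => [|j IH] w js; first by rewrite subn0; apply: HD.
  set m := (s - j.+1)%N; have Em : (s - j)%N = m.+1 by rewrite /m subnSK.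
  rewrite Em in IH; set phi := iter m.+1 (shiftdiff h) psi.
  have IH' w' : `|shiftdiff h phi w'| <= D * h ^+ m.+2 by apply: IH (ltnW js).
  have S0 : \sum_(k < N) phi (w + k%:R * h) = 0.
    rewrite /phi /= telescope_step Nh iter_shiftdiff_periodic // subrr //.
  have E : N%:R * phi w = \sum_(k < N) (phi w - phi (w + k%:R * h)).
    by rewrite sumrB S0 subr0 sumr_const card_ord mulr_natl.
  rewrite -(ler_pM2l N0) -[X in X * `| _ |]normr_nat -normrM E.
  apply: le_trans (ler_norm_sum _ _ _) _.
  apply: (@le_trans _ _ (\sum_(k < N) D * h ^+ m.+1)).
    apply: ler_sum => k _; rewrite distrC.
    apply: le_trans (step_bound IH' _ _) _.
    rewrite [h ^+ m.+2]exprS mulrCA ler_wpM2l // mulrA ler_piMl ?exprn_ge0 //.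
    by rewrite -[leRHS]Nh ler_wpM2r // ler_nat ltnW.
  by rewrite sumr_const card_ord mulr_natl.
have H1 w : `|shiftdiff h psi w| <= D * h.
  by have := down s w (leqnn s); rewrite subnn.
pose k := Num.truncn (t * N%:R).
have tN0 : 0 <= t * N%:R by rewrite mulr_ge0 // ltW.
have /andP[k1 k2] := truncn_itv tN0; rewrite -/k in k1 k2.
have kN : k%:R <= N%:R :> R by apply: le_trans k1 _; rewrite ler_piMl ?(ltW t1) // ltW.
rewrite (_ : _ - _ = (psi (u + t) - psi (u + k%:R * h)) + (psi (u + k%:R * h) - psi u)); last by ring.
rewrite [leRHS]addrC; apply: le_trans (ler_normD _ _) _; apply: lerD; last first.
  apply: le_trans (step_bound H1 _ _) _.
  by rewrite mulrCA ler_piMr // -[leRHS]Nh ler_wpM2r.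
apply: le_trans NL.
have kt : k%:R * h <= t by rewrite ler_pdivrMr.
have [<-|kt'] := eqVneq (k%:R * h) t; first by rewrite subrr normr0 divr_ge0 // ltW.
have tk : 0 < t - k%:R * h <= h.
  rewrite subr_gt0 lt_neqAle kt' kt /= lerBlDr -[X in X + _]mul1r -mulrDl addrC natr1.
  by rewrite ler_pdivlMr // ltW.
have := HL (t - k%:R * h) (u + k%:R * h); rewrite /shiftdiff.
rewrite (_ : u + k%:R * h + (t - k%:R * h) = u + t); last by ring.
case/andP: tk => -> tkh; case/andP: h01 => _ h1; rewrite (le_trans tkh h1) => /(_ isT).
by move=> /le_trans; apply; rewrite ler_wpM2l.
Qed.
End Periodic.

Section Tensor.
Variables (R : realType) (d' : nat).
Local Notation d := d'.+1.
Variables (L : set 'rV[R]_d) (c : R).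
Hypothesis c0 : 0 < c.
Hypothesis LB : forall x y, L x -> L y -> L (x - y).
Hypothesis LN : forall x, L x -> x != 0 -> c <= \prod_i `|x 0 i|.

Definition tens (g : 'I_d -> R -> R) (p a : 'I_d -> R) (x : 'rV[R]_d) : R :=
  \prod_i g i ((x 0 i - p i) / a i).

Definition tensum g p a := latsum L (tens g p a).

Definition unitsupp (g : R -> R) := forall t, g t != 0 -> 0 <= t < 1.

Lemma tens_supp g p a x : (forall i, 0 < a i) -> (forall i, unitsupp (g i)) ->
  tens g p a x != 0 -> hbox p a x.
Proof.
move=> a0 gs; rewrite /tens => /prodf_neq0 H i.
have /gs/andP[] := H i isT; rewrite ler_pdivlMr // mul0r ltr_pdivrMr // mul1r; lra.
Qed.

Lemma tens_bsupp g p a : (forall i, 0 < a i) -> (forall i, unitsupp (g i)) ->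
  bsupp (tens g p a).
Proof. by move=> a0 gs; exists p, a => x; apply: tens_supp. Qed.

Lemma tensum_crude A g p a : (forall i, 0 < a i) -> (forall i, unitsupp (g i)) ->
  (forall i t, `|g i t| <= A) -> `|tensum g p a| <= A ^+ d * ((\prod_i a i) / c + 1).
Proof.
move=> a0 gs gA; apply: (latsum_le c0 LB LN (p := p)) => //; first by move=> x; apply: tens_supp.
move=> x; rewrite /tens normr_prod.
apply: le_trans (_ : \prod_(i < d) A <= _); first by apply: ler_prod => i _; rewrite normr_ge0 gA.
by rewrite big_const_ord iter_mulr_1.
Qed.

Lemma iter_shiftdiff_latsum n h (F : 'rV[R]_d -> R -> R) :
  (forall u, bsupp (F^~ u)) ->
  (forall u, bsupp (fun x => iter n (shiftdiff h) (F x) u)) /\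
  iter n (shiftdiff h) (fun u => latsum L (F^~ u)) =1
    (fun u => latsum L (fun x => iter n (shiftdiff h) (F x) u)).
Proof.
move=> bF; elim: n => [|n [IH1 IH2]] //=; split=> u.
  have := bsuppD (IH1 (u + h)) (bsuppZ (-1) (IH1 u)).
  by congr bsupp; apply/funext => x; rewrite mulN1r.
by rewrite {1}/shiftdiff !IH2 -(latsumB c0 LB LN).
Qed.

Section Smooth.
Variable kap : R.
Hypothesis kap0 : 0 < kap.
Hypothesis Ldens : forall a : 'I_d -> R, (forall i, 0 < a i) -> exists p (s : seq 'rV[R]_d),
  [/\ uniq s, {subset s <= L `&` hbox p a} & kap * \prod_i a i <= (size s)%:R].

(** The box is scaled to volume 1 by the factor [M = V ^ (1 / d)]. Along a
    lattice vector which is short for the scaled box the bump varies at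
    frequency [T / M], so that its differences of order [2 d] are of size [M
    ^- (2 d) = V ^- 2], while [O(V)] points of [L] contribute: the sum is
    within [O(1 / V)] of a constant along each of [d] independent directions. *)
Lemma smooth_osc A : 0 <= A -> exists2 C, 0 <= C & forall g p p' a,
  (forall i, 0 < a i) -> (forall i, unitsupp (g i)) -> (forall i, sd (2 * d) A 1 (g i)) ->
  1 <= \prod_i a i -> `|tensum g p' a - tensum g p a| <= C / \prod_i a i.
Proof.
move=> A0; have [T T1 HT] := short_vectors c0 LB LN kap0 Ldens.
have T0 : 0 < T by apply: lt_le_trans T1.
pose s := (2 * d)%N; have sE : s = (s.-1).+1 by [].
(* The points where an iterated difference is nonzero lie in the box enlarged
   by [s] steps on both sides, hence [K]. *)
pose K := (1 + 2 * s%:R * T); have K0 : 0 < K.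
  by rewrite /K addr_gt0 // ?mulr_gt0 // ltr0n.
pose C2 := K ^+ d / c + 1; pose C1 := (2 ^+ s * A) ^+ d.
have C10 : 0 <= C1 by rewrite exprn_ge0 // mulr_ge0 // exprn_ge0.
have C20 : 0 <= C2 by rewrite addr_ge0 // divr_ge0 ?exprn_ge0 // ltW.
pose C3 := C1 * T ^+ s * C2.
have C30 : 0 <= C3 by rewrite !mulr_ge0 // exprn_ge0 // ltW.
exists (d%:R * C3); first by rewrite mulr_ge0.
move=> g p p' a a0 gs gsd V1; set V := \prod_i a i in V1 *.
have V0 : 0 < V by apply: lt_le_trans V1.
pose M := V `^ (d%:R^-1).
have M1 : 1 <= M.
  have -> : 1 = (1 : R) `^ (d%:R^-1) by rewrite powR1.
  by apply: ge0_ler_powR => //; rewrite ?nnegrE ?invr_ge0 ?ler0n ?(ltW V0).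
have M0 : 0 < M by apply: lt_le_trans M1.
have MV : M ^+ d = V.
  by rewrite /M -powR_mulrn ?powR_ge0 // -powRrM mulVf ?pnatr_eq0 // powRr1 // ltW.
have wV : \prod_i (a i / M) = 1.
  rewrite big_split /= big_const_ord iter_mulr_1 exprVn MV mulfV //; exact: lt0r_neq0.
have w0 i : 0 < a i / M by rewrite divr_gt0.
have [b [Lb bT bspan]] := HT _ w0 wV.
clearbody M.
have one j p0 u : `|tensum g (fun i => p0 i - u * b j 0 i) a - tensum g p0 a| <= C3 / V.
  pose F (x : 'rV[R]_d) (v : R) := \prod_i g i ((b j 0 i / a i) * v + (x 0 i - p0 i) / a i).
  pose psi v := latsum L (F^~ v).
  have tensF x v : F x v = tens g (fun i => p0 i - v * b j 0 i) a x.
    apply: eq_bigr => i _; congr (g i _); field; exact: lt0r_neq0.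
  have psiE v : psi v = tensum g (fun i => p0 i - v * b j 0 i) a.
    by congr latsum; apply/funext => x; rewrite tensF.
  have bF v : bsupp (F^~ v).
    rewrite (_ : F^~ v = tens g (fun i => p0 i - v * b j 0 i) a); first exact: tens_bsupp.
    by apply/funext => x; rewrite tensF.
  have lam0 : 0 <= T / M by rewrite divr_ge0 // ltW.
  have sdF x : sd s C1 (T / M) (F x).
    have := @sd_prod R 'I_d (index_enum 'I_d) s A (T / M) (fun i v => g i ((b j 0 i / a i) * v + (x 0 i - p0 i) / a i)) lam0.
    rewrite -[size _]/(size (index_enum _)) [size _](_ : _ = d); last first.
      by rewrite -[RHS]card_ord cardT enumT.
    apply=> i; apply: sd_affine => //.
    rewrite normrM normfV (gtr0_norm (a0 i)) ler_pdivrMr //.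
    by apply: le_trans (bT j i) _; rewrite mulrA mulrAC.
  have it n h v : (n <= s)%N -> 0 < h <= 1 ->
      `|iter n (shiftdiff h) psi v| <= C1 * (T / M * h) ^+ n * (C2 * V).
    move=> ns /andP[h0 h1]; have [_ ->] := iter_shiftdiff_latsum n h bF.
    have Ka i : 0 < K * a i by rewrite mulr_gt0.
    pose pp i := p0 i - v * b j 0 i - s%:R * T * a i.
    apply: le_trans (latsum_le c0 LB LN (p := pp) (F := C1 * (T / M * h) ^+ n) Ka _ _) _.
    - move=> x /iter_shiftdiff_supp[k kn]; rewrite tensF => /(tens_supp a0 gs) hx i.
      have /andP[h2 h3] := hx i.
      have kb : `|k%:R * h * b j 0 i| <= s%:R * T * a i.
        rewrite !normrM normr_nat (gtr0_norm h0) -!mulrA ler_pM ?mulr_ge0 ?(ltW h0) //.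
          by rewrite ler_nat (leq_trans kn).
        rewrite -[leRHS]mul1r ler_pM ?(ltW h0) //; apply: le_trans (bT j i) _.
        by rewrite ler_wpM2l ?(ltW T0) // ler_pdivrMr // ler_peMr // ltW.
      move: kb; rewrite ler_norml => /andP[kb1 kb2].
      rewrite /pp /K; move: h2 h3; rewrite !mulrDl mul1r => h2 h3.
      apply/andP; split; lra.
    - move=> x; have := sd_iter h (sd_trunc ns (sdF x)) v.
      by rewrite (gtr0_norm h0).
    have nn : 0 <= C1 * (T / M * h) ^+ n.
      by apply: mulr_ge0 => //; apply: exprn_ge0; apply: mulr_ge0 => //; exact: ltW.
    rewrite ler_wpM2l //.
    have -> : \prod_(i < d) (K * a i) = K ^+ d * V.
      by rewrite big_split /= big_const_ord iter_mulr_1.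
    rewrite /C2 mulrDl mul1r mulrAC.
    by rewrite lerD2l.
  rewrite -psiE (_ : tensum g p0 a = psi 0); last first.
    by rewrite psiE; congr tensum; apply/funext => i; rewrite mul0r subr0.
  apply: (@periodic_osc R psi s.-1 (C3 / V) (C1 * (T / M) * (C2 * V))).
  - move=> v; transitivity (latsum L (fun x => F (x + b j) v)); last exact: (latsum_shift LB (F^~ v)).
    congr latsum; apply/funext => x.
    apply: eq_bigr => i _; congr (g i _); rewrite mxE; field; exact: lt0r_neq0.
  - move=> h v h01; rewrite -sE; apply: le_trans (it s h v (leqnn s) h01) _.
    rewrite !exprMn exprVn.
    have -> : M ^+ s = V ^+ 2 by rewrite /s mulnC exprM MV.
    rewrite le_eqVlt; apply/orP; left; apply/eqP; rewrite /C3.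
    by field; exact: lt0r_neq0.
  - move=> h v h01; have := it 1%N h v isT h01; rewrite expr1 /=.
    by move=> /le_trans; apply; rewrite le_eqVlt; apply/orP; left; apply/eqP; ring.
pose v : 'rV[R]_d := \row_i (p i - p' i).
have [u vE] := bspan v.
have tel (r : seq 'I_d) p0 :
    `|tensum g (fun i => p0 i - (\sum_(j <- r) u j *: b j) 0 i) a - tensum g p0 a| <= (size r)%:R * (C3 / V).
  elim: r p0 => [|j r IH] p0.
    rewrite big_nil mul0r (_ : (fun i => _) = p0) ?subrr ?normr0 //.
    by apply/funext => i; rewrite mxE subr0.
  have := lerD (IH (fun i => p0 i - u j * b j 0 i)) (one j p0 (u j)).
  rewrite /= -natr1 mulrDl mul1r; apply: le_trans.
  rewrite (_ : (fun i => p0 i - (\sum_(j <- j :: r) u j *: b j) 0 i) =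
    (fun i => p0 i - u j * b j 0 i - (\sum_(j <- r) u j *: b j) 0 i)).
    by apply: le_trans (ler_normD _ _); rewrite le_eqVlt; apply/orP; left; apply/eqP; congr `| _ |; ring.
  by apply/funext => i; rewrite big_cons !mxE; ring.
have := tel (index_enum 'I_d) p; rewrite -vE (_ : (fun i => _) = p'); last first.
  by apply/funext => i; rewrite mxE; ring.
rewrite [size _](_ : _ = d) ?mulrA //.
by rewrite -[RHS]card_ord cardT enumT.
Qed.

End Smooth.

(** * Dyadic decomposition of an interval *)

Section Dyadic.
Definition chi (t : R) : R := (0 <= t < 1)%R%:R.

Variables (theta : R -> R).
Hypothesis th0 : forall t : R, t <= 0 -> theta t = 0.
Hypothesis th1 : forall t, 1 / 4%:R <= t -> theta t = 1.
Hypothesis th01 : forall t, 0 <= theta t <= 1.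

Definition wmid t := theta t * theta (1 - t).
Definition qleft t := theta (2 * t) - theta t.
Definition qright t := qleft (1 - t).
Definition rleft t := if 0 <= t then 1 - theta t else 0.
Definition rright t := if t < 1 then 1 - theta (1 - t) else 0.

(** At a step of the induction the sharp left end at scale [2 ^- J] is the
    smooth bump [qleft] at that scale plus a sharp end half as wide; likewise
    on the right. *)
Lemma chi_decomp J t : chi t = wmid t +
   \sum_(j < J) (qleft (2 ^+ j * t) + qright (2 ^+ j * t - (2 ^+ j - 1))) +
   (rleft (2 ^+ J * t) + rright (2 ^+ J * t - (2 ^+ J - 1))).
Proof.
elim: J => [|J ->].
  rewrite big_ord0 addr0 expr0 mul1r subrr subr0 /chi /wmid /rleft /rright.
  case: (leP 0 t) => t0 /=; last first.
    by rewrite (th0 (ltW t0)) mul0r !add0r (lt_trans t0 ltr01) th1 ?subrr //; lra.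
  case: (ltP t 1) => t1 /=; last first.
    by rewrite (th0 (_ : 1 - t <= 0)) ?subr_le0 // mulr0 add0r addr0 th1 ?subrr //; lra.
  case: (lerP (1 / 4) t) => t4; first by rewrite (th1 t4); ring.
  by rewrite (@th1 (1 - t)); [ring|lra].
rewrite big_ord_recr /= -!addrA; congr (_ + (_ + _)).
have p2 : 0 < 2 ^+ J :> R by rewrite exprn_gt0.
have E1 : rleft (2 ^+ J * t) = qleft (2 ^+ J * t) + rleft (2 ^+ J.+1 * t).
  rewrite exprS -mulrA; move: (2 ^+ J * t) => v; rewrite /rleft /qleft.
  rewrite pmulr_rge0 //; case: leP => v0; first by ring.
  by rewrite !th0 ?subrr ?addr0 // ltW // pmulr_rlt0.
have E2 : rright (2 ^+ J * t - (2 ^+ J - 1)) = qright (2 ^+ J * t - (2 ^+ J - 1)) +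
     rright (2 ^+ J.+1 * t - (2 ^+ J.+1 - 1)).
  rewrite /rright /qright /qleft exprS.
  have -> : 1 - (2 ^+ J * t - (2 ^+ J - 1)) = 2 ^+ J * (1 - t) by ring.
  have -> : 1 - (2 * 2 ^+ J * t - (2 * 2 ^+ J - 1)) = 2 * (2 ^+ J * (1 - t)) by ring.
  have -> : (2 ^+ J * t - (2 ^+ J - 1) < 1) = (0 < 2 ^+ J * (1 - t)).
    by rewrite -[RHS]subr_gt0 -[LHS]subr_gt0; congr (0 < _); ring.
  have -> : (2 * 2 ^+ J * t - (2 * 2 ^+ J - 1) < 1) = (0 < 2 ^+ J * (1 - t)).
    rewrite -[LHS]subr_gt0 (_ : 1 - _ = 2 * (2 ^+ J * (1 - t))); last by ring.
    by rewrite pmulr_rgt0.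
  move: (2 ^+ J * (1 - t)) => v; case: ltP => v0; first by ring.
  by rewrite !th0 ?subrr ?addr0 // pmulr_rle0.
by rewrite E1 E2 /qright /qleft; ring.
Qed.

Lemma unitsupp_chi : unitsupp chi.
Proof. by move=> t; rewrite /chi; case: (_ <= _ < _); rewrite ?eqxx. Qed.

Lemma unitsupp_wmid : unitsupp wmid.
Proof.
move=> t; apply: contraNT => /nandP[]; rewrite -?ltNge -?leNgt => t0; rewrite /wmid.
  by rewrite th0 ?mul0r // ltW.
by rewrite (@th0 (1 - t)) ?mulr0 // subr_le0.
Qed.

Lemma qleft_supp t : qleft t != 0 -> 0 < t < 1.
Proof.
apply: contraNT => /nandP[]; rewrite -?leNgt -?leNgt => t0; rewrite /qleft.
  by rewrite !th0 ?subrr // pmulr_rle0.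
by rewrite !th1 ?subrr //; lra.
Qed.

Lemma unitsupp_qleft : unitsupp qleft.
Proof. by move=> t /qleft_supp; lra. Qed.

Lemma unitsupp_qright : unitsupp qright.
Proof. by move=> t /qleft_supp; lra. Qed.

Lemma unitsupp_rleft : unitsupp rleft.
Proof.
move=> t; rewrite /rleft; case: (leP 0 t) => t0; last by rewrite eqxx.
move=> H /=; rewrite ltNge; apply: contraNN H => t1.
by rewrite th1 ?subrr //; lra.
Qed.

Lemma unitsupp_rright : unitsupp rright.
Proof.
move=> t; rewrite /rright; case: (ltP t 1) => t0; last by rewrite eqxx.
move=> H; rewrite andbT leNgt; apply: contraNN H => t1.
by rewrite th1 ?subrr //; lra.
Qed.

Lemma rleft_le1 t : `|rleft t| <= 1.
Proof.
rewrite /rleft; case: (leP 0 t) => _; last by rewrite normr0.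
by have /andP[? ?] := th01 t; rewrite ler_norml; apply/andP; split; lra.
Qed.

Lemma rright_le1 t : `|rright t| <= 1.
Proof.
rewrite /rright; case: (ltP t 1) => _; last by rewrite normr0.
by have /andP[? ?] := th01 (1 - t); rewrite ler_norml; apply/andP; split; lra.
Qed.

Definition upd (T : Type) (i0 : 'I_d) (z : T) (f : 'I_d -> T) : 'I_d -> T :=
  fun i => if i == i0 then z else f i.

Lemma tens_upd (i0 : 'I_d) (f : R -> R) (g : 'I_d -> R -> R) (p a : 'I_d -> R) (x : 'rV[R]_d) :
  tens (upd i0 f g) p a x = f ((x 0 i0 - p i0) / a i0) * \prod_(i < d | i != i0) g i ((x 0 i - p i) / a i).
Proof.
rewrite /tens (bigD1 i0) //= {1}/upd eqxx; congr (_ * _).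
by apply: eq_bigr => i /negbTE ii0; rewrite /upd ii0.
Qed.

Lemma prod_upd (i0 : 'I_d) (z : R) (a : 'I_d -> R) (k : R) : z = a i0 * k -> \prod_i upd i0 z a i = (\prod_i a i) * k.
Proof.
move=> ->; rewrite (bigD1 i0) //= {1}/upd eqxx [in RHS](bigD1 i0) //= mulrAC; congr (_ * _ * _).
by apply: eq_bigr => i /negbTE ii0; rewrite /upd ii0.
Qed.

Lemma tens_upd_scale (i0 : 'I_d) (f : R -> R) (g : 'I_d -> R -> R) (p a : 'I_d -> R) (x : 'rV[R]_d) (k o : R) : 0 < k -> a i0 != 0 ->
  f (k * ((x 0 i0 - p i0) / a i0) - o) * \prod_(i < d | i != i0) g i ((x 0 i - p i) / a i) =
  tens (upd i0 f g) (upd i0 (p i0 + a i0 * o / k) p) (upd i0 (a i0 * k^-1) a) x.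
Proof.
move=> k0 a0; rewrite tens_upd; congr (f _ * _).
  by rewrite /upd eqxx; field; rewrite a0 gt_eqF.
by apply: eq_bigr => i /negbTE ii0; rewrite /upd ii0.
Qed.

Lemma upd_P (T : Type) (P : 'I_d -> T -> Prop) i0 z f : P i0 z -> (forall i, i != i0 -> P i (f i)) ->
  forall i, P i (upd i0 z f i).
Proof. by move=> Pz Pf i; rewrite /upd; have [->|ii0] := eqVneq i i0; [|apply: Pf]. Qed.

(** In the box, a profile of width [2 ^- j] on the edge [i0] is a profile of
    width 1 on an edge [2 ^ j] times shorter. *)
Lemma tensum_expand (g : 'I_d -> R -> R) (i0 : 'I_d) (p a : 'I_d -> R) J : (forall i, 0 < a i) -> (forall i, i != i0 -> unitsupp (g i)) -> g i0 = chi ->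
  tensum g p a = tensum (upd i0 wmid g) p a + 
   (\sum_(j < J) (tensum (upd i0 qleft g) (upd i0 (p i0 + a i0 * 0 / 2 ^+ j) p) (upd i0 (a i0 * (2 ^+ j)^-1) a) +
                  tensum (upd i0 qright g) (upd i0 (p i0 + a i0 * (2 ^+ j - 1) / 2 ^+ j) p) (upd i0 (a i0 * (2 ^+ j)^-1) a)) +
   (tensum (upd i0 rleft g) (upd i0 (p i0 + a i0 * 0 / 2 ^+ J) p) (upd i0 (a i0 * (2 ^+ J)^-1) a) +
                  tensum (upd i0 rright g) (upd i0 (p i0 + a i0 * (2 ^+ J - 1) / 2 ^+ J) p) (upd i0 (a i0 * (2 ^+ J)^-1) a))).
Proof.
move=> a0 gs gi0.
have p2 j : 0 < 2 ^+ j :> R by rewrite exprn_gt0.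
have ua j : forall i, 0 < upd i0 (a i0 * (2 ^+ j)^-1) a i.
  by apply: (@upd_P _ (fun _ (x : R) => 0 < x)) => //; rewrite divr_gt0.
have us f : unitsupp f -> forall i, unitsupp (upd i0 f g i).
  by move=> uf; apply: (@upd_P _ (fun _ (x : R -> R) => unitsupp x)).
have B f j q : unitsupp f -> bsupp (tens (upd i0 f g) q (upd i0 (a i0 * (2 ^+ j)^-1) a)).
  by move=> uf; apply: tens_bsupp => //; exact: us.
have Bw : bsupp (tens (upd i0 wmid g) p a).
  by apply: tens_bsupp => //; apply: us; exact: unitsupp_wmid.
have uq := unitsupp_qleft. have uq' := unitsupp_qright.
have ur := unitsupp_rleft. have ur' := unitsupp_rright.
rewrite /tensum.
under [in RHS]eq_bigr => j _ do rewrite -(latsumD c0 LB LN (B _ _ _ uq) (B _ _ _ uq')).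
have Bj := fun (j : 'I_J) => bsuppD (B _ j (upd i0 (p i0 + a i0 * 0 / 2 ^+ j) p) uq)
   (B _ j (upd i0 (p i0 + a i0 * (2 ^+ j - 1) / 2 ^+ j) p) uq').
have [Bs <-] := latsum_sum c0 LB LN (index_enum 'I_J) Bj.
have Br := bsuppD (B _ J (upd i0 (p i0 + a i0 * 0 / 2 ^+ J) p) ur)
   (B _ J (upd i0 (p i0 + a i0 * (2 ^+ J - 1) / 2 ^+ J) p) ur').
rewrite -(latsumD c0 LB LN (B _ _ _ ur) (B _ _ _ ur')) -(latsumD c0 LB LN Bs Br).
rewrite -(latsumD c0 LB LN Bw (bsuppD Bs Br)); congr latsum; apply/funext => x.
have ai0 : a i0 != 0 by rewrite gt_eqF.
have -> : g = upd i0 chi g by apply/funext => i; rewrite /upd; case: eqP => // ->.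
have EE f j o : tens (upd i0 f (upd i0 chi g)) (upd i0 (p i0 + a i0 * o / 2 ^+ j) p) (upd i0 (a i0 * (2 ^+ j)^-1) a) x =
   f (2 ^+ j * ((x 0 i0 - p i0) / a i0) - o) * \prod_(i < d | i != i0) g i ((x 0 i - p i) / a i).
  rewrite -tens_upd_scale //; congr (_ * _); apply: eq_bigr => i /negbTE ii0; by rewrite /upd ii0.
under eq_bigr => j _ do rewrite !EE.
rewrite !EE !tens_upd (chi_decomp J).
set P := \prod_(i < d | i != i0) _.
have -> : \prod_(i < d | i != i0) upd i0 chi g i ((x 0 i - p i) / a i) = P.
  by apply: eq_bigr => i /negbTE ii0; rewrite /upd ii0.
rewrite !mulrDl mulr_suml -!addrA; congr (_ + _); congr (_ + _).
  by apply: eq_bigr => j _; rewrite mulrDl subr0.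
by rewrite subr0.
Qed.

Definition osc g p p' a := `|tensum g p' a - tensum g p a|.

(** The sharp ends left over at scale [2 ^- J] live in boxes of volume [2 ^-
    J] times the original one, and are estimated by the number of points
    alone. *)
Lemma osc_expand A (g : 'I_d -> R -> R) (i0 : 'I_d) (p p' a : 'I_d -> R) J (Bd : nat -> R) : (forall i, 0 < a i) -> (forall i, unitsupp (g i)) -> g i0 = chi ->
  1 <= A -> (forall i t, `|g i t| <= A) ->
  (forall p p', osc (upd i0 wmid g) p p' a <= Bd 0%N) ->
  (forall f j p p', (f = qleft \/ f = qright) -> (j < J)%N ->
     osc (upd i0 f g) p p' (upd i0 (a i0 * (2 ^+ j)^-1) a) <= Bd j) ->
  osc g p p' a <= Bd 0%N + \sum_(j < J) (2 * Bd j) + 4 * (A ^+ d * ((\prod_i a i) / 2 ^+ J / c + 1)).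
Proof.
move=> a0 gs gi0 A1 gA Hw Hq.
have gs' i : i != i0 -> unitsupp (g i) by [].
rewrite /osc (tensum_expand p J a0 gs' gi0) (tensum_expand p' J a0 gs' gi0).
set W := tensum (upd i0 wmid g) p a; set W' := tensum (upd i0 wmid g) p' a.
set S := \sum_(j < J) _; set S' := \sum_(j < J) _.
set r1 := tensum _ _ _; set r2 := tensum _ _ _; set r1' := tensum _ _ _; set r2' := tensum _ _ _.
have H1 : `|W' - W| <= Bd 0%N by apply: Hw.
have H2 : `|S' - S| <= \sum_(j < J) (2 * Bd j).
  rewrite /S' /S -sumrB; apply: le_trans (ler_norm_sum _ _ _) _.
  apply: ler_sum => j _; rewrite opprD addrACA mulr_natl mulr2n.
  apply: le_trans (ler_normD _ _) _; apply: lerD; apply: Hq => //; by [left|right].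
have p2 : 0 < 2 ^+ J :> R by rewrite exprn_gt0.
have cr f q : unitsupp f -> (forall t, `|f t| <= 1) ->
   `|tensum (upd i0 f g) q (upd i0 (a i0 * (2 ^+ J)^-1) a)| <= A ^+ d * ((\prod_i a i) / 2 ^+ J / c + 1).
  move=> uf f1; rewrite -(@prod_upd i0 (a i0 * (2 ^+ J)^-1)) //; apply: tensum_crude.
  - by apply: (@upd_P _ (fun _ (x : R) => 0 < x)) => //; rewrite divr_gt0.
  - by apply: (@upd_P _ (fun _ (x : R -> R) => unitsupp x)).
  - apply: (@upd_P _ (fun _ (x : R -> R) => forall t, `|x t| <= A)) => // t.
    exact: le_trans A1.
move: (cr rleft) => /(_ _ unitsupp_rleft rleft_le1) c1.
move: (cr rright) => /(_ _ unitsupp_rright rright_le1) c2.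
have h1 := c1 (upd i0 (p' i0 + a i0 * 0 / 2 ^+ J) p'); rewrite -/r1 in h1.
have h2 := c2 (upd i0 (p' i0 + a i0 * (2 ^+ J - 1) / 2 ^+ J) p'); rewrite -/r2 in h2.
have h3 := c1 (upd i0 (p i0 + a i0 * 0 / 2 ^+ J) p); rewrite -/r1' in h3.
have h4 := c2 (upd i0 (p i0 + a i0 * (2 ^+ J - 1) / 2 ^+ J) p); rewrite -/r2' in h4.
move: H1 H2 h1 h2 h3 h4; rewrite !ler_norml => /andP[? ?] /andP[? ?] /andP[? ?] /andP[? ?] /andP[? ?] /andP[? ?].
by apply/andP; split; lra.
Qed.

End Dyadic.
End Tensor.

(** * Discrepancy between translates of a box *)

Section BoxDiscrepancy.
Variables (R : realType) (d' : nat).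
Local Notation d := d'.+1.
Variables (L : set 'rV[R]_d) (c : R).
Hypothesis c0 : 0 < c.
Hypothesis LB : forall x y, L x -> L y -> L (x - y).
Hypothesis LN : forall x, L x -> x != 0 -> c <= \prod_i `|x 0 i|.
Variable kap : R.
Hypothesis kap0 : 0 < kap.
Hypothesis Ldens : forall a : 'I_d -> R, (forall i, 0 < a i) -> exists p (s : seq 'rV[R]_d),
  [/\ uniq s, {subset s <= L `&` hbox p a} & kap * \prod_i a i <= (size s)%:R].

Lemma bump_family s : exists2 A, 1 <= A & exists theta : R -> R,
  [/\ forall t, t <= 0 -> theta t = 0,
      forall t, 1 / 4%:R <= t -> theta t = 1, forall t, 0 <= theta t <= 1 &
      [/\ sd s A 1 (wmid theta), sd s A 1 (qleft theta) & sd s A 1 (qright theta)]].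
Proof.
have [A0 A1 [theta [sdt t0 t1 t01]]] := smooth_step R s.
have A00 : 0 <= A0 by apply: le_trans A1.
have p1 : 1 <= 2 ^+ s :> R by rewrite exprn_ege1 // ler1n.
pose A := 2 ^+ s * (A0 * A0) + (A0 * 2 ^+ s + A0).
have hA : 0 <= A0 * 2 ^+ s by rewrite mulr_ge0 // exprn_ge0.
have hB : 0 <= 2 ^+ s * (A0 * A0) by rewrite mulr_ge0 ?mulr_ge0 // exprn_ge0.
exists A; first by rewrite /A; lra.
exists theta; split=> //.
have refl f : sd s A0 1 f -> sd s A0 1 (fun t => f (1 - t)).
  move=> H; have := sd_affine H (_ : `|-1| <= 1) 1; rewrite normrN1 => /(_ (lexx _)).
  by apply: sd_ext => t; rewrite mulN1r addrC.
have sq : sd s (A0 * 2 ^+ s + A0) 1 (qleft theta).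
  have h1 : sd s (A0 * 2 ^+ s) 1 (fun t => theta (2 * t)).
    apply: sd_unscale; first by rewrite ler1n.
    have := sd_affine sdt (_ : `|2| <= 2) 0; rewrite normr_nat => /(_ (lexx _)).
    by apply: sd_ext => t; rewrite addr0.
  have := sd_add h1 (sd_scale (-1) sdt); rewrite normrN1 mul1r.
  by apply: sd_ext => t; rewrite mulN1r.
have sq' : sd s A 1 (qleft theta) by apply: sd_le sq; rewrite /A //; lra.
split=> //.
- by apply: sd_le (sd_mul _ sdt (refl _ sdt)); rewrite /A //; lra.
- have := sd_affine sq' (_ : `|-1| <= 1) 1; rewrite normrN1 => /(_ (lexx _)).
  by apply: sd_ext => t; rewrite /qright mulN1r addrC.
Qed.

Lemma sum_pow2 n : \sum_(j < n) (2 : R) ^+ j = 2 ^+ n - 1.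
Proof.
elim: n => [|n IH]; first by rewrite big_ord0 expr0 subrr.
by rewrite big_ord_recr /= IH exprS; ring.
Qed.

Lemma log2_bracket (V : R) m : 1 <= V -> V < 2 ^+ m.+1 ->
  exists2 k, (k <= m)%N & 2 ^+ k <= V < 2 ^+ k.+1.
Proof.
move=> V1; elim: m => [|m IH] Vm; first by exists 0%N; rewrite ?expr0 ?V1.
case: (ltP V (2 ^+ m.+1)) => [/IH[k km Hk]|H]; first by exists k => //; apply: leqW.
by exists m.+1 => //; rewrite H.
Qed.

(** Induction on the number of sharp factors. With a single one, [smooth_osc]
    gives [C0 * 2 ^+ j / V] for the pieces at scale [2 ^- j], and the sum over
    [2 ^+ j <= V] is bounded. With one more sharp factor, the pieces at each
    of [m.+1] scales are covered by the previous case, their volume being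
    smaller. *)
Lemma osc_induction A theta k : 1 <= A ->
  (forall t : R, t <= 0 -> theta t = 0) -> (forall t, 1 / 4%:R <= t -> theta t = 1) ->
  (forall t, 0 <= theta t <= 1) ->
  let bumpset f := [\/ f = wmid theta, f = qleft theta | f = qright theta] in
  (forall f, bumpset f -> sd (2 * d) A 1 f) ->
  (k < d)%N ->
  exists2 C, 0 <= C & forall (g : 'I_d -> R -> R) p p' a m, (forall i, 0 < a i) ->
    (forall i : 'I_d, (i <= k)%N -> g i = @chi R) ->
    (forall i : 'I_d, (k < i)%N -> bumpset (g i)) ->
    \prod_i a i < 2 ^+ m.+1 -> osc L g p p' a <= C * m.+1%:R ^+ k.
Proof.
move=> A1 th0 th1 th01 bumpset bsd; have A0 : 0 <= A by apply: le_trans A1.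
have bsupp f : bumpset f -> unitsupp f.
  by case=> ->; [exact: unitsupp_wmid|exact: unitsupp_qleft|exact: unitsupp_qright].
have chiA t : `|chi t| <= A.
  apply: le_trans A1; rewrite /chi; case: (_ <= _ < _); rewrite ?normr0 ?normr1 ?ler01 //.
have [C0 C00 HC0] := smooth_osc c0 LB LN kap0 Ldens A0.
pose Cr := 4 * (A ^+ d * (1 / c + 1)).
have Cr0 : 0 <= Cr by rewrite !mulr_ge0 ?exprn_ge0 // addr_ge0 // divr_ge0 // ltW.
have gA n (g : 'I_d -> R -> R) : (forall i : 'I_d, (i <= n)%N -> g i = @chi R) ->
    (forall i : 'I_d, (n < i)%N -> bumpset (g i)) -> (forall i, unitsupp (g i)) /\ (forall i t, `|g i t| <= A).
  move=> g1 g2; split=> i; case: (leqP i n) => [/g1 ->|/g2 gi] //.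
  - exact: unitsupp_chi.
  - exact: bsupp.
  - by move=> t; apply: sd_bound (bsd _ gi).
have crude V J : V < 2 ^+ J -> 4 * (A ^+ d * (V / 2 ^+ J / c + 1)) <= Cr.
  move=> VJ; rewrite /Cr ler_wpM2l // ler_wpM2l ?exprn_ge0 // lerD2r ler_wpM2r ?invr_ge0 ?(ltW c0) //.
  by rewrite ler_pdivrMr ?exprn_gt0 // mul1r ltW.
have qb f : f = qleft theta \/ f = qright theta -> bumpset f.
  by case=> ->; [exact: Or32|exact: Or33].
have wb : bumpset (wmid theta) by exact: Or31.
have aj (a : 'I_d -> R) i0 j : (forall i, 0 < a i) -> forall i, 0 < upd i0 (a i0 * (2 ^+ j)^-1) a i.
  by move=> a0; apply: (@upd_P _ _ (fun _ (x : R) => 0 < x)) => //; rewrite divr_gt0 // exprn_gt0.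
elim: k => [|k IH] kd.
- exists (C0 * 5 + Cr); first by rewrite addr_ge0 // mulr_ge0.
  move=> g p p' a m a0 g1 g2 Vm; rewrite expr0 mulr1.
  have [us ub] := gA 0%N g g1 g2; set V := \prod_i a i in Vm *.
  have V0 : 0 < V by apply: prodr_gt0.
  have g0 : g ord0 = @chi R by apply: g1.
  have allb f : bumpset f -> forall i, bumpset (upd ord0 f g i).
    move=> bf; apply: (@upd_P _ _ (fun _ x => bumpset x)) => // i i0; apply: g2.
    by rewrite lt0n; apply: contraNneq i0 => i0; apply/eqP/val_inj.
  have base f a' q q' : bumpset f -> (forall i, 0 < a' i) -> 1 <= \prod_i a' i ->
      osc L (upd ord0 f g) q q' a' <= C0 / \prod_i a' i.
    by move=> bf a'0 V1; apply: HC0 => // i; [apply: bsupp|apply: bsd]; apply: allb.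
  (* A box of volume below 1 contains boundedly many points. *)
  case: (ltP V 1) => V1.
    apply: le_trans (_ : Cr <= _); last by rewrite lerDr mulr_ge0.
    rewrite /osc; apply: le_trans (ler_normB _ _) _.
    have cr q := tensum_crude c0 LB LN q a0 us ub.
    apply: le_trans (lerD (cr p') (cr p)) _; rewrite -/V.
    have h : V / c + 1 <= 1 / c + 1 by rewrite lerD2r ler_wpM2r ?invr_ge0 ?ltW.
    have h2 := ler_wpM2l (exprn_ge0 d A0) h.
    have h3 : 0 <= A ^+ d * (1 / c + 1) by apply: mulr_ge0; rewrite ?exprn_ge0 // addr_ge0 // divr_ge0 // ltW.
    rewrite /Cr; lra.
  (* The scales [j <= n] are those whose pieces still have volume at least 1,
     as [smooth_osc] requires. *)
  have [n nm /andP[n1 n2]] := log2_bracket V1 Vm.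
  pose Bd j := C0 * 2 ^+ j / V.
  apply: le_trans (osc_expand c0 LB LN th0 th1 th01 (J := n.+1) (Bd := Bd) p p' a0 us g0 A1 ub _ _) _.
  + by move=> q q'; rewrite /Bd expr0 mulr1; apply: base.
  + move=> f j q q' /qb bf jn; rewrite /Bd -mulrA.
    have E : \prod_i upd ord0 (a ord0 * (2 ^+ j)^-1) a i = V * (2 ^+ j)^-1 by rewrite (@prod_upd _ _ _ _ _ (2 ^+ j)^-1).
    have -> : 2 ^+ j / V = (\prod_i upd ord0 (a ord0 * (2 ^+ j)^-1) a i)^-1.
      by rewrite E invfM invrK mulrC.
    apply: base => //; first exact: aj.
    rewrite E ler_pdivlMr ?exprn_gt0 // mul1r; apply: le_trans n1.
    by rewrite ler_eXn2l // ltr1n.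
  + apply: lerD; last exact: crude.
    rewrite /Bd expr0 mulr1 -mulr_sumr -mulr_suml -mulr_sumr sum_pow2.
    have h1 : C0 / V <= C0 by rewrite ler_pdivrMr // ler_peMr.
    have h2 : C0 * (2 ^+ n.+1 - 1) / V <= C0 * 2.
      rewrite ler_pdivrMr // -mulrA ler_wpM2l // exprS.
      by have := exprn_gt0 n (ltr0n R 2); lra.
    lra.
- have [Ck Ck0 HCk] := IH (ltnW kd).
  exists (3 * Ck + Cr); first by rewrite addr_ge0 // mulr_ge0.
  move=> g p p' a m a0 g1 g2 Vm; set V := \prod_i a i in Vm *.
  have [us ub] := gA k.+1 g g1 g2.
  have V0 : 0 < V by apply: prodr_gt0.
  pose i0 : 'I_d := Ordinal kd.
  have g0 : g i0 = @chi R by apply: g1.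
  have base f a' q q' : bumpset f -> (forall i, 0 < a' i) -> \prod_i a' i <= V ->
      osc L (upd i0 f g) q q' a' <= Ck * m.+1%:R ^+ k.
    move=> bf a'0 V1; apply: HCk => //; last exact: le_lt_trans V1 Vm.
    - move=> i ik; rewrite /upd; case: eqP => [E|_]; last by apply: g1; apply: leqW.
      by move: ik; rewrite E /= ltnn.
    - move=> i ik; rewrite /upd; case: eqP => // /eqP E; apply: g2.
      by rewrite ltn_neqAle ik andbT; apply: contraNneq E => E; apply/eqP/val_inj.
  apply: le_trans (osc_expand c0 LB LN th0 th1 th01 (J := m.+1) (Bd := fun=> Ck * m.+1%:R ^+ k) p p' a0 us g0 A1 ub _ _) _.
  + by move=> q q'; apply: base.
  + move=> f j q q' /qb bf jn; apply: base => //; first exact: aj.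
    rewrite (@prod_upd _ _ _ _ _ (2 ^+ j)^-1) // ler_piMr ?(ltW V0) // invf_le1 ?exprn_gt0 //.
    by rewrite exprn_ege1 // ler1n.
  + rewrite sumr_const card_ord.
    have h1 := crude V m.+1 Vm; rewrite -/V in h1 *.
    have m1 : 1 <= m.+1%:R :> R by rewrite ler1n.
    have h2 : Cr <= Cr * m.+1%:R ^+ k.+1 by rewrite ler_peMr // exprn_ege1.
    have h3 : 0 <= Ck * m.+1%:R ^+ k by rewrite mulr_ge0 // exprn_ge0.
    have h4 : Ck * m.+1%:R ^+ k <= Ck * m.+1%:R ^+ k.+1.
      by rewrite ler_wpM2l // exprS ler_peMl // exprn_ge0.
    set X := Ck * m.+1%:R ^+ k; rewrite -/X in h3 h4.
    have E : Ck * m.+1%:R ^+ k.+1 = m.+1%:R * X by rewrite exprS /X; ring.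
    rewrite E in h4.
    have -> : (3 * Ck + Cr) * m.+1%:R ^+ k.+1 = 3 * (m.+1%:R * X) + Cr * m.+1%:R ^+ k.+1.
      by rewrite mulrDl -[3 * Ck * _]mulrA E.
    rewrite -[(2 * X) *+ m.+1]mulr_natl.
    have -> : m.+1%:R * (2 * X) = 2 * (m.+1%:R * X) by ring.
    lra.
Qed.

Lemma tensum_chi p a : (forall i, 0 < a i) ->
  tensum L (fun=> @chi R) p a = (cnt (L `&` hbox p a))%:R.
Proof.
move=> a0; rewrite /tensum (latsum_box c0 LB LN (p := p) (a := a)); last first.
  by move=> x; apply: tens_supp => // i; exact: unitsupp_chi.
rewrite (eq_big_seq (fun=> 1)); last first.
  move=> x; rewrite in_fset_set ?inE; last exact: (admissible_box_finite c0 LB LN).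
  move=> [_ hx]; rewrite /tens big1 // => i _; rewrite /chi.
  by have /andP[h1 h2] := hx i; rewrite divr_ge0 ?subr_ge0 ?(ltW (a0 i)) //= ltr_pdivrMr // mul1r ltrBlDr addrC h2.
by rewrite big_const_seq count_predT iter_addr addr0.
Qed.

Theorem box_discrepancy : exists2 C, 0 <= C & forall p p' a m, (forall i, 0 < a i) ->
  \prod_i a i < 2 ^+ m.+1 ->
  `|(cnt (L `&` hbox p' a))%:R - (cnt (L `&` hbox p a))%:R : R| <= C * m.+1%:R ^+ d'.
Proof.
have [A A1 [theta [th0 th1 th01 [s1 s2 s3]]]] := bump_family (2 * d).
have [|C C0 HC] := osc_induction A1 th0 th1 th01 _ (ltnSn d').
  by move=> f [] ->.
exists C => // p p' a m a0 Vm.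
rewrite -!tensum_chi //; apply: (HC (fun=> @chi R) p p' a m) => // i.
by rewrite ltnNge -ltnS ltn_ord.
Qed.
End BoxDiscrepancy.

(** * Orthonormal frames and boxes *)

Section DotAlgebra.
Variables (R : realType) (E : vectType R) (dot : {dot E for idfun}).

Lemma dotC u v : dot u v = dot v u.
Proof. by rewrite (hermC (theta := idfun)) expr0 mul1r. Qed.
Lemma dotDl u v w : dot (u + v) w = dot u w + dot v w.
Proof. exact: linearDl. Qed.
Lemma dotBl u v w : dot (u - v) w = dot u w - dot v w.
Proof. exact: linearBl. Qed.
Lemma dotBr u v w : dot w (u - v) = dot w u - dot w v.
Proof. exact: linearBr. Qed.
Lemma dotZl a u w : dot (a *: u) w = a * dot u w.
Proof. exact: linearZl_LR. Qed.
Lemma dotZr a u w : dot w (a *: u) = a * dot w u.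
Proof. exact: linearZr_LR. Qed.
Lemma dot0l w : dot 0 w = 0.
Proof. exact: linear0l. Qed.
Lemma dot0r w : dot w 0 = 0.
Proof. exact: linear0r. Qed.
Lemma dot_suml (I : Type) (r : seq I) (P : pred I) f w :
  dot (\sum_(i <- r | P i) f i) w = \sum_(i <- r | P i) dot (f i) w.
Proof. exact: linear_sumlz. Qed.
Lemma dot_sumr (I : Type) (r : seq I) (P : pred I) f w :
  dot w (\sum_(i <- r | P i) f i) = \sum_(i <- r | P i) dot w (f i).
Proof. exact: linear_sumr. Qed.
Lemma dot_gt0 u : u != 0 -> 0 < dot u u.
Proof. exact: neq0_dnorm_gt0. Qed.
Lemma dot_ge0 u : 0 <= dot u u.
Proof. by have [->|/dot_gt0/ltW//] := eqVneq u 0; rewrite dot0l. Qed.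
Lemma dot_eq0 u : dot u u = 0 -> u = 0.
Proof. by move=> u0; apply/eqP; apply: contra_eqT u0 => /dot_gt0; rewrite lt0r => /andP[]. Qed.

Lemma dot_CauchySchwarz u v : dot u v ^+ 2 <= dot u u * dot v v.
Proof.
have [->|v0] := eqVneq v 0; first by rewrite !dot0r expr0n /= mulr0.
have vv := dot_gt0 v0; set t := dot u v / dot v v.
have := dot_ge0 (u - t *: v).
rewrite dotBl !dotBr !dotZl !dotZr [dot v u]dotC.
have -> : dot u u - t * dot u v - (t * dot u v - t * (t * dot v v)) = dot u u - dot u v ^+ 2 / dot v v.
  by rewrite /t; field; rewrite gt_eqF.
by rewrite subr_ge0 ler_pdivrMr.
Qed.

Lemma orthonormalP_ij d (e : d.-tuple E) :
  orthonormal dot e <-> forall i j, dot (tnth e i) (tnth e j) = (i == j)%:R.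
Proof.
have po (s : seq E) : pair_ortho_rec dot s <->
    forall i j, (i < j < size s)%N -> dot (nth 0 s i) (nth 0 s j) = 0.
  elim: s => [|x s IH] /=; first by split=> // _ i j; rewrite ltn0 andbF.
  rewrite andbT; split.
    move=> /andP[/allP h1 /IH h2] [|i] [|j] //= ij; last by apply: h2.
    by apply/eqP/h1; rewrite mem_nth.
  move=> H; apply/andP; split.
    apply/allP => y /(nthP 0)[j js <-]; apply/eqP.
    exact: (H 0%N j.+1).
  by apply/IH => i j ij; apply: (H i.+1 j.+1).
rewrite /orthonormal; split.
  move=> /andP[/allP h1 /po h2] i j; have [<-|ij] := eqVneq i j.
    by apply/eqP/h1; rewrite mem_tnth.
  rewrite !(tnth_nth 0); wlog ij' : i j ij / (i < j)%N => [W|].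
    case: (ltngtP i j) => [|ji|/val_inj E2]; first exact: W.
      by rewrite dotC; apply: W; rewrite // eq_sym.
    by rewrite E2 eqxx in ij.
  by apply: h2; rewrite ij' size_tuple ltn_ord.
move=> H; apply/andP; split.
  by apply/allP => x /tnthP[i ->] /=; rewrite H eqxx.
apply/po => i j /andP[ij js]; rewrite size_tuple in js.
have := H (Ordinal (ltn_trans ij js)) (Ordinal js).
by rewrite !(tnth_nth 0) /= => ->; rewrite -val_eqE /= ltn_eqF.
Qed.

Lemma orthobasisP (W : {vspace E}) (e : (\dim W).-tuple E) : orthobasis dot e <->
  (forall j, tnth e j \in W) /\ (forall i j, dot (tnth e i) (tnth e j) = (i == j)%:R).
Proof.
split=> [[b o]|[h1 h2]].
  by split; [move=> j; apply: (basis_mem b); rewrite mem_tnth|exact/orthonormalP_ij].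
split; last exact/orthonormalP_ij.
rewrite basisEfree size_tuple leqnn andbT; apply/andP; split; last first.
  by apply/span_subvP => x /tnthP[i ->].
apply/freeP => k k0 i; have := congr1 (fun x => dot x (tnth e i)) k0.
rewrite dot0l dot_suml (bigD1 i) //= -tnth_nth dotZl h2 eqxx mulr1 big1 ?addr0 //.
by move=> j ji; rewrite -tnth_nth dotZl h2 (negbTE ji) mulr0.
Qed.

Section OB.
Variables (W : {vspace E}) (e : (\dim W).-tuple E).
Hypothesis oe : orthobasis dot e.
Local Notation d := (\dim W).

Lemma ob_mem j : tnth e j \in W. Proof. by have /orthobasisP[] := oe. Qed.
Lemma ob_dot i j : dot (tnth e i) (tnth e j) = (i == j)%:R.
Proof. by have /orthobasisP[] := oe. Qed.

Definition comb (t : 'I_d -> R) : E := \sum_(j < d) t j *: tnth e j.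

Lemma comb_mem t : comb t \in W.
Proof. by apply: memv_suml => j _; rewrite memvZ // ob_mem. Qed.

Lemma dot_comb t j : dot (comb t) (tnth e j) = t j.
Proof.
rewrite dot_suml (bigD1 j) //= dotZl ob_dot eqxx mulr1 big1 ?addr0 // => i ij.
by rewrite dotZl ob_dot (negbTE ij) mulr0.
Qed.

Lemma ob_expand x : x \in W -> x = comb (fun j => dot x (tnth e j)).
Proof.
move=> xW; have [b _] := oe.
have xE : x = comb (fun i => coord e i x).
  by rewrite {1}(coord_basis b xW) /comb; apply: eq_bigr => i _; rewrite -tnth_nth.
by rewrite [in LHS]xE; congr comb; apply/funext => j; rewrite [in RHS]xE dot_comb.
Qed.

Lemma dot_expand x y : x \in W -> dot x y = \sum_j dot x (tnth e j) * dot y (tnth e j).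
Proof.
move=> xW; rewrite [in LHS](ob_expand xW) dot_suml; apply: eq_bigr => j _.
by rewrite dotZl [dot y _]dotC.
Qed.

Lemma cuboidP c l y : cuboid c e l y <->
  y - c \in W /\ forall j, 0 < dot (y - c) (tnth e j) < l j.
Proof.
split=> [[t tl <-]|[yW H]].
  by rewrite addrAC subrr add0r; split; [exact: comb_mem|move=> j; rewrite dot_comb].
exists (fun j => dot (y - c) (tnth e j)) => //.
by rewrite -[RHS](subrK c) addrC; congr (_ + _); exact/esym/ob_expand.
Qed.
End OB.
End DotAlgebra.

(** * The volume of a box *)

Lemma esumZ_le (R : realType) (I : choiceType) (D : set I) (k : R) (f : I -> R) : 0 <= k ->
  (\esum_(i in D) (k * f i)%:E <= k%:E * \esum_(i in D) (f i)%:E)%E.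
Proof.
move=> k0; apply: ge_ereal_sup => _ [X [finX XD] <-].
rewrite fsbig_finite //= sumEFin -mulr_sumr EFinM lee_wpmul2l ?lee_fin //.
by apply: esum_ge; exists X => //; rewrite fsbig_finite //= sumEFin.
Qed.

Section Vol.
Variables (R : realType) (E : vectType R) (dot : {dot E for idfun}) (W : {vspace E}).
Local Notation d := (\dim W).
Local Notation vol := (vol dot W).
Variable e0 : d.-tuple E.
Hypothesis oe0 : orthobasis dot e0.

(** Coverings indexed by any countable type; the definition of [vol] uses
    subsets of [nat]. *)
Lemma vol_cover (I : countType) (D : set I) (c : I -> E) (e : I -> d.-tuple E) (l : I -> 'I_d -> R) A :
  (forall k, orthobasis dot (e k)) -> (forall k j, 0 < l k j) ->
  A `<=` \bigcup_(k in D) cuboid (c k) (e k) (l k) ->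
  (vol A <= \esum_(k in D) (\prod_(j < d) l k j)%:E)%E.
Proof.
move=> oe l0 AD; apply: ereal_inf_lbound => /=.
exists (choice.pickle @` D), (fun n => if choice.unpickle n is Some k then c k else 0),
  (fun n => if choice.unpickle n is Some k then e k else e0),
  (fun n => if choice.unpickle n is Some k then l k else fun=> 1); split.
- by move=> n; case: (choice.unpickle n).
- by move=> n j; case: (choice.unpickle n).
- by move=> x /AD[k Dk Hk]; exists (choice.pickle k); [exists k|rewrite /= choice.pickleK].
- rewrite esum_image; first by apply: eq_esum => k _; rewrite choice.pickleK.
  by move=> k1 k2 _ _; apply: (pcan_inj choice.pickleK).
Qed.

Lemma vol_ge0 A : (0 <= vol A)%E.
Proof.
apply: le_ereal_inf_tmp => _ [D [c [e [l [_ l0 _ ->]]]]].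
by apply: esum_ge0 => k _; rewrite lee_fin prodr_ge0 // => j _; exact: ltW.
Qed.

Lemma vol_mono A B : A `<=` B -> (vol A <= vol B)%E.
Proof.
move=> AB; apply: le_ereal_inf_tmp => _ [D [c [e [l [oe l0 BD ->]]]]].
by apply: vol_cover => //; apply: subset_trans BD.
Qed.

Lemma vol_cuboid_le c e l : orthobasis dot e -> (forall j, 0 < l j) ->
  (vol (cuboid c e l) <= (\prod_(j < d) l j)%:E)%E.
Proof.
move=> oe l0; have := @vol_cover unit [set tt] (fun=> c) (fun=> e) (fun=> l) (cuboid c e l).
rewrite esum_set1; last by rewrite lee_fin prodr_ge0 // => j _; exact: ltW.
by apply => // x Hx; exists tt.
Qed.

Lemma vol_lt_cover A v : (vol A < v%:E)%E -> exists (D : set nat) c (e : nat -> d.-tuple E) l,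
  [/\ forall k, orthobasis dot (e k), forall k j, 0 < l k j,
      A `<=` \bigcup_(k in D) cuboid (c k) (e k) (l k) &
      (\esum_(k in D) (\prod_(j < d) l k j)%:E < v%:E)%E].
Proof.
by move=> /ereal_inf_lt[_ [D [c [e [l [oe l0 AD ->]]]]] H]; exists D, c, e, l.
Qed.

(** A strict bound on the volume of each piece provides a covering of it
    within that bound, so no error terms are to be summed. *)
Lemma vol_subadd (I : countType) (D : set I) (A : I -> set E) (v : I -> R) :
  (forall k, D k -> (vol (A k) < (v k)%:E)%E) ->
  (vol (\bigcup_(k in D) A k) <= \esum_(k in D) (v k)%:E)%E.
Proof.
move=> H.
have /choice[f Hf] k : exists f : set nat * (nat -> E) * (nat -> d.-tuple E) * (nat -> 'I_d -> R),
   [/\ forall i, orthobasis dot (f.1.2 i), forall i j, 0 < f.2 i j &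
   D k -> A k `<=` \bigcup_(i in f.1.1.1) cuboid (f.1.1.2 i) (f.1.2 i) (f.2 i) /\
      (\esum_(i in f.1.1.1) (\prod_(j < d) f.2 i j)%:E < (v k)%:E)%E].
  have [Dk|nDk] := pselect (D k); last first.
    by exists (set0, fun=> 0, fun=> e0, fun _ _ => 1); split.
  have [D' [c [e [l [oe l0 AD lv]]]]] := vol_lt_cover (H k Dk).
  by exists (D', c, e, l); split.
have := @vol_cover (I * nat)%type (D `*`` (fun k => (f k).1.1.1))
  (fun k => (f k.1).1.1.2 k.2) (fun k => (f k.1).1.2 k.2) (fun k => (f k.1).2 k.2)
  (\bigcup_(k in D) A k).
have Hc : \bigcup_(k in D) A k `<=` \bigcup_(k in D `*`` (fun k => (f k).1.1.1))
    cuboid ((f k.1).1.1.2 k.2) ((f k.1).1.2 k.2) ((f k.1).2 k.2).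
  move=> x [k Dk Ax]; have [_ _ /(_ Dk)[AD _]] := Hf k.
  by have [i Di Hi] := AD _ Ax; exists (k, i).
move=> /(_ _ _ Hc) H1; apply: le_trans (H1 _ _) _.
- by move=> k; have [] := Hf k.1.
- by move=> k; have [] := Hf k.1.
rewrite -(@esum_esum _ _ _ D (fun k => (f k).1.1.1) (fun k i => (\prod_(j < d) (f k).2 i j)%:E)).
  by apply: le_esum => k Dk; have [_ _ /(_ Dk)[_ /ltW]] := Hf k.
move=> k i _ _; have [_ l0 _] := Hf k.
by rewrite lee_fin prodr_ge0 // => j _; exact/ltW/l0.
Qed.

Section Similarity.
Variables (e e' : d.-tuple E) (c c' : E) (s : R).
Hypotheses (oe : orthobasis dot e) (oe' : orthobasis dot e') (s0 : 0 < s).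

(** The isometry of [W] that carries the frame [e] to [e']; it is precomposed
    with the projection onto [W]. *)
Definition frame_map (x : E) : E := comb e' (fun j => dot x (tnth e j)).
Definition simil (x : E) : E := c' + s *: frame_map (x - c).

Lemma frame_mapB x y : frame_map (x - y) = frame_map x - frame_map y.
Proof.
rewrite /frame_map /comb -sumrB; apply: eq_bigr => j _; by rewrite dotBl scalerBl.
Qed.

Lemma frame_mapD x y : frame_map (x + y) = frame_map x + frame_map y.
Proof.
rewrite /frame_map /comb -big_split; apply: eq_bigr => j _; by rewrite dotDl scalerDl.
Qed.

Lemma frame_mapZ a x : frame_map (a *: x) = a *: frame_map x.
Proof.
rewrite /frame_map /comb scaler_sumr; apply: eq_bigr => j _; by rewrite dotZl scalerA.
Qed.

Lemma frame_map_sum (I : Type) (r : seq I) f : frame_map (\sum_(i <- r) f i) = \sum_(i <- r) frame_map (f i).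
Proof.
elim: r => [|i r IH]; last by rewrite !big_cons frame_mapD IH.
by rewrite !big_nil; have := frame_mapB 0 0; rewrite !subrr.
Qed.

Lemma frame_map_dot x y : x \in W -> y \in W -> dot (frame_map x) (frame_map y) = dot x y.
Proof.
move=> xW yW; rewrite (dot_expand oe' _ (comb_mem oe' _)) (dot_expand oe _ xW).
by apply: eq_bigr => j _; rewrite !(dot_comb oe').
Qed.

Lemma frame_map_orthobasis f : orthobasis dot f -> orthobasis dot [tuple frame_map (tnth f j) | j < d].
Proof.
move=> /orthobasisP[fW ff]; apply/orthobasisP; split=> [j|i j].
  by rewrite tnth_mktuple; exact: (comb_mem oe').
by rewrite !tnth_mktuple frame_map_dot.
Qed.

Lemma simil_cuboid c1 f l : simil @` cuboid c1 f l `<=`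
  cuboid (simil c1) [tuple frame_map (tnth f j) | j < d] (fun j => s * l j).
Proof.
move=> _ [_ [t tl <-] <-]; exists (fun j => s * t j).
  by move=> j; have /andP[? ?] := tl j; rewrite mulr_gt0 // ltr_pM2l.
rewrite /simil [c1 + _ - c]addrAC [frame_map (c1 - c + _)]frame_mapD scalerDr addrA; congr (_ + _).
rewrite frame_map_sum scaler_sumr; apply: eq_bigr => j _.
by rewrite frame_mapZ tnth_mktuple scalerA.
Qed.

(** A similarity maps boxes to boxes, as [vol] allows all orientations, and
    multiplies their volumes by [s ^+ d]. *)
Lemma vol_simil A v : (vol A < v%:E)%E -> (vol (simil @` A) < (s ^+ d * v)%:E)%E.
Proof.
move=> /vol_lt_cover[D [c1 [f [l [of_ l0 AD lv]]]]].
apply: (@le_lt_trans _ _ ((s ^+ d)%:E * \esum_(k in D) (\prod_(j < d) l k j)%:E)%E); last first.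
  by rewrite EFinM lte_pmul2l // lte_fin exprn_gt0.
have l0' k : (0 <= (\prod_(j < d) l k j)%:E)%E.
  by rewrite lee_fin prodr_ge0 // => j _; exact/ltW.
apply: le_trans (_ : (\esum_(k in D) (s ^+ d * \prod_(j < d) l k j)%:E <= _)%E); last first.
  by apply: esumZ_le; rewrite ?exprn_ge0 ?ltW.
have -> : \esum_(k in D) (s ^+ d * \prod_(j < d) l k j)%:E = \esum_(k in D) (\prod_(j < d) (s * l k j))%:E.
  by apply: eq_esum => k _; rewrite big_split /= big_const_ord iter_mulr_1.
apply: (@vol_cover nat D (fun k => simil (c1 k)) (fun k => [tuple frame_map (tnth (f k) j) | j < d])).
- by move=> k; exact: frame_map_orthobasis.
- by move=> k j; rewrite mulr_gt0.
- move=> _ [x Ax <-]; have [k Dk Hk] := AD x Ax; exists k => //.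
  by apply: simil_cuboid; exists x.
Qed.

End Similarity.
End Vol.

Section Small.
Variable R : realType.

Lemma common_lbound (I : finType) (a : I -> R) : (forall i, 0 < a i) ->
  exists2 s : R, 0 < s <= 1 & forall i, s <= a i.
Proof.
move=> a0; have S0 : 0 <= \sum_i (a i)^-1 by apply: sumr_ge0 => i _; rewrite invr_ge0 ltW.
exists (1 + \sum_i (a i)^-1)^-1.
  by rewrite invr_gt0 invf_le1; lra.
move=> i; rewrite -[leRHS]invrK lef_pV2 ?posrE ?invr_gt0 //; last by lra.
rewrite (bigD1 i) //= addrCA lerDl addr_ge0 //.
by apply: sumr_ge0 => j _; rewrite invr_ge0 ltW.
Qed.

Lemma expr1D_le n (x : R) : 0 <= x <= 1 -> (1 + x) ^+ n <= 1 + 2 ^+ n * x.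
Proof.
move=> /andP[x0 x1].
have H : (1 + x) ^+ n <= 1 + (2 ^+ n - 1) * x.
  elim: n => [|n IH]; first by rewrite !expr0 subrr mul0r addr0.
  rewrite !exprS; have := ler_wpM2l (_ : 0 <= 1 + x) IH.
  move=> /(_ _)/le_trans; apply; first lra.
  have p1 : 1 <= 2 ^+ n :> R by rewrite exprn_ege1 // ler1n.
  have : 0 <= (2 ^+ n - 1) * x * (1 - x) by rewrite !mulr_ge0 // subr_ge0.
  by set P := 2 ^+ n; nra.
apply: le_trans H _; rewrite lerD2l ler_wpM2r //; lra.
Qed.

(** Approximation errors below are all powers of [1 + x] with [x] small. *)
Lemma le_limit (a C : R) n : 0 <= C -> (forall x, 0 < x <= 1 -> a <= C * (1 + x) ^+ n) -> a <= C.
Proof.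
move=> C0 H; apply/ler_addgt0Pr => e e0.
pose x := Num.min 1 (e / (2 ^+ n * (C + 1))).
have p0 : 0 < 2 ^+ n :> R by rewrite exprn_gt0.
have C1 : 0 < C + 1 by lra.
have x0 : 0 < x <= 1 by rewrite lt_min ltr01 divr_gt0 ?mulr_gt0 //= ge_min lexx.
apply: le_trans (H x x0) _.
apply: le_trans (ler_wpM2l C0 (expr1D_le n _)) _; first by case/andP: x0 => /ltW->.
rewrite mulrDr mulr1 lerD2l.
have : x <= e / (2 ^+ n * (C + 1)) by rewrite ge_min lexx orbT.
rewrite ler_pdivlMr ?mulr_gt0 //; apply: le_trans.
rewrite mulrA [leRHS]mulrA [C * _]mulrC [x * _]mulrC -!mulrA ler_wpM2l ?(ltW p0) //.
by case/andP: x0 => ? _; rewrite mulrC ler_wpM2l //; lra.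
Qed.

Lemma esum_cst_fin (I : finType) (C : R) : 0 <= C ->
  (\esum_(k in [set: I]) C%:E = (#|I|%:R * C)%:E)%E.
Proof.
move=> C0; rewrite esum_fset; [|exact: finite_finset|by move=> i _; rewrite lee_fin].
rewrite (fsbigE (enum I)) ?enum_uniq //; last by move=> i _; rewrite mem_enum.
rewrite (eq_bigl xpredT); last by move=> i; rewrite in_setT.
by rewrite sumEFin big_const_seq count_predT iter_addr addr0 -cardE mulr_natl.
Qed.

Lemma card_dffun_ord d (N : 'I_d -> nat) :
  #|{dffun forall j : 'I_d, 'I_(N j)}| = (\prod_(j < d) N j)%N.
Proof.
rewrite card_dep_ffun foldrE big_map big_enum /=.
by apply: eq_bigr => j _; rewrite card_ord.
Qed.

Lemma natr_prod_le d (N : 'I_d -> nat) (a : 'I_d -> R) :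
  (forall j, (N j)%:R <= a j) -> (\prod_(j < d) N j)%N%:R <= \prod_(j < d) a j.
Proof. by move=> H; rewrite natr_prod; apply: ler_prod => j _; rewrite ler0n H. Qed.
End Small.

Section Vol.
Variables (R : realType) (E : vectType R) (dot : {dot E for idfun}) (W : {vspace E}).
Local Notation d := (\dim W).
Local Notation vol := (vol dot W).
Variable e0 : d.-tuple E.
Hypothesis oe0 : orthobasis dot e0.

Lemma simil_comb (f e : d.-tuple E) c c' s t : orthobasis dot f ->
  simil dot f e c c' s (c + comb f t) = c' + comb e (fun j => s * t j).
Proof.
move=> of_; rewrite /simil [c + _]addrC addrK /frame_map /comb scaler_sumr; congr (_ + _).
by apply: eq_bigr => j _; rewrite (dot_comb of_) scalerA.
Qed.

(** Any box is tiled, with little waste, by translates of a small scaled copy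
    of any other box: the edges [l] are cut in steps [s * l1 j], and the
    copies, scaled by [s' = s * (1 + del)], overlap slightly because boxes are
    open. *)
Lemma vol_fill c1 (f : d.-tuple E) l1 v : orthobasis dot f -> (forall j, 0 < l1 j) ->
  (vol (cuboid c1 f l1) < v%:E)%E ->
  forall c (e : d.-tuple E) l del, orthobasis dot e -> (forall j, 0 < l j) -> 0 < del ->
  (vol (cuboid c e l) <= (v / (\prod_j l1 j) * (1 + del) ^+ (d + d) * \prod_j l j)%:E)%E.
Proof.
move=> of_ l10 Hv c e l del oe l0 del0.
have [s /andP[s0 _] sl] : exists2 s : R, 0 < s <= 1 & forall j, s <= del * l j / l1 j.
  by apply: common_lbound => j; rewrite divr_gt0 ?mulr_gt0.
have sl0 j : 0 < s * l1 j by rewrite mulr_gt0.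
pose N j := (Num.truncn (l j / (s * l1 j))).+1.
pose I := {dffun forall j : 'I_d, 'I_(N j)}.
pose s' := s * (1 + del); have s'0 : 0 < s' by rewrite mulr_gt0 //; lra.
pose corner (z : I) := c + comb e (fun j => s * l1 j * (z j)%:R - s * l1 j * (del / 2)).
pose A (z : I) := simil dot f e c1 (corner z) s' @` cuboid c1 f l1.
have cov : cuboid c e l `<=` \bigcup_(z in [set: I]) A z.
  move=> y [t tl <-].
  have tj j : 0 <= t j / (s * l1 j) by rewrite divr_ge0 ?ltW //; case/andP: (tl j).
  have zN j : (Num.truncn (t j / (s * l1 j)) < N j)%N.
    rewrite truncn_lt_nat // (le_lt_trans _ (truncnS_gt _)) // ler_wpM2r ?invr_ge0 ?(ltW (sl0 j)) //.
    by case/andP: (tl j) => _ /ltW.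
  pose z : I := [ffun j => Ordinal (zN j)].
  exists z => //=; pose u j := (t j - s * l1 j * (z j)%:R + s * l1 j * (del / 2)) / s'.
  have zE j : z j = Num.truncn (t j / (s * l1 j)) :> nat by rewrite ffunE.
  have zb j : 0 <= t j - s * l1 j * (z j)%:R < s * l1 j.
    rewrite zE; have /andP[h1 h2] := truncn_itv (tj j).
    rewrite ler_pdivlMr // in h1; rewrite ltr_pdivrMr // -natr1 mulrDl mul1r in h2.
    by rewrite [s * l1 j * _]mulrC; lra.
  exists (c1 + comb f u).
    exists u => // j; have /andP[h1 h2] := zb j; rewrite /u divr_gt0 //=; last first.
      by rewrite -[0]addr0 ler_ltD // mulr_gt0 // divr_gt0.
    rewrite ltr_pdivrMr // /s' mulrCA mulrA mulrDr mulr1.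
    have := mulr_gt0 (sl0 j) del0; lra.
  rewrite simil_comb // /corner -addrA; congr (_ + _).
  rewrite /comb -big_split; apply: eq_bigr => j _ /=; rewrite -scalerDl; congr (_ *: _).
  rewrite /u; field; exact: lt0r_neq0.
apply: le_trans (vol_mono oe0 cov) _.
have Av z : [set: I] z -> (vol (A z) < (s' ^+ d * v)%:E)%E.
  by move=> _; apply: (vol_simil oe0).
apply: le_trans (vol_subadd oe0 Av) _.
have v0 : 0 < v by rewrite -lte_fin (le_lt_trans _ Hv) // (vol_ge0 dot).
have s'd : 0 <= s' ^+ d * v by rewrite mulr_ge0 ?exprn_ge0 ?ltW.
have sE : (\esum_(k in [set: I]) (s' ^+ d * v)%:E = (#|I|%:R * (s' ^+ d * v))%:E)%E.
  by apply: esum_cst_fin.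
rewrite sE lee_fin card_dffun_ord.
have NL : (\prod_(j < d) N j)%:R <= \prod_(j < d) (l j / (s * l1 j) * (1 + del)).
  apply: natr_prod_le => j; rewrite /N -natr1 mulrDr mulr1 lerD //.
    by have /andP[] := truncn_itv (divr_ge0 (ltW (l0 j)) (ltW (sl0 j))).
  rewrite mulrAC ler_pdivlMr // mul1r [l j * _]mulrC.
  by have := sl j; rewrite ler_pdivlMr.
apply: le_trans (ler_wpM2r s'd NL) _.
rewrite !big_split /= prodfV big_split /= !big_const_ord !iter_mulr_1 /s' exprD exprMn.
rewrite le_eqVlt; apply/orP; left; apply/eqP; field.
have : 0 < \prod_j l1 j by apply: prodr_gt0.
by move=> /lt0r_neq0 ->; rewrite expf_neq0 // lt0r_neq0.
Qed.

Lemma cuboid_open_coord c (e : d.-tuple E) l : orthobasis dot e ->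
  open [set y : 'rV[R]_d | cuboid c e l (comb e0 (fun j => y 0 j))].
Proof.
move=> oe; have [cW|cW] := boolP (c \in W); last first.
  rewrite (_ : mkset _ = set0); first exact: open0.
  rewrite -subset0 => y /= /(cuboidP oe)[H _]; move/negP: cW; apply.
  by rewrite -[c](subKr (comb e0 (fun j => y 0 j))) rpredB // (comb_mem oe0).
pose h j (y : 'rV[R]_d) : R := \sum_(i < d) y 0 i * dot (tnth e0 i) (tnth e j) - dot c (tnth e j).
have hE j (y : 'rV[R]_d) : dot (comb e0 (fun j => y 0 j) - c) (tnth e j) = h j y.
  by rewrite dotBl dot_suml; congr (_ - _); apply: eq_bigr => i _; rewrite dotZl.
have hc j : continuous (h j).
  move=> y; have Fy : Filter (nbhs y) by exact: nbhs_filter.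
  have H : (fun y : 'rV[R]_d => \sum_(i < d) y 0 i * dot (tnth e0 i) (tnth e j)) @ y -->
           \sum_(i < d) y 0 i * dot (tnth e0 i) (tnth e j).
    apply: cvg_big => [|i _]; first exact: add_continuous.
    by apply: cvgM; [exact: coord_continuous|exact: cvg_cst].
  exact: (cvgB H (cvg_cst _)).
rewrite openE => y /= /(cuboidP oe)[_ Hy].
have : \forall z \near nbhs y, forall j, 0 < h j z < l j.
  apply: filter_forall => j.
  apply: (hc j y [set x | 0 < x < l j]).
  have /near_in_itvoo : h j y \in `]0, l j[ by rewrite in_itv /= -hE.
  by apply: filterS => x /=; rewrite in_itv.
apply: filterS => z Hz /=; apply/(cuboidP oe); split; first by rewrite rpredB // (comb_mem oe0).
by move=> j; rewrite hE.
Qed.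

(** Boxes are open, so by compactness finitely many of those covering the unit
    cube cover a smaller closed cube. Counting points of a grid finer than all
    of them then bounds the sum of their volumes from below: in a frame of its
    own a box has as many grid cells as its volume dictates, and a cell of
    size [h] contains at most one point of a grid whose mesh is larger than
    the diameter of the cell. *)
Lemma vol_cube_crude : exists2 kap : R, 0 < kap & (kap%:E <= vol (cuboid 0%R e0 (fun=> 1%R)))%E.
Proof.
have d1 : 0 < d.+1%:R :> R by rewrite ltr0n.
exists (((4 * d.+1%:R) ^+ d)^-1); first by rewrite invr_gt0 exprn_gt0 // mulr_gt0.
apply: le_ereal_inf_tmp => _ [D [c [e [l [oe l0 AD ->]]]]].
pose io (y : 'rV[R]_d) := comb e0 (fun j => y 0 j).
pose Y := [set y : 'rV[R]_d | forall j, `[1 / 4, 3 / 4]%classic (y ord0 j)].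
have cY : compact Y by apply: (@rV_compact R d (fun=> `[1 / 4, 3 / 4]%classic)) => i; exact: segment_compact.
pose U k := [set y : 'rV[R]_d | cuboid (c k) (e k) (l k) (io y)].
have [D' D'D YD'] : finite_subset_cover D U Y.
  move: cY; rewrite compact_cover; apply; first by move=> k _; exact: cuboid_open_coord.
  move=> y Yy; have [|k Dk Hk] := AD (io y); last by exists k.
  exists (fun j => y 0 j); last by rewrite add0r.
  by move=> j; have := Yy j; rewrite /= in_itv /= => /andP[? ?]; apply/andP; split; lra.
have [s /andP[s0 s1] sl] : exists2 s : R, 0 < s <= 1 & forall kj : D' * 'I_d, s <= l (val kj.1) kj.2.
  by apply: common_lbound => kj; apply: l0.
pose n := (Num.truncn s^-1).+1; have n0 : 0 < n%:R :> R by rewrite ltr0n.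
have sn : n%:R^-1 <= s.
  by rewrite -[leRHS]invrK lef_pV2 ?posrE ?invr_gt0 //; exact/ltW/truncnS_gt.
pose h : R := (2 * n%:R * d.+1%:R)^-1.
have h0 : 0 < h by rewrite invr_gt0 !mulr_gt0.
have hs : h <= s.
  apply: le_trans sn; rewrite /h lef_pV2 ?posrE ?mulr_gt0 //.
  by rewrite -!natrM ler_nat mulnAC leq_pmull.
pose yz (z : {ffun 'I_d -> 'I_n}) : 'rV[R]_d := \row_j (1 / 4 + (z j)%:R / (2 * n%:R)).
have Yyz z : Y (yz z).
  move=> j; rewrite /= in_itv /= mxE.
  have z0 : 0 <= (z j)%:R / (2 * n%:R) :> R by rewrite divr_ge0 // mulr_ge0 // ltW.
  have z1 : (z j)%:R / (2 * n%:R) <= 1 / 2 :> R.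
    rewrite ler_pdivrMr ?mulr_gt0 // mul1r mulKf ?gt_eqF //.
    by rewrite ler_nat ltnW.
  by apply/andP; split; lra.
have /choice[kf Hkf] : forall z, exists k, k \in D' /\ U k (yz z).
  by move=> z; have [k kD' Uk] := YD' _ (Yyz z); exists k.
pose N k j := (Num.truncn (l k j / h)).+1.
have count k : k \in D' -> (#|[set z | kf z == k]%SET| <= \prod_(j < d) N k j)%N.
  move=> kD'; rewrite -card_dffun_ord cardE.
  pose f (z : {ffun 'I_d -> 'I_n}) : {dffun forall j, 'I_(N k j)} :=
    [ffun j => inord (Num.truncn (dot (io (yz z) - c k) (tnth (e k) j) / h))].
  apply: (@uniq_size_inj _ _ f); first exact: enum_uniq.
  move=> z z'; rewrite !mem_enum !inE => /eqP zk /eqP z'k fzz'.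
  have [_ Hz] := Hkf z; have [_ Hz'] := Hkf z'; rewrite zk in Hz; rewrite z'k in Hz'.
  have /(cuboidP (oe k))[_ Bz] := Hz; have /(cuboidP (oe k))[_ Bz'] := Hz'.
  pose x := io (yz z) - io (yz z').
  have xW : x \in W by rewrite rpredB // (comb_mem oe0).
  have xs j : `|dot x (tnth (e k) j)| < h.
    have := congr1 (fun g : {dffun forall j, 'I_(N k j)} => val (g j)) fzz'.
    rewrite !ffunE /=; have /andP[b1 b2] := Bz j; have /andP[b1' b2'] := Bz' j.
    set u := dot _ _ / h; set u' := dot _ _ / h.
    have u0 : 0 <= u by rewrite divr_ge0 ?ltW.
    have u'0 : 0 <= u' by rewrite divr_ge0 ?ltW.
    have uN : (Num.truncn u < N k j)%N.
      by rewrite truncn_lt_nat // (le_lt_trans _ (truncnS_gt _)) // /u ler_wpM2r ?invr_ge0 ?(ltW h0) // ltW.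
    have u'N : (Num.truncn u' < N k j)%N.
      by rewrite truncn_lt_nat // (le_lt_trans _ (truncnS_gt _)) // /u' ler_wpM2r ?invr_ge0 ?(ltW h0) // ltW.
    rewrite !inordK // => /(truncn_close u0 u'0).
    rewrite /u /u' -mulrBl normrM normfV (gtr0_norm h0) ltr_pdivrMr // mul1r -dotBl.
    by congr (`|dot _ _| < _); rewrite /x; rewrite opprB addrA subrK.
  have xx1 : dot x x <= d%:R * h ^+ 2.
    rewrite (dot_expand (oe k)) //; apply: (@le_trans _ _ (\sum_(j < d) h ^+ 2)).
      apply: ler_sum => j _; rewrite -expr2 -[leLHS]ger0_norm ?sqr_ge0 // normrX.
      by rewrite lerXn2r ?nnegrE ?(ltW h0) // ltW.
    by rewrite sumr_const card_ord mulr_natl.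
  have xj j : dot x (tnth e0 j) = ((z j)%:R - (z' j)%:R) / (2 * n%:R).
    by rewrite dotBl !(dot_comb oe0) !mxE; ring.
  apply/ffunP => j; apply/eqP/negPn/negP => zj.
  have xx2 : (1 / (2 * n%:R)) ^+ 2 <= dot x x.
    rewrite (dot_expand oe0) // (bigD1 j) //= -[leLHS]addr0 lerD //; last first.
      by apply: sumr_ge0 => i _; rewrite -expr2 sqr_ge0.
    rewrite -expr2 xj !expr_div_n ler_wpM2r ?invr_ge0 ?sqr_ge0 // expr1n.
    have := zj; rewrite -val_eqE /= neq_ltn => /orP[] lt.
      rewrite -sqrrN opprB -natrB ?(ltnW lt) // -natrX ler1n expn_gt0 subn_gt0 lt //.
    by rewrite -natrB ?(ltnW lt) // -natrX ler1n expn_gt0 subn_gt0 lt.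
  have : d%:R * h ^+ 2 < (1 / (2 * n%:R)) ^+ 2.
    rewrite /h invfM exprMn mulrCA div1r -[ltRHS]mulr1 ltr_pM2l ?exprn_gt0 ?invr_gt0 ?mulr_gt0 //.
    rewrite exprVn ltr_pdivrMr ?exprn_gt0 // mul1r.
    by rewrite -natrX ltr_nat -mulnn; apply: leq_trans (leq_pmulr _ _).
  by rewrite ltNge (le_trans xx2 xx1).
have tot : (n ^ d)%N = (\sum_(k <- D') #|[set z | kf z == k]%SET|)%N.
  have -> : (n ^ d)%N = #|{ffun 'I_d -> 'I_n}| by rewrite card_ffun !card_ord.
  transitivity (\sum_(z : {ffun 'I_d -> 'I_n}) \sum_(k <- D') (kf z == k))%N.
    rewrite -sum1_card; apply: eq_bigr => z _; have [kD _] := Hkf z.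
    rewrite (bigD1_seq (kf z)) ?fset_uniq //= eqxx big1 // => k kz.
    by rewrite eq_sym (negbTE kz).
  rewrite exchange_big /=; apply: eq_bigr => k _.
  by rewrite -sum1_card [RHS]big_mkcond /=; apply: eq_bigr => z _; rewrite inE; case: eqP.
have fin : ((4 * d.+1%:R) ^+ d)^-1 <= \sum_(k <- D') \prod_(j < d) l k j.
  have term k : k \in D' -> #|[set z | kf z == k]%SET|%:R <= (n%:R * (4 * d.+1%:R)) ^+ d * \prod_(j < d) l k j.
    move=> kD'; apply: le_trans (_ : \prod_(j < d) (l k j / h * 2) <= _).
      apply: le_trans (_ : (\prod_(j < d) N k j)%N%:R <= _); first by rewrite ler_nat count.
      apply: natr_prod_le => j; rewrite /N -natr1 mulr2n mulrDr !mulr1 lerD //.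
        by have /andP[] := truncn_itv (divr_ge0 (ltW (l0 k j)) (ltW h0)).
      rewrite ler_pdivlMr // mul1r (le_trans hs) //.
      exact: (sl ([` kD']%fset, j)).
    rewrite !big_split /= !big_const_ord !iter_mulr_1 mulrC mulrCA [leLHS]mulrC -exprMn.
    rewrite le_eqVlt; apply/orP; left; apply/eqP; congr (_ ^+ _ * _).
    by rewrite /h invrK; ring.
  have key : n%:R ^+ d <= \sum_(k <- D') (n%:R * (4 * d.+1%:R)) ^+ d * \prod_(j < d) l k j.
    by rewrite -natrX tot natr_sum big_seq [leRHS]big_seq; apply: ler_sum.
  rewrite -mulr_sumr exprMn -mulrA ler_pMr ?exprn_gt0 // in key.
  by rewrite -div1r ler_pdivrMr ?exprn_gt0 ?mulr_gt0 // mulrC.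
apply: le_trans (_ : (\sum_(k <- D') \prod_(j < d) l k j)%:E <= _)%E; first by rewrite lee_fin.
apply: esum_ge; exists [set` D']; last by rewrite fsbig_finite //= set_fsetK sumEFin.
split; first exact: finite_fset.
by move=> k /= /D'D; rewrite inE.
Qed.

Let Q := cuboid (0 : E) e0 (fun=> 1).

(** Let [v] exceed the volume [q] of the cube by little. Each box of a
    covering of total volume below [v] has, by [vol_fill], a volume of at most
    about [v] times the product of its edges, so that [q <= v * v] up to small
    factors, and [q <= q * q] in the limit. Since [q] is positive, [q >= 1]. *)
Lemma vol_cube_ge1 : (1%:E <= vol Q)%E.
Proof.
have [kap kap0 kapQ] := vol_cube_crude.
have Q1 : (vol Q <= 1%:E)%E.
  by have := vol_cuboid_le oe0 0 oe0 (fun _ => ltr01); rewrite big1.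
have Qfin : vol Q \is a fin_num.
  by rewrite ge0_fin_numE ?(vol_ge0 dot) // (le_lt_trans Q1) // ltry.
have [q qE] : exists q, vol Q = q%:E by exists (fine (vol Q)); rewrite fineK.
rewrite -/Q qE in kapQ Q1 *; rewrite !lee_fin in kapQ Q1 *.
have q0 : 0 < q by apply: lt_le_trans kap0 kapQ.
have q2 : q <= q * q.
  apply: (@le_limit _ _ _ (d + d).+3); first by rewrite mulr_ge0 // ltW.
  move=> x /andP[x0 x1]; pose v := q * (1 + x).
  have x10 : 0 < 1 + x by lra.
  have qv : (vol Q < v%:E)%E by rewrite qE lte_fin /v; nra.
  have [D [c [e [l [oe l0 QD lv]]]]] := vol_lt_cover qv.
  pose m := v * (1 + x) ^+ (d + d); have m0 : 0 < m by rewrite !mulr_gt0 ?exprn_gt0.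
  have Kv k : D k -> (vol (cuboid (c k) (e k) (l k)) < (m * (1 + x) * \prod_(j < d) l k j)%:E)%E.
    move=> Dk; have := vol_fill oe0 (fun _ => ltr01) qv (c k) (oe k) (l0 k) x0.
    rewrite (big1 _ (fun=> 1)) // divr1 => /le_lt_trans; apply.
    have l0k : 0 < \prod_j l k j by apply: prodr_gt0.
    rewrite lte_fin ltr_pM2r // -/m; nra.
  have := vol_subadd oe0 Kv => /(le_trans (vol_mono oe0 QD)).
  have mx0 : 0 <= m * (1 + x) by rewrite mulr_ge0 // ltW.
  move=> /le_trans/(_ (esumZ_le _ _ mx0)); rewrite qE => H.
  have : (q%:E <= (m * (1 + x))%:E * v%:E)%E.
    apply: le_trans H _; rewrite lee_wpmul2l ?lee_fin //; exact: ltW.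
  rewrite -EFinM lee_fin; move=> /le_trans; apply.
  rewrite le_eqVlt; apply/orP; left; apply/eqP; rewrite /m /v !exprS; ring.
by rewrite -(ler_pM2l q0) mulr1.
Qed.

(** If a box had a smaller volume than the product of its edges, filling the
    unit cube with copies of it would give the cube a volume below 1. *)
Theorem vol_cuboid c (e : d.-tuple E) l : orthobasis dot e -> (forall j, 0 < l j) ->
  vol (cuboid c e l) = (\prod_(j < d) l j)%:E.
Proof.
move=> oe l0; apply/eqP; rewrite eq_le (vol_cuboid_le oe0) //=.
rewrite leNgt; apply/negP => H.
have V0 : 0 < \prod_(j < d) l j by apply: prodr_gt0.
have [v0 v0E] : exists q, vol (cuboid c e l) = q%:E.
  exists (fine (vol (cuboid c e l))); rewrite fineK // ge0_fin_numE ?(vol_ge0 dot) //.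
  by apply: lt_trans H _; rewrite ltry.
rewrite v0E lte_fin in H.
pose v := (v0 + \prod_(j < d) l j) / 2.
have vl : v < \prod_(j < d) l j by rewrite /v; lra.
have Hv : (vol (cuboid c e l) < v%:E)%E by rewrite v0E lte_fin /v; lra.
have v00 : 0 < v by rewrite -lte_fin (le_lt_trans _ Hv) // (vol_ge0 dot).
have : 1 <= v / \prod_(j < d) l j.
  apply: (@le_limit _ _ _ (d + d)); first by rewrite divr_ge0 ?ltW.
  move=> x /andP[x0 _].
  have := vol_fill oe l0 Hv 0 oe0 (fun _ => ltr01) x0.
  have P1 : \prod_(j < d) (1 : R) = 1 by rewrite big1.
  rewrite P1 mulr1.
  by move=> /(le_trans vol_cube_ge1); rewrite lee_fin.
by rewrite ler_pdivlMr // mul1r leNgt vl.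
Qed.

End Vol.

(** * Average number of lattice points in a box *)

Section Pigeon.
Variables (T : eqType) (F : finType) (f : T -> F) (X : seq T).

Lemma sum_count : (\sum_(w : F) count (fun x => f x == w) X)%N = size X.
Proof.
elim: X => [|x s IH]; first by rewrite big1.
rewrite big_split /= IH (bigD1 (f x)) //= eqxx big1 // => w.
by rewrite eq_sym => /negbTE ->.
Qed.

Lemma fiber_max (w0 : F) : exists w, (size X <= #|F| * count (fun x => f x == w) X)%N.
Proof.
case: (@arg_maxnP _ w0 predT (fun w => count (fun x => f x == w) X)) => // w _ H.
exists w; rewrite -sum_count -sum_nat_const; apply: leq_sum => i _; exact: H.
Qed.

Lemma fiber_min (w0 : F) : exists w, (#|F| * count (fun x => f x == w) X <= size X)%N.
Proof.
case: (@arg_minnP _ w0 predT (fun w => count (fun x => f x == w) X)) => // w _ H.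
exists w; rewrite -sum_count -sum_nat_const; apply: leq_sum => i _; exact: H.
Qed.
End Pigeon.

Lemma sum_count_le (T : eqType) (U : Type) (f : U -> T) (s : seq T) (r : seq U) : uniq s ->
  (\sum_(y <- s) count (fun z => f z == y) r <= size r)%N.
Proof.
move=> us; elim: r => [|a r IH]; first by rewrite big1.
rewrite big_split /= -add1n leq_add //.
have -> : (\sum_(y <- s) (f a == y) = count_mem (f a) s)%N.
  by elim: {us IH} s => [|y s IHs]; rewrite ?big_nil // big_cons IHs /= eq_sym.
by rewrite count_uniq_mem // leq_b1.
Qed.

Definition obox (R : realType) d (p a : 'I_d -> R) : set 'rV[R]_d :=
  [set x : 'rV[R]_d | forall i, p i < x 0 i < p i + a i].

Section Density.
Variables (R : realType) (d : nat) (B : 'M[R]_d).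
Hypothesis uB : B \in unitmx.
Variable vl : set 'rV[R]_d -> \bar R.
Hypothesis vl0 : forall A, (0 <= vl A)%E.
Hypothesis vl_mono : forall A A', A `<=` A' -> (vl A <= vl A')%E.
Hypothesis vl_sub : forall (I : finType) (A : I -> set 'rV[R]_d) (v : R),
  (forall k, (vl (A k) < v%:E)%E) -> (vl (\bigcup_(k in [set: I]) A k) <= (#|I|%:R * v)%:E)%E.
Hypothesis vl_sim : forall A v (c : 'rV[R]_d) (s : R), 0 < s -> (vl A < v%:E)%E ->
  (vl ((fun x => (c + s *: x)%R) @` A) < (s ^+ d * v)%:E)%E.
Hypothesis vl_box : forall p a, (forall j, 0 < a j) -> vl (obox p a) = (\prod_j a j)%:E.

Definition lat (z : 'rV[int]_d) : 'rV[R]_d := map_mx intr z *m B.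
Definition lattice_pts : set 'rV[R]_d := range lat.
Definition cell : set 'rV[R]_d := [set t *m B | t in [set t : 'rV[R]_d | forall i, 0 <= t 0 i < 1]].
(** The index of the lattice point whose translate of [cell] contains [y]. *)
Definition cell_index (y : 'rV[R]_d) : 'rV[int]_d := \row_i Num.floor ((y *m invmx B) 0 i).

(** Bounds the norm of [M] for the supremum norm; the added 1 keeps it
    positive. *)
Let rho (M : 'M[R]_d) : R := 1 + \sum_i \sum_j `|M i j|.

Lemma rho_gt0 M : 0 < rho M.
Proof. by rewrite ltr_pwDl // sumr_ge0 // => i _; rewrite sumr_ge0. Qed.

Lemma rho_bound M (t : 'rV[R]_d) b j : (forall i, `|t 0 i| <= b) -> `|(t *m M) 0 j| <= b * rho M.
Proof.
move=> tb; have b0 : 0 <= b by apply: le_trans (tb j).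
rewrite mxE; apply: le_trans (ler_norm_sum _ _ _) _.
apply: (@le_trans _ _ (\sum_i b * `|M i j|)).
  by apply: ler_sum => i _; rewrite normrM ler_wpM2r.
rewrite -mulr_sumr ler_wpM2l // /rho -[leLHS]add0r lerD //.
apply: ler_sum => i _; rewrite (bigD1 j) //= lerDl.
by apply: sumr_ge0.
Qed.

Lemma cell_bound u j : cell u -> `|u 0 j| <= rho B.
Proof.
move=> [t tt <-]; rewrite -[rho B]mul1r; apply: rho_bound => i.
by have /andP[? ?] := tt i; rewrite ger0_norm // ltW.
Qed.

Lemma sub_cell_index y : cell (y - lat (cell_index y)).
Proof.
exists (y *m invmx B - map_mx intr (cell_index y)); last by rewrite mulmxBl mulmxKV.
move=> i; rewrite !mxE; have /andP[f1 f2] := floor_itv ((y *m invmx B) 0 i).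
by rewrite intrD in f2; apply/andP; split; rewrite mxE in f1 f2; lra.
Qed.

Lemma cell_index_uniq z u : cell u -> cell_index (lat z + u) = z.
Proof.
move=> [t tt <-]; apply/rowP => i; rewrite mxE.
rewrite mulmxDl !mulmxK // !mxE; apply: floor_def.
by have := tt i; rewrite intrD => /andP[? ?]; apply/andP; split; lra.
Qed.

Lemma lattice_pts_box_finite p a : finite_set (lattice_pts `&` hbox p a).
Proof.
pose b := \sum_i (`|p i| + `|a i|); pose M := (Num.truncn (b * rho (invmx B))).+1.
have b0 i : `|p i| + `|a i| <= b.
  rewrite /b (bigD1 i) //= lerDl; apply: sumr_ge0 => j _; exact: addr_ge0.
have sub : lattice_pts `&` hbox p a `<=`
   (fun w : {ffun 'I_d -> 'I_(M + M).+1} => lat (\row_i ((w i : nat)%:Z - M%:Z))) @` [set: _].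
  move=> _ [[z _ <-] hz].
  have zb i : `|(z 0 i)%:~R| < M%:R :> R.
    have -> : (z 0 i)%:~R = (lat z *m invmx B) 0 i :> R by rewrite mulmxK // mxE.
    apply: (@le_lt_trans _ _ (b * rho (invmx B))); last exact: truncnS_gt.
    apply: rho_bound => j; have /andP[h1 h2] := hz j; apply: le_trans (b0 j).
    have [? ? ? ?] : [/\ - `|p j| <= p j, p j <= `|p j|, - `|a j| <= a j & a j <= `|a j|].
      by split; rewrite ?ler_norm // lerNl -normrN ler_norm.
    have := normr_ge0 (a j).
    by rewrite ler_norml; move=> ?; apply/andP; split; lra.
  have zM (i : 'I_d) : (absz (z ord0 i + M%:Z)%R < (M + M).+1)%N /\ 0 <= z 0 i + M%:Z.
    have := zb i; rewrite -intr_norm -[M%:R]/((M%:Z)%:~R) ltr_int ltr_norml.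
    rewrite -[z ord0 i]/(z 0 i); move: (z 0 i) => v; lia.
  exists [ffun i => Ordinal (proj1 (zM i))] => //=.
  congr lat; apply/rowP => i; rewrite !mxE ffunE /=; have [_] := zM i.
  by rewrite -[z ord0 i]/(z 0 i); move: (z 0 i) => v; lia.
by apply: sub_finite_set sub _; apply: finite_image; exact: finite_finset.
Qed.

Lemma cell_fin : exists2 vC, vl cell = vC%:E & 0 <= vC.
Proof.
have h : (vl cell <= (\prod_(j < d) (4 * rho B))%:E)%E.
  rewrite -(vl_box (fun=> - (2 * rho B))) => [|j]; last by rewrite mulr_gt0 ?rho_gt0.
  apply: vl_mono => u cu i; have := cell_bound i cu; rewrite ler_norml => /andP[? ?].
  have := rho_gt0 B; lra.
have f : vl cell \is a fin_num by rewrite ge0_fin_numE // (le_lt_trans h) // ltry.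
exists (fine (vl cell)); first by rewrite fineK.
exact: fine_ge0.
Qed.

Section WithVol.
Variable vC : R.
Hypothesis vCE : vl cell = vC%:E.

(** The box dilated by [k.+1] is tiled by translates of the box [l]; the
    fibres of the tile map are the points of the lattice in the tiles. *)
Lemma tile_count k (l : 'I_d -> R) (w : {ffun 'I_d -> 'I_k.+1}) : (forall i, 0 < l i) ->
  count (fun x : 'rV[R]_d => [ffun i => inord (Num.truncn (x 0 i / l i))] == w)
    (fset_set (lattice_pts `&` hbox (fun=> 0) (fun i => k.+1%:R * l i))) =
  cnt (lattice_pts `&` hbox (fun i => (w i)%:R * l i) l).
Proof.
move=> l0; rewrite -size_filter /cnt; apply: perm_size; apply: uniq_perm.
- by rewrite filter_uniq // fset_uniq.
- exact: fset_uniq.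
move=> x; rewrite mem_filter !in_fset_set ?inE //; try exact: lattice_pts_box_finite.
have tr i : 0 <= x 0 i -> (Num.truncn (x 0 i / l i) = w i :> nat) <-> (w i)%:R * l i <= x 0 i < (w i)%:R * l i + l i.
  move=> xi; split=> [<-|H].
    have /andP[h1 h2] := truncn_itv (divr_ge0 xi (ltW (l0 i))).
    by rewrite -ler_pdivlMr // h1 /= -[X in _ + X]mul1r -mulrDl natr1 -ltr_pdivrMr.
  apply: truncn_def; rewrite ler_pdivlMr // ltr_pdivrMr // -natr1 mulrDl mul1r //.
apply/idP/idP.
  move=> /andP[/eqP/ffunP E] /asboolP[Lx hx]; apply/asboolP; split=> // i.
  have /andP[h1 h2] := hx i; apply/tr => //.
  have := congr1 val (E i); rewrite ffunE /= inordK // truncn_lt_nat ?divr_ge0 ?(ltW (l0 i)) //.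
  by rewrite ltr_pdivrMr //; lra.
move=> /asboolP[Lx hx]; have x0 i : 0 <= x 0 i.
  by have /andP[h1 h2] := hx i; apply: le_trans h1; rewrite mulr_ge0 // ltW.
apply/andP; split; last first.
  apply/asboolP; split=> // i; rewrite x0 add0r /=; have /andP[h1 h2] := hx i.
  apply: lt_le_trans h2 _; rewrite -[X in _ + X]mul1r -mulrDl natr1 ler_wpM2r ?(ltW (l0 i)) //.
  by rewrite ler_nat.
apply/eqP/ffunP => i; rewrite ffunE; apply/val_inj => /=.
have /tr E := hx i; rewrite inordK E //.
Qed.

Lemma vC_ge0 : 0 <= vC. Proof. by rewrite -lee_fin -vCE. Qed.

Lemma dilation_exists (a l : 'I_d -> R) (r : R) : (forall i, 0 < l i) -> 0 < r ->
  exists k : nat, forall i, a i <= r * (k.+1%:R * l i).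
Proof.
move=> l0 r0; pose S := \sum_i `|a i / (r * l i)|.
exists (Num.truncn S) => i.
have : a i / (r * l i) <= S.
  apply: le_trans (ler_norm _) _; rewrite /S (bigD1 i) //= lerDl.
  by apply: sumr_ge0 => j _.
rewrite ler_pdivrMr ?mulr_gt0 // => /le_trans; apply.
rewrite [leRHS]mulrCA ler_wpM2r ?mulr_ge0 ?(ltW r0) ?(ltW (l0 i)) //.
exact/ltW/truncnS_gt.
Qed.

(** The cells attached to the lattice points of a box cover all of it but a
    margin of width [rho B], and [vl] is subadditive. *)
Lemma cells_cover k (l : 'I_d -> R) : (forall i, 0 < l i) -> (forall i, 2 * rho B < k.+1%:R * l i) ->
  \prod_j (k.+1%:R * l j - 2 * rho B) <=
  (cnt (lattice_pts `&` hbox (fun=> 0) (fun i => k.+1%:R * l i)))%:R * vC.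
Proof.
move=> l0 kl; set X := lattice_pts `&` _.
have finX : finite_set X by exact: lattice_pts_box_finite.
pose I := fset_set X; pose A (x : I) := (fun u => (val x + 1 *: u)%R) @` cell.
have cov : obox (fun=> rho B) (fun j => k.+1%:R * l j - 2 * rho B) `<=` \bigcup_(x in [set: I]) A x.
  move=> y hy; have [x Lx cu] : exists2 x, lattice_pts x & cell (y - x).
    by exists (lat (cell_index y)); [exists (cell_index y)|exact: sub_cell_index].
  have Xx : X x.
    split=> // i; have := cell_bound i cu; have /andP[h1 h2] := hy i.
    rewrite mxE mxE ler_norml => /andP[h3 h4].
    apply/andP; split; lra.
  have xI : x \in I by rewrite in_fset_set ?inE.
  exists [` xI]%fset => //; exists (y - x) => //.
  by rewrite /= scale1r addrC subrK.
have kl' j : 0 < k.+1%:R * l j - 2 * rho B by rewrite subr_gt0.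
rewrite [cnt X](_ : _ = #|{: I}|); last by rewrite /cnt cardfE.
apply: (@le_limit _ _ _ 1); first by rewrite mulr_ge0 // vC_ge0.
move=> x /andP[x0 _].
have S (y : R) : vC < y -> \prod_j (k.+1%:R * l j - 2 * rho B) <= #|{: I}|%:R * y.
  move=> Hy; rewrite -lee_fin -(vl_box (fun=> rho B)) //; apply: le_trans (vl_mono cov) _.
  apply: vl_sub => z; have := @vl_sim cell y (val z) 1 ltr01.
  by rewrite vCE lte_fin expr1n mul1r; exact.
rewrite expr1 -mulrA.
have [v0|v0] := ltrP 0 vC; first by apply: S; rewrite mulrDr mulr1 ltrDl mulr_gt0.
have -> : vC = 0 by apply/le_anti; rewrite v0 vC_ge0.
rewrite mul0r mulr0; apply/ler_addgt0Pr => e e0; rewrite add0r.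
have I0 : 0 < #|{: I}|%:R + 1 :> R by rewrite ltr_wpDl.
apply: le_trans (S (e / (#|{: I}|%:R + 1)) _) _.
  by apply: le_lt_trans v0 _; rewrite divr_gt0.
rewrite mulrA ler_pdivrMr // mulrC ler_wpM2l ?(ltW e0) //; lra.
Qed.

Lemma vC_gt0 : 0 < vC.
Proof.
have [k Hk] := @dilation_exists (fun=> 2 * rho B + 1) (fun=> 1) 1 (fun _ => ltr01) ltr01.
have kl (i : 'I_d) : 2 * rho B < k.+1%:R * 1.
  by apply: (lt_le_trans _ (le_trans (Hk i) _)); rewrite ?ltrDl ?mul1r.
have := cells_cover (fun _ => ltr01) kl.
rewrite lt_neqAle vC_ge0 andbT; apply: contraTN => /eqP <-.
rewrite mulr0 -ltNge; apply: prodr_gt0 => i _; rewrite subr_gt0; exact: kl.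
Qed.

(** Among the [k.+1 ^ d] tiles of a dilated box one contains at least the
    average number of points, and by [cells_cover] the average is at least
    [volume / covolume] up to the margin, which is negligible for [k] large. *)
Theorem density_lower (l : 'I_d -> R) x : (forall i, 0 < l i) -> 0 < x <= 1 ->
  exists p, \prod_i l i <= vC * (cnt (lattice_pts `&` hbox p l))%:R * (1 + x) ^+ d.
Proof.
move=> l0 /andP[x0 x1].
have r0 : 0 < x / 4 by rewrite divr_gt0.
have [k Hk] := @dilation_exists (fun=> 2 * rho B) l (x / 4) l0 r0.
have kl0 i : 0 < k.+1%:R * l i by rewrite mulr_gt0.
have kl i : 2 * rho B < k.+1%:R * l i.
  by apply: le_lt_trans (Hk i) _; rewrite gtr_pMl //; lra.
have := cells_cover l0 kl; set X := lattice_pts `&` _.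
have [w] := @fiber_max _ {ffun 'I_d -> 'I_k.+1} (fun x : 'rV[R]_d => [ffun i => inord (Num.truncn (x 0 i / l i))])
  (fset_set X) [ffun=> ord0].
rewrite tile_count // card_ffun !card_ord; set p := (fun i => _); set N := cnt _ => H1 H2.
exists p; rewrite -/N.
have kd0 : 0 < k.+1%:R ^+ d :> R by rewrite exprn_gt0.
rewrite -(ler_pM2l kd0).
apply: (@le_trans _ _ (\prod_j (k.+1%:R * l j - 2 * rho B) * (1 + x) ^+ d)).
  have -> : k.+1%:R ^+ d * \prod_i l i = \prod_i (k.+1%:R * l i).
    by rewrite big_split /= big_const_ord iter_mulr_1.
  have -> : \prod_j (k.+1%:R * l j - 2 * rho B) * (1 + x) ^+ d = \prod_j ((k.+1%:R * l j - 2 * rho B) * (1 + x)).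
    by rewrite [RHS]big_split /= [X in _ = _ * X]big_const_ord iter_mulr_1.
  apply: ler_prod => i _; rewrite (ltW (kl0 i)) /=.
  have h1 := Hk i; have h2 := kl0 i; set K := k.+1%:R * l i in h1 h2 *.
  have h3 : 2 * rho B * x <= 2 * rho B by rewrite ler_piMr // mulr_ge0 // ltW ?rho_gt0.
  have h4 : 0 <= x * K by rewrite mulr_ge0 ?ltW.
  by clear -h1 h2 h3 h4; lra.
have x10 : 0 <= (1 + x) ^+ d by rewrite exprn_ge0 //; lra.
rewrite mulrA ler_wpM2r //; apply: le_trans H2 _.
by rewrite mulrC mulrCA ler_wpM2l ?vC_ge0 // -natrX -natrM ler_nat.
Qed.

(** An upper bound for the number of cells packed in a region does not follow
    from subadditivity alone; a grid of small cubes replaces additivity. A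
    slightly shrunk copy of the cell at the lattice point [y] is covered by
    cubes whose corners lie in the cell of [y] itself, so the number of these
    corners is at least [covolume / h ^ d], nearly. Corners of different cells
    are different, and there are about [volume / h ^ d] of them in all. *)
Theorem density_upper (l : 'I_d -> R) x : (forall i, 0 < l i) -> 0 < x <= 1 ->
  exists p, vC * (cnt (lattice_pts `&` hbox p l))%:R <= \prod_i l i * (1 + x) ^+ (d + d + d).+1.
Proof.
move=> l0 /andP[x0 x1].
have x10 : 0 < 1 + x by lra.
pose sg := (1 + x)^-1; have sg0 : 0 < sg by rewrite invr_gt0.
have sgx : sg * (1 + x) = 1 by rewrite mulVf // gt_eqF.
have sg1 : sg < 1 by rewrite invf_lt1; lra.
(* With this mesh a grid cube that meets the cell shrunk by [sg] about its
   centre has its corner inside the cell. *)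
pose h := (1 - sg) / 2 / rho (invmx B).
have h0 : 0 < h by rewrite !divr_gt0 ?rho_gt0 ?subr_gt0.
have hB : h * rho (invmx B) = (1 - sg) / 2 by rewrite divfK // gt_eqF ?rho_gt0.
have [k Hk] := @dilation_exists (fun=> 2 * rho B + 3 * h) l x l0 x0.
have kl0 i : 0 < k.+1%:R * l i by rewrite mulr_gt0.
set X := lattice_pts `&` hbox (fun=> 0) (fun i => k.+1%:R * l i).
have finX : finite_set X by exact: lattice_pts_box_finite.
have [w] := @fiber_min _ {ffun 'I_d -> 'I_k.+1} (fun x : 'rV[R]_d => [ffun i => inord (Num.truncn (x 0 i / l i))])
  (fset_set X) [ffun=> ord0].
rewrite tile_count // card_ffun !card_ord; set p := (fun i => _); set N := cnt _ => H1.
exists p; rewrite -/N.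
pose M j := (Num.truncn ((k.+1%:R * l j + 2 * rho B + 2 * h) / h)).+1.
pose I := {dffun forall j : 'I_d, 'I_(M j)}.
pose g (z : I) : 'rV[R]_d := \row_j (h * (z j)%:R - (rho B + h)).
pose V := (h * (1 + x)) ^+ d * (1 + x).
have hx0 : 0 < h * (1 + x) by rewrite mulr_gt0.
have V0 : 0 < V by rewrite mulr_gt0 // exprn_gt0.
have each y : X y -> vC <= (count (fun z => lat (cell_index (g z)) == y) (enum I))%:R * V * (1 + x) ^+ d.
  move=> [[z0 _ yE] hy].
  pose J := {z : I | lat (cell_index (g z)) == y}.
  pose D : set 'rV[R]_d := (fun u => ((y + ((1 - sg) / 2) *: (const_mx 1 *m B)) + sg *: u)%R) @` cell.
  pose A (z : J) : set 'rV[R]_d := obox (fun j => g (val z) 0 j - h * x / 2) (fun=> h * (1 + x)).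
  have cov : D `<=` \bigcup_(z in [set: J]) A z.
    move=> _ [_ [t tt <-] <-]; set v := (X in _ X).
    have vE : v = y + (((1 - sg) / 2) *: const_mx 1 + sg *: t) *m B.
      by rewrite /v mulmxDl -!scalemxAl addrA.
    pose s : 'rV[R]_d := ((1 - sg) / 2) *: const_mx 1 + sg *: t; rewrite -/s in vE; clearbody v.
    have sE i : s 0 i = (1 - sg) / 2 + sg * t 0 i by rewrite !mxE mulr1.
    have sb i : (1 - sg) / 2 <= s 0 i < 1 - (1 - sg) / 2.
      rewrite sE; have /andP[t0 t1] := tt i.
      have := mulr_ge0 (ltW sg0) t0; have : sg * t 0 i < sg by rewrite gtr_pMr.
      move=> ? ?; apply/andP; split; lra.
    have vy i : `|v 0 i - y 0 i| <= rho B.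
      have -> : v 0 i - y 0 i = (s *m B) 0 i by rewrite vE mxE addrAC subrr add0r.
      rewrite -[rho B]mul1r; apply: rho_bound => j; have /andP[? ?] := sb j.
      by rewrite ger0_norm; lra.
    have q0 j : 0 <= (v 0 j + rho B + h) / h.
      rewrite divr_ge0 ?ltW //; have := vy j; have /andP[? ?] := hy j.
      by rewrite ler_norml => /andP[? ?]; lra.
    have qM j : (Num.truncn ((v 0 j + rho B + h) / h)%R < M j)%N.
      rewrite truncn_lt_nat // (le_lt_trans _ (truncnS_gt _)) // ler_wpM2r ?invr_ge0 ?(ltW h0) //.
      have := vy j; have /andP[? ?] := hy j.
      by rewrite ler_norml => /andP[? ?]; lra.
    pose z : I := [ffun j => Ordinal (qM j)].
    have gz j : 0 <= v 0 j - g z 0 j < h.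
      rewrite /g mxE /z ffunE /=; have /andP[h1 h2] := truncn_itv (q0 j).
      rewrite ler_pdivlMr // in h1; rewrite ltr_pdivrMr // -natr1 mulrDl mul1r in h2.
      by rewrite [h * _]mulrC; apply/andP; split; lra.
    have zJ : lat (cell_index (g z)) == y.
      have -> : g z = lat z0 + (s - (v - g z) *m invmx B) *m B.
        rewrite mulmxBl mulmxKV // yE -[y + _]/(y + _) addrA -vE.
        by rewrite opprB addrCA subrr addr0.
      rewrite cell_index_uniq ?yE //; eexists; last by [].
      move=> i; have rb : `|((v - g z) *m invmx B) 0 i| <= h * rho (invmx B).
        apply: rho_bound => j; rewrite mxE [(- g z) _ _]mxE; have /andP[? ?] := gz j.
        by rewrite ger0_norm // ltW.
      have E : (s - (v - g z) *m invmx B) 0 i = s 0 i - ((v - g z) *m invmx B) 0 i.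
        by rewrite mxE [X in _ + X]mxE.
      have := rb; rewrite hB ler_norml E => /andP[? ?].
      by have /andP[? ?] := sb i; apply/andP; split; lra.
    exists (exist _ z zJ) => // j /=; have /andP[? ?] := gz j.
    have := mulr_gt0 h0 x0 => ?; apply/andP; split; lra.
  have vA z : (vl (A z) < V%:E)%E.
    rewrite vl_box // lte_fin big_const_ord iter_mulr_1 /V ltr_pMr ?exprn_gt0 //; lra.
  have vD : (vl D <= (#|{: J}|%:R * V)%:E)%E.
    by apply: le_trans (vl_mono cov) _; apply: vl_sub.
  have cJ : #|{: J}| = count (fun z => lat (cell_index (g z)) == y) (enum I).
    by rewrite card_sig cardE -size_filter /enum_mem filter_predT.
  rewrite -cJ.
  have sc : cell `<=` (fun u => (- ((1 + x) *: (y + ((1 - sg) / 2) *: (const_mx 1 *m B))) + (1 + x) *: u)%R) @` D.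
    move=> u cu; exists (y + ((1 - sg) / 2) *: (const_mx 1 *m B) + sg *: u); first by exists u.
    by rewrite /= [in X in _ + X]scalerDr scalerA [(1 + x) * sg]mulrC sgx scale1r addKr.
  have xd0 : 0 < (1 + x) ^+ d by rewrite exprn_gt0.
  have H (v : R) : (vl D < v%:E)%E -> vC <= v * (1 + x) ^+ d.
    move=> Dv; rewrite -lee_fin -vCE; apply: le_trans (vl_mono sc) _.
    by rewrite [v * _]mulrC; apply/ltW; apply: (@vl_sim D v _ (1 + x) x10 Dv).
  apply/ler_addgt0Pr => e e0.
  have -> : #|{: J}|%:R * V * (1 + x) ^+ d + e = (#|{: J}|%:R * V + e / (1 + x) ^+ d) * (1 + x) ^+ d.
    by rewrite mulrDl divfK // gt_eqF.
  by apply: H; apply: le_lt_trans vD _; rewrite lte_fin ltrDl divr_gt0.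
have xd0 : 0 <= (1 + x) ^+ d by rewrite exprn_ge0 // ltW.
have key : (cnt X)%:R * vC <= #|{: I}|%:R * V * (1 + x) ^+ d.
  apply: (@le_trans _ _ (\sum_(y <- fset_set X) (count (fun z => lat (cell_index (g z)) == y) (enum I))%:R * V * (1 + x) ^+ d)).
    rewrite mulr_natl /cnt -[leLHS]addr0 -iter_addr -(count_predT (fset_set X)) -big_const_seq.
    rewrite big_seq [leRHS]big_seq; apply: ler_sum => y.
    by rewrite in_fset_set // inE => /each.
  rewrite -!mulr_suml ler_wpM2r // ler_wpM2r ?(ltW V0) // -natr_sum ler_nat.
  rewrite cardE; apply: sum_count_le; exact: fset_uniq.
have cI : #|{: I}|%:R * h ^+ d <= k.+1%:R ^+ d * \prod_i l i * (1 + x) ^+ d.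
  rewrite card_dffun_ord.
  apply: (@le_trans _ _ (\prod_(j < d) (k.+1%:R * l j * (1 + x) / h) * h ^+ d)).
    rewrite ler_wpM2r ?exprn_ge0 ?(ltW h0) //; apply: natr_prod_le => j.
    have nn : 0 <= (k.+1%:R * l j + 2 * rho B + 2 * h) / h.
      have r1 := rho_gt0 B; have r2 := kl0 j; rewrite divr_ge0 ?(ltW h0) //.
      by set K := k.+1%:R * l j in r2 *; clear -r1 r2 h0; lra.
    have /andP[t1 _] := truncn_itv nn; rewrite /M -natr1.
    apply: le_trans (_ : (k.+1%:R * l j + 2 * rho B + 2 * h) / h + 1 <= _); first by rewrite lerD2r.
    rewrite -[X in _ + X](mulfV (lt0r_neq0 h0)) -mulrDl ler_wpM2r ?invr_ge0 ?(ltW h0) //.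
    have h1 := Hk j; set K := k.+1%:R * l j in h1 *; clear -h1; lra.
  rewrite !big_split /= !big_const_ord !iter_mulr_1 exprVn divfK //.
  by rewrite expf_neq0 // gt_eqF.
have kd0 : 0 < k.+1%:R ^+ d :> R by rewrite exprn_gt0.
rewrite -(ler_pM2l kd0).
apply: (@le_trans _ _ ((cnt X)%:R * vC)).
  by rewrite mulrCA mulrC ler_wpM2r ?vC_ge0 // -natrX -natrM ler_nat.
apply: le_trans key _; rewrite /V.
have -> : #|{: I}|%:R * ((h * (1 + x)) ^+ d * (1 + x)) * (1 + x) ^+ d =
  (#|{: I}|%:R * h ^+ d) * ((1 + x) ^+ (d + d).+1).
  by rewrite exprMn exprS exprD; ring.
apply: (@le_trans _ _ (k.+1%:R ^+ d * \prod_i l i * (1 + x) ^+ d * (1 + x) ^+ (d + d).+1)).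
  by rewrite ler_wpM2r // exprn_ge0 // ltW.
by rewrite !exprS !exprD le_eqVlt; apply/orP; left; apply/eqP; ring.
Qed.
End WithVol.
End Density.

(** * Lattice points in a box of a subspace *)

Lemma cnt_sub (T : choiceType) (A A' : set T) : finite_set A' -> A `<=` A' -> (cnt A <= cnt A')%N.
Proof.
move=> fA' AA'; have fA := sub_finite_set AA' fA'.
by apply: fsubset_leq_card; rewrite -fset_set_sub.
Qed.

Lemma cnt_image (T U : choiceType) (f : T -> U) (A : set T) : finite_set A -> {in A &, injective f} ->
  cnt (f @` A) = cnt A.
Proof.
move=> fA inj; rewrite /cnt fset_set_image // card_in_imfset //= => x y.
by rewrite !in_fset_set //; exact: inj.
Qed.

(** In dimension 0 every count is exact, whereas [C * m.+1%:R ^+ 0] would be a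
    constant. *)
Definition errbound (R : realType) (d : nat) (C : R) (m : nat) : R :=
  if d == 0%N then 0 else C * m.+1%:R ^+ d.-1.

Lemma box_discrepancy_any (R : realType) (d : nat) (L : set 'rV[R]_d) (c kap : R) :
  0 < c -> (forall x y, L x -> L y -> L (x - y)) ->
  (forall x, L x -> x != 0 -> c <= \prod_i `|x 0 i|) -> 0 < kap ->
  (forall a : 'I_d -> R, (forall i, 0 < a i) -> exists p (s : seq 'rV[R]_d),
    [/\ uniq s, {subset s <= L `&` hbox p a} & kap * \prod_i a i <= (size s)%:R]) ->
  exists2 C, 0 <= C & forall p p' a m, (forall i, 0 < a i) -> \prod_i a i < 2 ^+ m.+1 ->
  `|(cnt (L `&` hbox p' a))%:R - (cnt (L `&` hbox p a))%:R : R| <= errbound d C m.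
Proof.
case: d L => [|d'] L c0 LB LN kap0 Ld; last exact: box_discrepancy c0 LB LN _ kap0 Ld.
exists 0 => // p p' a m _ _; have -> : hbox p' a = hbox p a.
  by apply/seteqP; split=> x _ [].
by rewrite subrr normr0.
Qed.

Section LatticeCount.
Variables (R : realType) (E : vectType R) (dot : {dot E for idfun}) (W : {vspace E}).
Local Notation d := (\dim W).
Variables (e b : d.-tuple E).
Hypothesis oe : orthobasis dot e.
Hypothesis bb : basis_of W b.

Definition of_coords (y : 'rV[R]_d) : E := comb e (fun j => y 0 j).
Definition coords (x : E) : 'rV[R]_d := \row_j dot x (tnth e j).
(** The rows are the coordinates of [b] in the frame [e], so that [of_coords]
    carries the lattice of this matrix to [zspan b]. *)
Definition basis_mx : 'M[R]_d := \matrix_(i, j) dot (tnth b i) (tnth e j).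

Lemma of_coordsD x y : of_coords (x + y) = of_coords x + of_coords y.
Proof. by rewrite /of_coords /comb -big_split; apply: eq_bigr => j _; rewrite mxE scalerDl. Qed.
Lemma of_coordsZ a x : of_coords (a *: x) = a *: of_coords x.
Proof. by rewrite /of_coords /comb scaler_sumr; apply: eq_bigr => j _; rewrite mxE scalerA. Qed.
Lemma of_coordsK : cancel of_coords coords.
Proof. by move=> y; apply/rowP => j; rewrite mxE (dot_comb oe). Qed.
Lemma coordsK x : x \in W -> of_coords (coords x) = x.
Proof.
by move=> xW; rewrite [RHS](ob_expand oe xW) /of_coords; congr comb; apply/funext => j; rewrite mxE.
Qed.
Lemma of_coords_mem y : of_coords y \in W. Proof. exact: (comb_mem oe). Qed.

Lemma basis_tnth_mem i : tnth b i \in W. Proof. by apply: (basis_mem bb); rewrite mem_tnth. Qed.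

Lemma of_coords_mul (v : 'rV[R]_d) : of_coords (v *m basis_mx) = \sum_i v 0 i *: tnth b i.
Proof.
rewrite -[RHS]coordsK; last by apply: memv_suml => i _; rewrite memvZ ?basis_tnth_mem.
congr of_coords; apply/rowP => j; rewrite !mxE dot_suml; apply: eq_bigr => i _.
by rewrite mxE dotZl.
Qed.

Lemma basis_mx_unit : basis_mx \in unitmx.
Proof.
rewrite -row_free_unit; apply: inj_row_free => v vB.
have := of_coords_mul v; rewrite vB.
have -> : of_coords 0 = 0 by rewrite /of_coords /comb big1 // => j _; rewrite mxE scale0r.
move=> /esym H; apply/rowP => i; rewrite mxE.
have /freeP/(_ (fun i => v 0 i)) := basis_free bb; apply.
by rewrite -[RHS]H; apply: eq_bigr => j _; rewrite -tnth_nth.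
Qed.

Lemma zspan_of_coords : zspan b = of_coords @` lattice_pts basis_mx.
Proof.
apply/seteqP; split=> x.
  move=> [z _ <-]; exists (lat basis_mx (\row_i z i)); first by exists (\row_i z i).
  by rewrite /lat of_coords_mul; apply: eq_bigr => i _; rewrite !mxE.
move=> [_ [z _ <-] <-]; exists (fun i => z 0 i) => //.
by rewrite /lat of_coords_mul; apply: eq_bigr => i _; rewrite !mxE.
Qed.

Lemma fundamental_cell_of_coords : fundamental_cell b = of_coords @` cell basis_mx.
Proof.
apply/seteqP; split=> x.
  move=> [t tt <-]; exists ((\row_i t i) *m basis_mx); first by exists (\row_i t i) => // i; rewrite mxE.
  by rewrite of_coords_mul; apply: eq_bigr => i _; rewrite !mxE.
move=> [_ [t tt <-] <-]; exists (fun i => t 0 i) => //.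
by rewrite of_coords_mul.
Qed.

Let vl (A : set 'rV[R]_d) := vol dot W (of_coords @` A).

Lemma vl_ge0 A : (0 <= vl A)%E. Proof. exact: vol_ge0. Qed.
Lemma vl_mono A A' : A `<=` A' -> (vl A <= vl A')%E.
Proof. by move=> AA'; apply: (vol_mono oe); apply: image_subset. Qed.
Lemma vl_sub (I : finType) (A : I -> set 'rV[R]_d) (v : R) :
  (forall k, (vl (A k) < v%:E)%E) -> (vl (\bigcup_(k in [set: I]) A k) <= (#|I|%:R * v)%:E)%E.
Proof.
move=> H; rewrite /vl image_bigcup.
have [I0|] := pselect (exists k : I, True); last first.
  move=> nI; rewrite (_ : \bigcup_(k in _) _ = set0); last first.
    by rewrite -subset0 => x [k]; case: nI; exists k.
  have cI : #|I| = 0%N by apply: eq_card0 => k; case: nI; exists k.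
  have := @vol_subadd _ _ _ _ _ oe I [set: I] (fun=> set0) (fun=> v).
  rewrite bigcup0 // => H'; apply: le_trans (H' _) _ => [k|]; first by case: nI; exists k.
  rewrite cI mul0r (_ : [set: I] = set0) ?esum_set0 // -subset0 => k; case: nI; by exists k.
have v0 : 0 <= v.
  by case: I0 => k _; rewrite -lee_fin (le_trans (vl_ge0 (A k))) // ltW.
apply: le_trans (vol_subadd oe (fun k _ => H k)) _.
by rewrite esum_cst_fin.
Qed.
Lemma vl_sim A v (c : 'rV[R]_d) (s : R) : 0 < s -> (vl A < v%:E)%E ->
  (vl ((fun x => (c + s *: x)%R) @` A) < (s ^+ d * v)%:E)%E.
Proof.
move=> s0 H; apply: le_lt_trans (vol_simil oe 0 (of_coords c) oe oe s0 H).
apply: (vol_mono oe) => _ [_ [y Ay <-] <-]; exists (of_coords y); first by exists y.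
have := simil_comb e 0 (of_coords c) s (fun j => y 0 j) oe; rewrite add0r => ->.
rewrite of_coordsD of_coordsZ; congr (_ + _).
by rewrite /of_coords /comb scaler_sumr; apply: eq_bigr => j _; rewrite scalerA.
Qed.
Lemma of_coords_obox p a : of_coords @` obox p a = cuboid (comb e p) e a.
Proof.
apply/seteqP; split=> x.
  move=> [y hy <-]; exists (fun j => y 0 j - p j).
    by move=> j; have /andP[? ?] := hy j; apply/andP; split; lra.
  by rewrite /of_coords /comb -big_split /=; apply: eq_bigr => j _; rewrite -scalerDl addrC subrK.
move=> [t tt <-]; exists (\row_j (p j + t j)).
  by move=> j; have /andP[? ?] := tt j; rewrite mxE; apply/andP; split; lra.
by rewrite /of_coords /comb -big_split /=; apply: eq_bigr => j _; rewrite mxE scalerDl.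
Qed.
Lemma vl_box p a : (forall j, 0 < a j) -> vl (obox p a) = (\prod_j a j)%:E.
Proof. by move=> a0; rewrite /vl of_coords_obox (vol_cuboid oe). Qed.

Let vC := fine (vol dot W (fundamental_cell b)).

Lemma vCE : vl (cell basis_mx) = vC%:E.
Proof.
have [v vE _] := cell_fin basis_mx vl_ge0 vl_mono vl_box.
by rewrite vE /vC fundamental_cell_of_coords -/(vl _) vE.
Qed.

Lemma covol_gt0 : 0 < vC.
Proof. exact: (vC_gt0 basis_mx_unit vl_ge0 vl_mono vl_sub vl_sim vl_box vCE). Qed.

(** If the counts in the translates of any box of volume at most [\prod_j l j]
    differ by at most [Bd], each is within [Bd] of the average. Half-open
    boxes slightly smaller than the open one, and the half-open box of the
    same size, enclose the count in the open box. *)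
Lemma count_sandwich (l p : 'I_d -> R) Bd : (forall j, 0 < l j) ->
  (forall p p' a, (forall j, 0 < a j) -> \prod_j a j <= \prod_j l j ->
    `|(cnt (lattice_pts basis_mx `&` hbox p' a))%:R - (cnt (lattice_pts basis_mx `&` hbox p a))%:R : R| <= Bd) ->
  `|(cnt (lattice_pts basis_mx `&` obox p l))%:R - (\prod_j l j) / vC| <= Bd.
Proof.
move=> l0 osc; set N := cnt _.
have Bd0 : 0 <= Bd by apply: le_trans (osc p p l l0 (lexx _)).
have vC0 := covol_gt0.
have P0 : 0 < \prod_j l j by apply: prodr_gt0.
have up : vC * (N%:R - Bd) <= \prod_j l j.
  apply: (@le_limit _ _ _ (d + d + d).+1); first exact: ltW.
  move=> x x01; have [q Hq] := density_upper basis_mx_unit vl_ge0 vl_mono vl_sub vl_sim vl_box vCE l0 x01.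
  apply: le_trans Hq; rewrite ler_wpM2l ?(ltW vC0) //.
  have := osc q p l l0 (lexx _); rewrite ler_norml => /andP[_ h].
  have : N%:R <= (cnt (lattice_pts basis_mx `&` hbox p l))%:R :> R.
    rewrite ler_nat; apply: cnt_sub; first exact: (lattice_pts_box_finite basis_mx_unit).
    by move=> y [Ly hy]; split=> // i; have /andP[h1 h2] := hy i; rewrite (ltW h1) h2.
  lra.
have lo : \prod_j l j <= vC * (N%:R + Bd).
  apply: (@le_limit _ _ _ (d + d)); first by rewrite mulr_ge0 ?addr_ge0 // ltW.
  move=> x x01; have /andP[x0 x1] := x01; have x10 : 0 < 1 + x by lra.
  pose l' j := l j / (1 + x); have l'0 j : 0 < l' j by rewrite divr_gt0.
  have ll' j : l' j < l j by rewrite /l' ltr_pdivrMr // ltr_pMr //; lra.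
  have [q Hq] := density_lower basis_mx_unit vl_ge0 vl_mono vl_sub vl_sim vl_box vCE l'0 x01.
  have EP : \prod_j l j = \prod_j l' j * (1 + x) ^+ d.
    rewrite /l' big_split /= big_const_ord iter_mulr_1 exprVn divfK //.
    by rewrite expf_neq0 // gt_eqF.
  have x1d : 1 <= (1 + x) ^+ d by rewrite exprn_ege1 //; lra.
  have P'0 : 0 <= \prod_j l' j by apply: prodr_ge0 => j _; exact: ltW.
  rewrite EP exprD mulrA ler_wpM2r ?exprn_ge0 ?(ltW x10) //.
  apply: le_trans Hq _; rewrite ler_wpM2r ?exprn_ge0 ?(ltW x10) // ler_wpM2l ?(ltW vC0) //.
  pose p' j := p j + (l j - l' j) / 2.
  have := osc p' q l' l'0 _; rewrite EP ler_peMr // => /(_ isT).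
  rewrite ler_norml => /andP[_ h].
  have : (cnt (lattice_pts basis_mx `&` hbox p' l'))%:R <= N%:R :> R.
    rewrite ler_nat; apply: cnt_sub.
      apply: sub_finite_set (lattice_pts_box_finite basis_mx_unit p l) => y [Ly hy]; split=> // i.
      by have /andP[h1 h2] := hy i; rewrite (ltW h1) h2.
    move=> y [Ly hy]; split=> // i; have /andP[h1 h2] := hy i; have := ll' i.
    by rewrite /p' in h1 h2; move=> ?; apply/andP; split; lra.
  lra.
rewrite ler_distlC; apply/andP; split.
  by rewrite ler_pdivlMr // mulrC.
by rewrite ler_pdivrMr // mulrC.
Qed.

(** The choice [x = 1] in [density_lower]: the hypothesis of the oscillation
    estimate. *)
Lemma box_dense (a : 'I_d -> R) : (forall i, 0 < a i) -> exists p (s : seq 'rV[R]_d),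
  [/\ uniq s, {subset s <= lattice_pts basis_mx `&` hbox p a} & (vC * 2 ^+ d)^-1 * \prod_i a i <= (size s)%:R].
Proof.
move=> a0; have x01 : 0 < (1 : R) <= 1 by rewrite ltr01 lexx.
have [p Hp] := density_lower basis_mx_unit vl_ge0 vl_mono vl_sub vl_sim vl_box vCE a0 x01.
exists p, (fset_set (lattice_pts basis_mx `&` hbox p a)); split; first exact: fset_uniq.
  by move=> x; rewrite in_fset_set //; exact: (lattice_pts_box_finite basis_mx_unit).
have v0 : 0 < vC * 2 ^+ d by rewrite mulr_gt0 ?covol_gt0 // exprn_gt0.
rewrite mulrC ler_pdivrMr //; apply: le_trans Hp _.
by rewrite mulrAC mulrC.
Qed.

Theorem lattice_count c : 0 < c ->
  (forall x, zspan b x -> x != 0 -> c <= `|Nm dot e x|) ->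
  exists2 C, 0 <= C & forall c0 l g m, (forall j, 0 < l j) -> c0 - g \in W ->
    \prod_j l j < 2 ^+ m.+1 ->
    let A := cuboid c0 e l `&` [set g + y | y in zspan b] in
    finite_set A /\ `|(cnt A)%:R - (\prod_j l j) / vC| <= errbound d C m.
Proof.
move=> c_gt0 adm.
have LB x y : lattice_pts basis_mx x -> lattice_pts basis_mx y -> lattice_pts basis_mx (x - y).
  move=> [z _ <-] [z' _ <-]; exists (z - z') => //.
  by rewrite /lat map_mxB mulmxBl.
have LN x : lattice_pts basis_mx x -> x != 0 -> c <= \prod_i `|x 0 i|.
  move=> Lx x0; have : zspan b (of_coords x) by rewrite zspan_of_coords; exists x.
  move=> /adm; rewrite /Nm normr_prod (eq_bigr (fun i => `|x 0 i|)); last first.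
    by move=> i _; rewrite (dot_comb oe).
  apply; apply: contraNneq x0 => ix0; rewrite -(of_coordsK x) ix0.
  by apply/eqP/rowP => j; rewrite !mxE dot0l.
have k0 : 0 < (vC * 2 ^+ d)^-1 by rewrite invr_gt0 mulr_gt0 ?covol_gt0 // exprn_gt0.
have [C C0 HC] := box_discrepancy_any c_gt0 LB LN k0 box_dense.
exists C => // c0 l g m l0 c0g Vm A.
pose p j := dot (c0 - g) (tnth e j).
have AE : A = (fun y => g + of_coords y) @` (lattice_pts basis_mx `&` obox p l).
  have c0E : c0 - g = comb e p by exact: ob_expand.
  rewrite /A; apply/seteqP; split=> x.
    move=> [/(cuboidP oe)[xW hx]]; rewrite zspan_of_coords => -[_ [y Ly <-] xE].
    exists y => //; split=> // j; have := hx j; rewrite -xE.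
    rewrite (_ : g + of_coords y - c0 = of_coords y - (c0 - g)); last by rewrite opprB addrCA addrA addrC addrA.
    by rewrite dotBl (dot_comb oe) -/(p j) => /andP[? ?]; apply/andP; split; lra.
  move=> [y [Ly hy] <-]; split; last by exists (of_coords y) => //; rewrite zspan_of_coords; exists y.
  apply/(cuboidP oe); rewrite (_ : g + of_coords y - c0 = of_coords y - (c0 - g)); last first.
    by rewrite opprB addrCA addrA addrC addrA.
  split; first by rewrite rpredB // of_coords_mem.
  move=> j; rewrite dotBl (dot_comb oe) -/(p j); have /andP[? ?] := hy j.
  by apply/andP; split; lra.
have fin : finite_set (lattice_pts basis_mx `&` obox p l).
  apply: sub_finite_set (lattice_pts_box_finite basis_mx_unit p l) => y [Ly hy]; split=> // i.
  by have /andP[h1 h2] := hy i; rewrite (ltW h1) h2.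
rewrite AE; split; first exact: finite_image.
rewrite cnt_image //; last by move=> x y _ _ /addrI /(can_inj of_coordsK).
apply: count_sandwich => // q q' a a0 al; apply: HC => //.
exact: le_lt_trans al Vm.
Qed.
End LatticeCount.

(** * The dual lattice and the slices *)

Section Orth.
Variables (R : realType) (E : vectType R) (dot : {dot E for idfun}).

Lemma orthovP_dot (U : {vspace E}) x : x \in orthov dot U <-> forall u, u \in U -> dot x u = 0.
Proof. by split=> [/mem_orthovP|H]; [|apply/mem_orthovP]. Qed.

Lemma orth_cap (U : {vspace E}) x : x \in U -> x \in orthov dot U -> x = 0.
Proof. by move=> xU /orthovP_dot/(_ x xU)/dot_eq0. Qed.

(** The Gram matrix of a basis of [U] is invertible, as the form is definite;
    solving the normal equations gives the projection. *)
Lemma orth_decomp (U : {vspace E}) x : exists2 u, u \in U & x - u \in orthov dot U.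
Proof.
pose X := vbasis U; have bX : basis_of U X by exact: vbasisP.
pose G : 'M[R]_(\dim U) := \matrix_(i, j) dot (tnth X i) (tnth X j).
have XU i : tnth X i \in U by apply: (basis_mem bX); rewrite mem_tnth.
have uG : G \in unitmx.
  rewrite -row_free_unit; apply: inj_row_free => v vG.
  pose y := \sum_i v 0 i *: tnth X i.
  have yX j : dot y (tnth X j) = 0.
    have := congr1 (fun M : 'rV_(\dim U) => M 0 j) vG; rewrite !mxE => H; rewrite -[RHS]H.
    by rewrite dot_suml; apply: eq_bigr => i _; rewrite mxE dotZl.
  have y0 : y = 0.
    by apply: (@dot_eq0 _ _ dot); rewrite {2}/y dot_sumr big1 // => i _; rewrite dotZr yX mulr0.
  have /freeP/(_ (fun i => v 0 i)) := basis_free bX => H; apply/rowP => i; rewrite mxE; apply: H.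
  by rewrite -[RHS]y0; apply: eq_bigr => j _; rewrite -tnth_nth.
pose t := (\row_i dot x (tnth X i)) *m invmx G.
pose u := \sum_i t 0 i *: tnth X i.
have uU : u \in U by apply: memv_suml => i _; rewrite memvZ.
exists u => //; apply/orthovP_dot => w wU.
rewrite (coord_basis bX wU) dot_sumr big1 // => j _; rewrite dotZr -tnth_nth dotBl.
have -> : dot u (tnth X j) = dot x (tnth X j).
  have tG : dot x (tnth X j) = (t *m G) 0 j by rewrite mulmxKV // mxE.
  rewrite tG mxE dot_suml; apply: eq_bigr => i _; by rewrite dotZl [G _ _]mxE.
by rewrite subrr mulr0.
Qed.

(** A maximal free family of elements of [A] spans the least subspace
    containing [A]. *)
Lemma span_setP (A : set E) : exists s : seq E,
  [/\ free s, forall x, x \in s -> A x & span_set A = (span s)] /\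
  (forall x, A x -> x \in span_set A).
Proof.
pose P n := `[< exists s : seq E, [/\ free s, forall x, x \in s -> A x & size s = n] >].
have P0 : exists n, P n by exists 0%N; apply/asboolP; exists [::]; split=> //; exact: nil_free.
have Pb n : P n -> (n <= \dim {:E})%N.
  move=> /asboolP[s [fs _ <-]]; rewrite -(eqP fs); apply: dimvS; exact: subvf.
case: (ex_maxnP P0 Pb) => n /asboolP[s [fs sA sn]] maxn.
have As x : A x -> x \in (span s).
  move=> Ax; apply/negPn/negP => xs.
  have : P n.+1.
    apply/asboolP; exists (x :: s); split; last by rewrite /= sn.
      by rewrite free_cons xs.
    by move=> y; rewrite inE => /orP[/eqP ->//|/sA].
  by move/maxn; rewrite ltnn.
have ex : ([set U : {vspace E} | (forall x, A x -> x \in U) /\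
    forall U' : {vspace E}, (forall x, A x -> x \in U') -> (U <= U')%VS]) (span s).
  by split=> // U' AU'; apply/span_subvP => x /sA/AU'.
have := @xgetI _ 0%VS _ _ ex; rewrite -/(span_set A) => -[h1 h2].
exists s; split; last exact: h1.
split=> //; apply/eqP; rewrite eqEsubv h2 //=.
by apply/span_subvP => x /sA/h1.
Qed.
End Orth.

Lemma intr_sum (R : realType) (I : Type) (r : seq I) (P : pred I) (f : I -> int) :
  (\sum_(i <- r | P i) f i)%:~R = \sum_(i <- r | P i) (f i)%:~R :> R.
Proof. by elim/big_rec2: _ => // i x y _ <-; rewrite intrD. Qed.

Section Adapted.
Variables (R : realType) (E : vectType R) (dot : {dot E for idfun}).
Variables (F : {vspace E}) (Gamma : set E).
Hypothesis lat : lattice_in fullv Gamma.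
Local Notation V := (V dot F Gamma).
Local Notation Vp := (Vperp dot F Gamma).
Local Notation n := (\dim {:E}).
Local Notation r := (\dim V).

Lemma GammaF_V g : GammaF dot F Gamma g -> g \in V.
Proof. by have [s [_]] := span_setP (GammaF dot F Gamma); apply. Qed.

Lemma V_sub_F : (V <= F)%VS.
Proof.
rewrite /V; have [s [[fs sA ->] _]] := span_setP (GammaF dot F Gamma).
by apply/span_subvP => x /sA[].
Qed.

(** The Smith normal form of the integer matrix of pairings between a maximal
    free family in [GammaF] and a basis of [Gamma] gives a basis [b] of
    [Gamma] and combinations of the free family whose matrix of pairings with
    [b] is diagonal. Divided by the diagonal entries they give [w], dual to the
    first [r] vectors of [b]. Such [w k] pair integrally with [Gamma], hence
    belong to [GammaF]. *)
Lemma adapted_basis : exists (w b : nat -> E),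
  [/\ (r <= n)%N, forall k, (k < r)%N -> GammaF dot F Gamma (w k),
   forall k j, (k < r)%N -> (j < n)%N -> dot (w k) (b j) = (k == j)%:R,
   Gamma = [set \sum_(j < n) (z j)%:~R *: b j | z in [set: 'I_n -> int]] &
   (forall x, exists t : 'I_n -> R, x = \sum_(j < n) t j *: b j) /\
   (forall x, (forall k, (k < r)%N -> dot x (w k) = 0) -> x \in Vp)].
Proof.
have [s [[fs sA VE] _]] := span_setP (GammaF dot F Gamma).
have rs : r = size s by rewrite /V VE; exact/eqP.
have [b0 [bb0 GE]] := lat.
pose M : 'M[int]_(r, n) := \matrix_(i, j) Num.floor (dot (nth 0 s i) (tnth b0 j)).
have ME (i : 'I_r) (j : 'I_n) : (M i j)%:~R = dot (nth 0 s i) (tnth b0 j).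
  rewrite mxE floorK //; have [[_ H] _] : GammaF dot F Gamma (nth 0 s i).
    by apply: sA; rewrite mem_nth // -rs.
  apply: H; rewrite GE; exists (fun k => (k == j)%:R) => //.
  rewrite (bigD1 j) //= eqxx scale1r big1 ?addr0 // => k kj.
  by rewrite (negbTE kj) scale0r.
have [L uL [Q uQ [D _ MD]]] := int_Smith_normal_form M.
set DD := (\matrix_(i, j) _) in MD.
have QQ : Q *m invmx Q = 1%:M by exact: mulmxV.
have QQ' : invmx Q *m Q = 1%:M by exact: mulVmx.
have LL : invmx L *m L = 1%:M by exact: mulVmx.
pose bf (k : 'I_n) := \sum_(j < n) ((invmx Q) j k)%:~R *: tnth b0 j.
have b0E (j : 'I_n) : tnth b0 j = \sum_(k < n) (Q k j)%:~R *: bf k.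
  rewrite /bf; under eq_bigr do rewrite scaler_sumr.
  rewrite exchange_big /= (bigD1 j) //=.
  have Hd (i : 'I_n) : \sum_(k < n) (Q k j)%:~R *: (((invmx Q) i k)%:~R *: tnth b0 i) = (i == j)%:R *: tnth b0 i.
    under eq_bigr do rewrite scalerA -intrM.
    rewrite -scaler_suml -intr_sum; congr (_ *: _).
    have := congr1 (fun M : 'M[int]_(n) => M i j) QQ'; rewrite !mxE => H.
    transitivity (((i == j)%:R : int)%:~R : R); last by case: eqP.
    by rewrite -H; congr (_%:~R); apply: eq_bigr => k _; rewrite mulrC.
  rewrite Hd eqxx scale1r big1 ?addr0 // => i ij.
  by rewrite Hd (negbTE ij) scale0r.
have sb (i : 'I_r) (k : 'I_n) : dot (nth 0 s i) (bf k) = ((L *m DD) i k)%:~R.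
  rewrite -[L *m DD](mulmxK uQ) -MD mxE /bf dot_sumr intr_sum; apply: eq_bigr => j _.
  by rewrite dotZr -ME intrM mulrC.
have spanb x : exists t : 'I_n -> R, x = \sum_(j < n) t j *: bf j.
  exists (fun k => \sum_(j < n) coord b0 j x * (Q k j)%:~R).
  rewrite [LHS](coord_basis bb0 (memvf x)).
  under eq_bigr => j _ do rewrite -tnth_nth b0E scaler_sumr.
  rewrite exchange_big /=; apply: eq_bigr => k _; rewrite scaler_suml.
  by apply: eq_bigr => j _; rewrite scalerA.
have nondeg y : (forall j, dot y (bf j) = 0) -> y = 0.
  move=> H; apply: (@dot_eq0 _ _ dot); have [t yE] := spanb y.
  by rewrite {2}yE dot_sumr big1 // => j _; rewrite dotZr H mulr0.
pose dd (k : nat) : int := D`_k.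
have DDE (i : 'I_r) (j : 'I_n) : DD i j = dd i *+ (i == j :> nat) by rewrite mxE.
pose yv (k : 'I_r) := \sum_(i < r) ((invmx L) k i)%:~R *: nth 0 s i.
have yb (k : 'I_r) (j : 'I_n) : dot (yv k) (bf j) = (DD k j)%:~R.
  have -> : DD = invmx L *m (L *m DD) by rewrite mulmxA LL mul1mx.
  rewrite mxE /yv dot_suml intr_sum; apply: eq_bigr => i _.
  by rewrite dotZl sb intrM.
have sfree (v : 'I_r -> R) : \sum_(i < r) v i *: nth 0 s i = 0 -> forall i, v i = 0.
  have fsT : free (Tuple (introT eqP (esym rs))) by [].
  by move=> H; move/freeP: fsT; apply; rewrite -[RHS]H.
(* A zero divisor would be a relation in the free family. *)
have d0 (k : 'I_r) : dd k != 0.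
  apply/eqP => dk0.
  have yk0 : yv k = 0.
    by apply: nondeg => j; rewrite yb DDE dk0 mul0rn.
  have Lk := sfree _ yk0.
  have : (invmx L *m L) k k = 0.
    rewrite mxE big1 // => i _; have /eqP := Lk i; rewrite intr_eq0 => /eqP ->.
    by rewrite mul0r.
  by rewrite LL mxE eqxx.
have rn : (r <= n)%N by apply: dimvS; exact: subvf.
pose wf (k : 'I_r) := (dd k)%:~R^-1 *: yv k.
have wb (k : 'I_r) (j : 'I_n) : dot (wf k) (bf j) = (k == j :> nat)%:R.
  rewrite dotZl yb DDE; case: eqP => _; last by rewrite mulr0n mulr0.
  by rewrite mulr1n mulVf // intr_eq0.
have GE' : Gamma = [set \sum_(j < n) (z j)%:~R *: bf j | z in [set: 'I_n -> int]].
  rewrite GE; apply/seteqP; split=> x [z _ <-].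
    exists (fun k => \sum_(j < n) z j * Q k j) => //.
    under [RHS]eq_bigr => j _ do rewrite b0E scaler_sumr.
    rewrite exchange_big /=; apply: eq_bigr => k _; rewrite intr_sum scaler_suml.
    by apply: eq_bigr => j _; rewrite scalerA intrM.
  exists (fun k => \sum_(j < n) z j * (invmx Q) k j) => //.
  under [RHS]eq_bigr => j _ do rewrite /bf scaler_sumr.
  rewrite exchange_big /=; apply: eq_bigr => k _; rewrite intr_sum scaler_suml.
  by apply: eq_bigr => j _; rewrite scalerA intrM.
have wG (k : 'I_r) : GammaF dot F Gamma (wf k).
  split.
    split; first exact: memvf.
    move=> g; rewrite GE' => -[z _ <-]; rewrite dot_sumr.
    apply: rpred_sum => j _; rewrite dotZr wb.
    by apply: rpredM; [exact: intr_int|exact: rpred_nat].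
  rewrite /= /wf memvZ //; apply: memv_suml => i _; rewrite memvZ //.
  by have [] : GammaF dot F Gamma (nth 0 s i) by apply: sA; rewrite mem_nth // -rs.
pose w (k : nat) := if insub k is Some i then wf i else 0.
pose b (k : nat) := if insub k is Some i then bf i else 0.
have wE (i : 'I_r) : w i = wf i by rewrite /w valK.
have bE (i : 'I_n) : b i = bf i by rewrite /b valK.
exists w, b; split=> //.
- by move=> k kr; have := wG (Ordinal kr); rewrite -wE.
- by move=> k j kr jn; have := wb (Ordinal kr) (Ordinal jn); rewrite -wE -bE.
- rewrite GE'; congr (image _ _); apply/funext => z; apply: eq_bigr => j _; by rewrite bE.
split=> [x|x H].
  by have [t ->] := spanb x; exists t; apply: eq_bigr => j _; rewrite bE.
apply/orthovP_dot => u; rewrite /V VE => us.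
have xs (i : 'I_r) : dot x (nth 0 s i) = 0.
  have -> : nth 0 s i = \sum_(k < r) dot (nth 0 s i) (b k) *: w k.
    apply/eqP; rewrite -subr_eq0; apply/eqP; apply: nondeg => j.
    rewrite dotBl dot_suml; case: (ltnP j r) => jr.
      rewrite (bigD1 (Ordinal jr)) //= dotZl [w j](wE (Ordinal jr)) wb eqxx mulr1.
      rewrite -[b j]/(b (nat_of_ord j)) bE big1 ?addr0 ?subrr // => k kj.
      rewrite dotZl wE wb (_ : _ == _ = false) ?mulr0 //.
      by apply: contraNF kj => /eqP kj; apply/eqP/val_inj.
    rewrite big1 ?subr0 => [|k _]; last first.
      rewrite dotZl wE wb (_ : _ == _ = false) ?mulr0 //.
      by apply/eqP => kj; have := leq_trans (ltn_ord k) jr; rewrite kj ltnn.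
    rewrite sb mxE big1 // => k _; rewrite DDE (_ : _ == _ = false) ?mulr0n ?mulr0 //.
    by apply/eqP => kj; have := leq_trans (ltn_ord k) jr; rewrite kj ltnn.
  by rewrite dot_sumr big1 // => k _; rewrite dotZr H ?ltn_ord // mulr0.
have us' : u \in span (in_tuple s) by [].
rewrite (coord_span us') dot_sumr big1 // => j _; rewrite dotZr.
have jr : (j < r)%N by rewrite rs.
by have := xs (Ordinal jr) => /= ->; rewrite mulr0.
Qed.
End Adapted.

Section LatticeFacts.
Variables (R : realType) (E : vectType R) (dot : {dot E for idfun}).
Variables (F : {vspace E}) (Gamma : set E).
Hypothesis lat : lattice_in fullv Gamma.
Local Notation V := (V dot F Gamma).
Local Notation Vp := (Vperp dot F Gamma).
Local Notation n := (\dim {:E}).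
Local Notation r := (\dim V).
Local Notation Gd := (GammaF_dual dot F Gamma).
Local Notation slice := (slice dot F Gamma).

Lemma Vp_dot x u : x \in Vp -> u \in V -> dot x u = 0.
Proof. by move=> /orthovP_dot; apply. Qed.

Lemma sliceP g x : slice g x <-> x - g \in Vp.
Proof.
split=> [[y yV <-]|H]; first by rewrite addrAC subrr add0r.
by exists (x - g) => //; rewrite addrC subrK.
Qed.

(** A point of [GammaF_dual] has integer pairings with the [w k]; use them as
    coordinates along the first vectors of the adapted basis. *)
Lemma lift_dual g : Gd g -> exists2 y, Gamma y & y - g \in Vp.
Proof.
move=> [gV gd]; have [w [b [rn wG wb GE [_ VpI]]]] := adapted_basis dot F lat.
pose z (j : 'I_n) : int := if (j < r)%N then Num.floor (dot g (w j)) else 0.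
exists (\sum_(j < n) (z j)%:~R *: b j); first by rewrite GE; exists z.
apply: VpI => k kr; rewrite dotBl dot_suml.
have kn := leq_trans kr rn.
rewrite (bigD1 (Ordinal kn)) //= dotZl [dot (b k) _]dotC wb // eqxx mulr1 /z /= kr.
rewrite floorK; last exact: gd (wG k kr).
rewrite big1 ?addr0 ?subrr // => j jk; rewrite dotZl dotC wb //.
rewrite (_ : (k == j) = false) ?mulr0 //.
by apply: contraNF jk => /eqP kj; apply/eqP/val_inj.
Qed.

Lemma proj_dual y : Gamma y -> exists2 g, Gd g & y - g \in Vp.
Proof.
move=> Gy; have [g gV yg] := orth_decomp dot V y.
exists g => //; split=> // g' Hg'; have g'V := GammaF_V Hg'.
have [[_ H] _] := Hg'.
have -> : dot g g' = dot y g' by apply/eqP; rewrite eq_sym -subr_eq0 -dotBl (Vp_dot yg).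
by rewrite dotC; apply: H.
Qed.

Lemma dual_inj g g' x : Gd g -> Gd g' -> slice g x -> slice g' x -> g = g'.
Proof.
move=> [gV _] [g'V _] /sliceP xg /sliceP xg'; apply/eqP; rewrite -subr_eq0; apply/eqP.
apply: (@orth_cap _ _ dot V); first by rewrite rpredB.
have -> : g - g' = (x - g') - (x - g) by rewrite opprB [RHS]addrC addrA subrK.
by rewrite rpredB.
Qed.

(** In the adapted basis [Gamma_perp] is cut out by the vanishing of the first
    [r] coordinates, so that the other [n - r] vectors are a basis of it, and
    by the same argument with real coordinates a basis of [Vp]. *)
Lemma perp_lattice : n = (r + \dim Vp)%N /\ lattice_in Vp (Gamma_perp dot F Gamma).
Proof.
have [w [b [rn wG wb GE [bspan VpI]]]] := adapted_basis dot F lat.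
have bdot (t : 'I_n -> R) k : (k < r)%N -> forall kn : (k < n)%N,
    dot (\sum_(j < n) t j *: b j) (w k) = t (Ordinal kn).
  move=> kr kn; rewrite dot_suml (bigD1 (Ordinal kn)) //= dotZl [dot (b k) _]dotC wb // eqxx mulr1.
  rewrite big1 ?addr0 // => j jk; rewrite dotZl dotC wb // (_ : (k == j) = false) ?mulr0 //.
  by apply: contraNF jk => /eqP kj; apply/eqP/val_inj.
pose m := (n - r)%N.
have nE : n = (r + m)%N by rewrite subnKC.
have wV k : (k < r)%N -> w k \in V by move=> kr; exact/GammaF_V/wG.
pose c := [tuple b (r + i)%N | i < m].
have cE i : tnth c i = b (r + i)%N by rewrite tnth_mktuple.
have cVp i : tnth c i \in Vp.
  rewrite cE; apply: VpI => k kr.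
  have rin : (r + i < n)%N by rewrite [X in (_ < X)%N]nE ltn_add2l.
  rewrite dotC wb //.
  by rewrite (_ : (k == r + i)%N = false) //; apply/eqP => kri; move: kr; rewrite kri ltnNge leq_addr.
have split_sum (f : nat -> E) : \sum_(j < n) f j = \sum_(j < r) f j + \sum_(i < m) f (r + i)%N.
  rewrite -(big_mkord xpredT f) -(big_mkord xpredT f) (@big_cat_nat _ _ _ r) //=; congr (_ + _).
  by rewrite -{1}[r]add0n big_addn big_mkord; apply: eq_bigr => i _; rewrite addnC.
have inVp (t : 'I_n -> R) : \sum_(j < n) t j *: b j \in Vp ->
    forall j : 'I_n, (j < r)%N -> t j = 0.
  move=> xVp j jr; have := bdot t j jr (ltn_ord j); rewrite (Vp_dot xVp (wV j jr)).
  by move=> ->; congr t; apply/val_inj.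
pose ext (T : Type) (z0 : T) (t : 'I_n -> T) (k : nat) := if insub k is Some i then t i else z0.
have extE (T : Type) (z0 : T) t (i : 'I_n) : ext T z0 t i = t i by rewrite /ext valK.
have tail (t : 'I_n -> R) : (forall j : 'I_n, (j < r)%N -> t j = 0) ->
    \sum_(j < n) t j *: b j = \sum_(i < m) ext R 0 t (r + i)%N *: tnth c i.
  move=> t0; rewrite (eq_bigr (fun j : 'I_n => ext R 0 t j *: b j)); last by move=> j _; rewrite extE.
  rewrite (split_sum (fun j => ext R 0 t j *: b j)) big1 ?add0r; last first.
    move=> j _; have jn := leq_trans (ltn_ord j) rn.
    by rewrite -[nat_of_ord j]/(nat_of_ord (Ordinal jn)) extE t0 ?scale0r //= ltn_ord.
  by apply: eq_bigr => i _; rewrite cE.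
have bfree (t : 'I_n -> R) : \sum_(j < n) t j *: b j = 0 -> forall j, t j = 0.
  pose bt := [tuple b j | j < n].
  have sp : (fullv <= span bt)%VS.
    apply/subvP => x _; have [u ->] := bspan x; apply: memv_suml => j _.
    by rewrite memvZ // memv_span //; apply/tnthP; exists j; rewrite tnth_mktuple.
  have bas : basis_of fullv bt by rewrite basisEdim sp size_tuple leqnn.
  have /freeP H := basis_free bas; move=> t0; apply: H.
  by rewrite -[RHS]t0; apply: eq_bigr => j _; rewrite -tnth_nth tnth_mktuple.
have cspan : (Vp <= span c)%VS.
  apply/subvP => x xVp; have [t xE] := bspan x; rewrite xE in xVp *.
  rewrite (tail _ (inVp _ xVp)); apply: memv_suml => i _.
  by rewrite memvZ // memv_span // mem_tnth.
have cfree : free c.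
  apply/freeP => k k0 i.
  pose t (j : 'I_n) := if (j < r)%N then 0 else ext R 0 (fun j' : 'I_n => 0) j +
     (if insub (j - r)%N is Some i' then k i' else 0).
  have t0 : \sum_(j < n) t j *: b j = 0.
    rewrite tail; last by move=> j jr; rewrite /t jr.
    rewrite -[RHS]k0; apply: eq_bigr => i' _; rewrite -tnth_nth; congr (_ *: _).
    have rin : (r + i' < n)%N by rewrite [X in (_ < X)%N]nE ltn_add2l.
    rewrite -[(r + i')%N]/(nat_of_ord (Ordinal rin)) extE /t /= ltnNge leq_addr /= addKn valK.
    by rewrite /ext; case: insub => [?|]; rewrite add0r.
  have rin : (r + i < n)%N by rewrite [X in (_ < X)%N]nE ltn_add2l.
  have := bfree t t0 (Ordinal rin); rewrite /t /= ltnNge leq_addr /= addKn valK.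
  by rewrite /ext; case: insub => [?|]; rewrite add0r.
have cV : span c = Vp.
  by apply/eqP; rewrite eqEsubv cspan andbT; apply/span_subvP => x /tnthP[i ->].
have dVp : m = \dim Vp by rewrite -cV (eqP cfree) size_tuple.
split; first by rewrite -dVp.
have tc : size c == \dim Vp by rewrite size_tuple dVp.
exists (Tuple tc); split; first by rewrite basisEdim size_tuple leqnn andbT; exact: cspan.
have zs : zspan (Tuple tc) = zspan c.
  suff H k (eq : size c == k) : m = k -> zspan (Tuple eq) = zspan c by exact: H.
  move=> mk; subst k; congr zspan; exact/val_inj.
rewrite zs; apply/seteqP; split=> x.
  move=> [Gx xVp]; have : Gamma x by [].
  rewrite GE => -[z _ zE]; rewrite /= -zE in xVp *.
  have z0 := inVp _ xVp.
  exists (fun i => ext int 0 z (r + i)%N) => //.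
  rewrite (tail (fun j => (z j)%:~R)) //; apply: eq_bigr => i _; congr (_ *: _).
  by rewrite /ext; case: insub.
move=> [z _ <-]; split; last first.
  by apply: memv_suml => i _; rewrite memvZ.
pose t (j : 'I_n) : int := if (j < r)%N then 0 else 
     (if insub (j - r)%N is Some i' then z i' else 0).
suff: [set \sum_(j < n) (z j)%:~R *: b j | z in [set: 'I_n -> int]] (\sum_(i < m) (z i)%:~R *: tnth c i) by rewrite -GE.
exists t => //; rewrite (tail (fun j => (t j)%:~R)); last by move=> j jr; rewrite /t jr.
apply: eq_bigr => i _; congr (_ *: _).
have rin : (r + i < n)%N by rewrite [X in (_ < X)%N]nE ltn_add2l.
by rewrite -[(r + i)%N]/(nat_of_ord (Ordinal rin)) extE /t /= ltnNge leq_addr /= addKn valK.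
Qed.

(** A point [g] of [GammaF_dual] is determined by its integer pairings with
    the [w k], which are bounded by those of a point of [S] in the slice. *)
Lemma finite_slices (S : set E) : ebounded dot S -> 
  finite_set [set g | Gd g /\ slice g `&` S !=set0].
Proof.
move=> [M bS]; have [w [b [rn wG wb GE [bspan VpI]]]] := adapted_basis dot F lat.
pose N := (Num.truncn (\sum_(k < r) (M ^+ 2 * dot (w k) (w k) + 1))).+1.
have wV k : (k < r)%N -> w k \in V by move=> kr; exact/GammaF_V/wG.
pose P (u : {ffun 'I_r -> 'I_(N + N).+1}) g := Gd g /\ forall k : 'I_r, dot g (w k) = ((u k : nat)%:Z - N%:Z)%:~R.
apply: (@sub_finite_set _ _ ((fun u => xget 0 (P u)) @` [set: {ffun 'I_r -> 'I_(N + N).+1}])); last first.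
  by apply: finite_image; exact: finite_finset.
move=> g [Gg [s [sg Ss]]].
have gs (k : 'I_r) : dot g (w k) = dot s (w k).
  have /sliceP sgV := sg; apply/eqP; rewrite eq_sym -subr_eq0 -dotBl (Vp_dot sgV) //.
  exact: wV.
have gint (k : 'I_r) : dot g (w k) \is a Num.int by have [_ H] := Gg; apply/H/wG.
have gb (k : 'I_r) : `|dot g (w k)| < N%:R.
  have h1 : `|dot s (w k)| ^+ 2 <= M ^+ 2 * dot (w k) (w k).
    rewrite -normrX ger0_norm ?sqr_ge0 //; apply: le_trans (dot_CauchySchwarz _ _ _) _.
    rewrite ler_wpM2r ?dot_ge0 //.
    have := bS _ Ss; rewrite /enorm => sM.
    rewrite -[leLHS]sqr_sqrtr ?dot_ge0 // lerXn2r ?nnegrE ?sqrtr_ge0 //.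
    exact: le_trans sM.
  rewrite gs; apply: (@le_lt_trans _ _ (\sum_(k < r) (M ^+ 2 * dot (w k) (w k) + 1))); last exact: truncnS_gt.
  rewrite (bigD1 k) //= -[leLHS]addr0 lerD //; last first.
    by apply: sumr_ge0 => i _; rewrite addr_ge0 // mulr_ge0 ?sqr_ge0 ?dot_ge0.
  apply: le_trans (_ : `|dot s (w k)| ^+ 2 + 1 <= _); last by rewrite lerD2r.
  have := sqr_ge0 (`|dot s (w k)| - 1); have := normr_ge0 (dot s (w k)).
  by set v := `| _ |; rewrite sqrrB1 => ? ?; nra.
have uN (k : 'I_r) : (absz (Num.floor (dot g (w k)) + N%:Z)%R < (N + N).+1)%N /\ 0 <= Num.floor (dot g (w k)) + N%:Z.
  have := gb k; rewrite -{1}(floorK (gint k)) -intr_norm -[N%:R]/((N%:Z)%:~R) ltr_int ltr_norml.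
  by move: (Num.floor _) => v; lia.
pose u : {ffun 'I_r -> 'I_(N + N).+1} := [ffun k => Ordinal (proj1 (uN k))].
have Pg : P u g.
  split=> // k; rewrite ffunE /=; have [_ h] := uN k.
  by rewrite gez0_abs // addrK floorK.
exists u => //; have [Gg' H'] := @xgetI _ 0 _ _ Pg.
have [_ H] := Pg.
apply/eqP; rewrite -subr_eq0; apply/eqP; apply: (@orth_cap _ _ dot V).
  by have [? _] := Gg; have [? _] := Gg'; rewrite rpredB.
by apply: VpI => k kr; have := H (Ordinal kr); have := H' (Ordinal kr) => /=; rewrite dotBl => -> ->; rewrite subrr.
Qed.
End LatticeFacts.

(** * Edge directions of a box and the stretching *)

Section BoxEdges.
Variables (R : realType) (E : vectType R) (dot : {dot E for idfun}) (W : {vspace E}).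
Local Notation d := (\dim W).

(** The differences of points of a box form a box centred at the origin, which
    no longer depends on the corner. *)
Lemma cuboid_diff (e : d.-tuple E) c l y : orthobasis dot e -> (forall j, 0 < l j) -> y \in W ->
  (exists x1 x2, [/\ cuboid c e l x1, cuboid c e l x2 & y = x1 - x2]) <->
  (forall j, `|dot y (tnth e j)| < l j).
Proof.
move=> oe l0 yW; split.
  move=> [x1 [x2 [/(cuboidP oe)[_ h1] /(cuboidP oe)[_ h2] ->]]] j.
  have -> : x1 - x2 = (x1 - c) - (x2 - c) by rewrite opprB addrA subrK.
  rewrite dotBl ltr_norml; have /andP[? ?] := h1 j; have /andP[? ?] := h2 j.
  by apply/andP; split; lra.
move=> H.
pose t j := (l j + dot y (tnth e j)) / 2; pose u j := (l j - dot y (tnth e j)) / 2.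
exists (c + comb e t), (c + comb e u); split.
- exists t => // j; have := H j; rewrite ltr_norml /t => /andP[? ?]; apply/andP; split; lra.
- exists u => // j; have := H j; rewrite ltr_norml /u => /andP[? ?]; apply/andP; split; lra.
- rewrite opprD addrACA subrr add0r [LHS](ob_expand oe yW) /comb -sumrB.
  by apply: eq_bigr => j _; rewrite -scalerBl; congr (_ *: _); rewrite /t /u; field.
Qed.

(** Equal boxes have the same box of differences, hence the same closure of
    it, which is reached by scaling. *)
Lemma sym_box_sub (e e' : d.-tuple E) c c' l l' y : orthobasis dot e -> orthobasis dot e' ->
  (forall j, 0 < l j) -> (forall j, 0 < l' j) -> cuboid c e l = cuboid c' e' l' -> y \in W ->
  (forall j, `|dot y (tnth e j)| <= l j) -> (forall j, `|dot y (tnth e' j)| <= l' j).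
Proof.
move=> oe oe' l0 l'0 KK yW H j.
apply: (@le_limit _ _ _ 1); first exact: ltW.
move=> x /andP[x0 _]; have x10 : 0 < 1 + x by lra.
pose z := (1 + x)^-1 *: y; have zW : z \in W by rewrite memvZ.
have Hz i : `|dot z (tnth e i)| < l i.
  rewrite dotZl normrM normfV (gtr0_norm x10) mulrC ltr_pdivrMr //.
  by apply: le_lt_trans (H i) _; rewrite ltr_pMr //; lra.
have := (cuboid_diff c oe l0 zW).2 Hz; rewrite KK => /(cuboid_diff c' oe' l'0 zW).1/(_ j).
rewrite dotZl normrM normfV (gtr0_norm x10) mulrC ltr_pdivrMr // expr1.
exact: ltW.
Qed.

(** Let [w] be an edge of the second box. It lies on the boundary of the
    common closed symmetric box, hence on a face orthogonal to some [e j].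
    Moving [w] by an edge in another direction [e' i], both ways, stays in the
    closed box, so that the direction is parallel to the face: [e j] is
    orthogonal to all [e' i] but the one of [w]. *)
Lemma box_edges (e e' : d.-tuple E) c c' l l' : orthobasis dot e -> orthobasis dot e' ->
  (forall j, 0 < l j) -> (forall j, 0 < l' j) -> cuboid c e l = cuboid c' e' l' ->
  forall k, exists j mu, tnth e' k = mu *: tnth e j.
Proof.
move=> oe oe' l0 l'0 KK k.
pose w := l' k *: tnth e' k; have wW : w \in W by rewrite memvZ // (ob_mem oe').
have wd i : dot w (tnth e' i) = l' k * (k == i)%:R by rewrite dotZl (ob_dot oe').
have wcl i : `|dot w (tnth e' i)| <= l' i.
  rewrite wd; have [<-|_] := eqVneq k i; first by rewrite mulr1 ger0_norm // ltW.
  by rewrite mulr0 normr0 ltW.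
have wcl' := sym_box_sub oe' oe l'0 l0 (esym KK) wW wcl.
have [j wj] : exists j, `|dot w (tnth e j)| = l j.
  apply: contrapT => /forallNP nH.
  have Hlt i : `|dot w (tnth e i)| < l i.
    by rewrite lt_neqAle wcl' andbT; apply/eqP/nH.
  have := (cuboid_diff c oe l0 wW).2 Hlt; rewrite KK => /(cuboid_diff c' oe' l'0 wW).1/(_ k).
  by rewrite wd eqxx mulr1 ger0_norm ?ltxx // ltW.
have orth i : i != k -> dot (tnth e j) (tnth e' i) = 0.
  move=> ik.
  have HH s : `|s| = l' i -> `|dot w (tnth e j) + s * dot (tnth e' i) (tnth e j)| <= l j.
    move=> sl; pose z := w + s *: tnth e' i.
    have zW : z \in W by rewrite rpredD // memvZ // (ob_mem oe').
    have zc i' : `|dot z (tnth e' i')| <= l' i'.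
      rewrite /z dotDl wd dotZl (ob_dot oe').
      have [<-|ki] := eqVneq k i'; first by rewrite (negbTE ik) mulr0 addr0 mulr1 ger0_norm // ltW.
      rewrite mulr0 add0r; have [<-|_] := eqVneq i i'; first by rewrite mulr1 sl.
      by rewrite mulr0 normr0 ltW.
    have := sym_box_sub oe' oe l'0 l0 (esym KK) zW zc j.
    by rewrite /z dotDl [dot (s *: _) _]dotZl.
  have h1 := HH (l' i) (ger0_norm (ltW (l'0 i))).
  have h2 : `|dot w (tnth e j) - l' i * dot (tnth e' i) (tnth e j)| <= l j.
    by rewrite -mulNr; apply: HH; rewrite normrN ger0_norm // ltW.
  have p0 : l' i * dot (tnth e' i) (tnth e j) = 0.
    move: h1 h2; rewrite -wj; set a := dot w _; set t := l' i * _.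
    by case: (ler0P a) => a0; rewrite !ler_norml => /andP[? ?] /andP[? ?]; apply/le_anti/andP; split; lra.
  by move/eqP: p0; rewrite mulf_eq0 (gt_eqF (l'0 i)) /= dotC => /eqP.
have ejE : tnth e j = dot (tnth e j) (tnth e' k) *: tnth e' k.
  rewrite [LHS](ob_expand oe' (ob_mem oe j)) /comb (bigD1 k) //= big1 ?addr0 // => i ik.
  by rewrite orth // scale0r.
have mu0 : dot (tnth e j) (tnth e' k) != 0.
  apply/eqP => mu0; have := ob_dot oe j j; rewrite {1}ejE mu0 scale0r dot0l eqxx => /esym/eqP.
  by rewrite oner_eq0.
exists j, (dot (tnth e j) (tnth e' k))^-1; rewrite {2}ejE scalerA mulVf //.
by rewrite scale1r.
Qed.
End BoxEdges.

Section Stretch.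
Variables (R : realType) (E : vectType R) (dot : {dot E for idfun}).
Variables (F : {vspace E}) (Gamma : set E).
Local Notation H := (Hperp dot F).
Local Notation V := (V dot F Gamma).
Local Notation Vp := (Vperp dot F Gamma).
Variable eps : R.
Hypothesis eps0 : 0 < eps.
Local Notation T := (stretch dot F eps).

Lemma FH_cap : (F :&: H = 0)%VS.
Proof.
apply/eqP; rewrite -subv0; apply/subvP => x; rewrite memv_cap => /andP[xF xH].
by rewrite (orth_cap xF xH) mem0v.
Qed.

Lemma FH_decomp x : exists f h, [/\ f \in F, h \in H & x = f + h].
Proof.
by have [f fF fh] := orth_decomp dot F x; exists f, (x - f); split=> //; rewrite addrC subrK.
Qed.

Lemma stretchE f h : f \in F -> h \in H -> T (f + h) = f + eps^-1 *: h.
Proof.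
move=> fF hH; rewrite /stretch !linearD /= (daddv_pi_id FH_cap fF).
have cap' : (H :&: F = 0)%VS by rewrite capvC FH_cap.
rewrite (daddv_pi_id cap' hH).
have hF : h \in (F + H)%VS by rewrite -[h]add0r memv_add ?mem0v.
have := daddv_pi_add FH_cap hF; rewrite (daddv_pi_id cap' hH) => /eqP.
rewrite -subr_eq0 addrK => /eqP ->.
have fH : f \in (F + H)%VS by rewrite -[f]addr0 memv_add ?mem0v.
have := daddv_pi_add FH_cap fH; rewrite (daddv_pi_id FH_cap fF) => /eqP.
rewrite -subr_eq0 addrAC subrr add0r => /eqP ->.
by rewrite scaler0 addr0 add0r.
Qed.

Lemma stretchF f : f \in F -> T f = f.
Proof. by move=> fF; have := stretchE fF (mem0v H); rewrite scaler0 !addr0. Qed.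

Lemma stretchH h : h \in H -> T h = eps^-1 *: h.
Proof. by move=> hH; have := stretchE (mem0v F) hH; rewrite !add0r. Qed.

Lemma stretchD x y : T (x + y) = T x + T y.
Proof. by rewrite /stretch !linearD /= addrACA. Qed.

Lemma stretchB x y : T (x - y) = T x - T y.
Proof. by rewrite /stretch !linearB /= opprD addrACA. Qed.

Lemma stretchZ a x : T (a *: x) = a *: T x.
Proof. by rewrite /stretch !linearZ /= scalerDr !scalerA mulrC. Qed.

Lemma stretch_sum (I : Type) (r : seq I) f : T (\sum_(i <- r) f i) = \sum_(i <- r) T (f i).
Proof.
elim: r => [|i r IH]; last by rewrite !big_cons stretchD IH.
by rewrite !big_nil stretchF // mem0v.
Qed.

Lemma Hperp_sub_Vperp h : h \in H -> h \in Vp.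
Proof.
move=> /orthovP_dot hF; apply/orthovP_dot => u uV; apply: hF.
exact: (subvP (V_sub_F dot F Gamma)).
Qed.

Lemma stretch_Vp y : (T y \in Vp) = (y \in Vp).
Proof.
have [f [h [fF hH ->]]] := FH_decomp y; rewrite stretchE //.
by rewrite !rpredDr // ?memvZ ?Hperp_sub_Vperp.
Qed.

Lemma stretch_slice g x : g \in V -> slice dot F Gamma g (T x) <-> slice dot F Gamma g x.
Proof.
move=> gV; have gF : g \in F by exact: (subvP (V_sub_F dot F Gamma)).
have TE : T x - g = T (x - g) by rewrite stretchB (stretchF gF).
by split=> /sliceP h; apply/sliceP; move: h; rewrite TE stretch_Vp.
Qed.

Lemma stretch_cuboid (e : (\dim Vp).-tuple E) c l : orthobasis dot e ->
  (forall j, tnth e j \in F \/ tnth e j \in H) ->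
  T @` cuboid c e l = cuboid (T c) e (fun j => (if tnth e j \in H then eps^-1 else 1) * l j).
Proof.
move=> oe eFH; pose k j : R := if tnth e j \in H then eps^-1 else 1.
have k0 j : 0 < k j by rewrite /k; case: ifP; rewrite ?invr_gt0.
have Te j : T (tnth e j) = k j *: tnth e j.
  rewrite /k; case: ifPn => ejH; first exact: stretchH.
  by case: (eFH j) => [ejF|ejH']; [rewrite scale1r stretchF|rewrite ejH' in ejH].
have Tc t : T (c + \sum_j t j *: tnth e j) = T c + \sum_j (k j * t j) *: tnth e j.
  rewrite stretchD stretch_sum; congr (_ + _); apply: eq_bigr => j _.
  by rewrite stretchZ Te scalerA mulrC.
apply/seteqP; split=> x.
  move=> [_ [t tl <-] <-]; exists (fun j => k j * t j); last by rewrite -Tc.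
  by move=> j; have /andP[? ?] := tl j; rewrite mulr_gt0 //= ltr_pM2l.
move=> [t tl <-]; exists (c + \sum_j ((k j)^-1 * t j) *: tnth e j).
  exists (fun j => (k j)^-1 * t j) => // j; have /andP[? ?] := tl j.
  by rewrite mulr_gt0 ?invr_gt0 //= mulrC ltr_pdivrMr // mulrC.
rewrite Tc; congr (_ + _); apply: eq_bigr => j _; congr (_ *: _).
by rewrite mulrA mulfV ?mul1r // gt_eqF.
Qed.

(** The frame vectors in [Hperp] are a basis of it, so exactly [\dim Hperp]
    edges are stretched. *)
Lemma prod_stretch (e : (\dim Vp).-tuple E) l : orthobasis dot e ->
  (forall j, tnth e j \in F \/ tnth e j \in H) ->
  \prod_j ((if tnth e j \in H then eps^-1 else 1) * l j) = eps ^- \dim H * \prod_j l j.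
Proof.
move=> oe eFH; rewrite big_split /=; congr (_ * _).
rewrite -big_mkcond /= prodr_const -exprVn; congr (_ ^+ _).
pose X := [seq x <- e | x \in H].
have Xfree : free X by have [be _] := oe; apply: filter_free; exact: basis_free be.
have XH : (H <= span X)%VS.
  apply/subvP => h hH; rewrite (ob_expand oe (Hperp_sub_Vperp hH)); apply: memv_suml => j _.
  case: (boolP (tnth e j \in H)) => jH.
    by rewrite memvZ // memv_span // mem_filter jH mem_tnth.
  case: (eFH j) => [jF|jH']; last by rewrite jH' in jH.
  have /orthovP_dot/(_ _ jF) -> := hH; rewrite scale0r; exact: mem0v.
have HX : (span X <= H)%VS.
  by apply/span_subvP => x; rewrite mem_filter => /andP[].
have dX : \dim H = size X.
  by rewrite -(eqP Xfree); congr (\dim _); apply/eqP; rewrite eqEsubv XH.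
rewrite dX size_filter -[tval e]map_tnth_enum count_map cardE -size_filter.
by congr size; rewrite enumT; apply: eq_filter => j.
Qed.
End Stretch.

(** * The remainder *)

Lemma cnt_disjointU (T : choiceType) (A B : set T) : finite_set A -> finite_set B ->
  A `&` B = set0 -> cnt (A `|` B) = (cnt A + cnt B)%N.
Proof.
move=> fA fB AB; rewrite /cnt fset_setU // -cardfsUI -fset_setI // AB fset_set0.
by rewrite cardfs0 addn0.
Qed.

Lemma cnt_bigcup (T I : choiceType) (s : seq I) (A : I -> set T) : uniq s ->
  (forall i, i \in s -> finite_set (A i)) ->
  (forall i j x, i \in s -> j \in s -> A i x -> A j x -> i = j) ->
  cnt (\bigcup_(i in [set` s]) A i) = (\sum_(i <- s) cnt (A i))%N.
Proof.
elim: s => [|i s IH].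
  move=> _ _ _; rewrite (_ : \bigcup_(i in _) _ = set0) ?big_nil /cnt ?fset_set0 ?cardfs0 //.
  by rewrite -subset0 => x [].
move=> /= /andP[is_ us] fA dA; rewrite big_cons.
have -> : \bigcup_(j in [set` i :: s]) A j = A i `|` \bigcup_(j in [set` s]) A j.
  apply/seteqP; split=> x.
    move=> [j /=]; rewrite inE => /orP[/eqP ->|js] Ax; [by left|by right; exists j].
  by move=> [Ax|[j js Ax]]; [exists i; rewrite //= inE eqxx|exists j; rewrite //= inE js orbT].
have fA' j : j \in s -> finite_set (A j) by move=> js; apply: fA; rewrite inE js orbT.
rewrite cnt_disjointU ?IH //.
- by move=> j k x js ks; apply: dA; rewrite inE ?js ?ks orbT.
- by apply: fA; rewrite inE eqxx.
- by apply: bigcup_finite => // j; exact: fA'.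
- rewrite -subset0 => x [Ax [j js Bx]]; move/negP: is_; apply.
  by rewrite (dA i j x) // inE ?eqxx //; rewrite (js : j \in s) orbT.
Qed.

(** Converts the size [eps ^- q * volume], an exponential in [- ln eps], into
    a number of dyadic scales linear in [- ln eps]. *)
Lemma expR_lt_pow2 (R : realType) : exists N : nat, forall t : R, 0 <= t ->
  expR t < 2 ^+ (N * (Num.truncn t).+1).
Proof.
pose N := Num.truncn (expR (1 : R)); exists N.+1 => t t0.
have e2 : expR (1 : R) <= 2 ^+ N.+1.
  have h : expR (1 : R) < N.+1%:R by exact: truncnS_gt.
  apply/ltW/(lt_le_trans h); rewrite -natrX ler_nat; apply: ltnW; exact: ltn_expl.
apply: (@lt_le_trans _ _ (expR ((Num.truncn t).+1%:R))); first by rewrite ltr_expR truncnS_gt.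
rewrite -[X in expR X]mulr1 expRM_natl exprM lerXn2r ?nnegrE ?expR_ge0 ?exprn_ge0 //.
Qed.

Section Volumes.
Variables (R : realType) (E : vectType R) (dot : {dot E for idfun}) (W : {vspace E}).

Lemma fine_vol_set0 : fine (vol dot W set0) = 0.
Proof.
have [[e oe]|ne] := pselect (exists e : (\dim W).-tuple E, orthobasis dot e).
  have h : (vol dot W set0 <= 0%:E)%E.
    have := @vol_cover R E dot W e oe nat set0 (fun=> 0) (fun=> e) (fun _ _ => 1) set0.
    by rewrite esum_set0; apply.
  by have -> : vol dot W set0 = 0%E by apply/le_anti; rewrite h vol_ge0.
rewrite /vol (_ : [set v | _] = set0) ?ereal_inf0 //.
rewrite -subset0 => v [D [c [e [l [oe _ _ _]]]]]; apply: ne; exists (e 0%N); exact: oe.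
Qed.

Lemma covolumeE L : lattice_in W L -> exists b : (\dim W).-tuple E,
  [/\ basis_of W b, L = zspan b & covolume dot W L = fine (vol dot W (fundamental_cell b))].
Proof.
move=> [b [bb LE]].
have ex : [set v : R | exists b : (\dim W).-tuple E,
    [/\ basis_of W b, L = zspan b & v = fine (vol dot W (fundamental_cell b))]]
    (fine (vol dot W (fundamental_cell b))) by exists b.
exact: (@xgetI _ 0 _ _ ex).
Qed.
End Volumes.

Section Main.
Variables (R : realType) (E : vectType R) (dot : {dot E for idfun}).
Variables (F : {vspace E}) (Gamma S : set E).
Local Notation H := (Hperp dot F).
Local Notation V := (V dot F Gamma).
Local Notation Vp := (Vperp dot F Gamma).
Local Notation Gd := (GammaF_dual dot F Gamma).
Local Notation Gp := (Gamma_perp dot F Gamma).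
Local Notation slice := (slice dot F Gamma).
Local Notation T := (stretch dot F).
Hypothesis lat : lattice_in fullv Gamma.
Hypothesis bS : ebounded dot S.
Hypothesis edges : forall g, Gd g -> slice g `&` S !=set0 ->
    exists e : (\dim Vp).-tuple E,
      [/\ orthobasis dot e,
          forall j, tnth e j \in (F :&: Vp)%VS \/ tnth e j \in H &
          cuboid_along e (slice g `&` S)].
Hypothesis good : forall g, Gd g -> slice g `&` S !=set0 -> good_position dot Vp Gp (slice g `&` S).

(** In the slice of [g], the points of [Gamma] form a translate of
    [Gamma_perp] by a lift of [g], and the stretched slice of [S] is a box in
    the frame of good position. *)
Lemma slice_count g : Gd g -> slice g `&` S !=set0 ->
  let P := fine (vol dot Vp (slice g `&` S)) in
  exists2 C, 0 <= C & forall eps m, 0 < eps -> eps ^- \dim H * P < 2 ^+ m.+1 ->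
    let A := (T eps @` (slice g `&` S)) `&` Gamma in
    finite_set A /\
    `|(cnt A)%:R - eps ^- \dim H / covolume dot Vp Gp * P| <= errbound (\dim Vp) C m.
Proof.
move=> Gg ne P.
have [e [oe [c [l [l0 KE]]] inf0]] := good Gg ne.
have [e1 [oe1 e1FH [c1 [l1 [l10 KE1]]]]] := edges Gg ne.
have eFH j : tnth e j \in F \/ tnth e j \in H.
  have [i [mu ->]] := box_edges oe1 oe l10 l0 (etrans (esym KE1) KE) j.
  have [iF|iH] := e1FH i; [left|right]; rewrite memvZ //.
  by move: iF; rewrite memv_cap => /andP[].
have PE : P = \prod_j l j by rewrite /P KE (vol_cuboid oe).
have [_ Glat] := perp_lattice dot F lat.
have [b [bb GpE covE]] := covolumeE dot Glat.
have [k k0 adm] : exists2 k, 0 < k & forall x, zspan b x -> x != 0 -> k <= `|Nm dot e x|.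
  pose I := ereal_inf [set (`|Nm dot e x|)%:E | x in Gp `\ 0].
  have Ile x : zspan b x -> x != 0 -> (I <= (`|Nm dot e x|)%:E)%E.
    by move=> bx x0; apply: ereal_inf_lbound; exists x => //; split; [rewrite GpE|apply/eqP].
  rewrite -/I in inf0; move: inf0 Ile; case: I => [i|_ Ile|//].
    by rewrite lte_fin => i0 Ile; exists i => // x bx x0; have := Ile x bx x0; rewrite lee_fin.
  by exists 1 => // x bx x0; have := Ile x bx x0; rewrite leye_eq.
have [C C0 HC] := lattice_count oe bb k0 adm.
exists C => // eps m eps0 Vm A.
have [y Gy yg] := lift_dual lat Gg.
have gV : g \in V by have [] := Gg.
have cg : c - g \in Vp.
  have [x Hx] := ne; have : cuboid c e l x by rewrite -KE.
  case: Hx => /sliceP xg _ /(cuboidP oe)[xc _].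
  have -> : c - g = (x - g) - (x - c) by rewrite opprB [RHS]addrC addrA subrK.
  by rewrite rpredB.
pose l' j := (if tnth e j \in H then eps^-1 else 1) * l j.
have l'0 j : 0 < l' j by rewrite mulr_gt0 //; case: ifP => _; rewrite ?invr_gt0.
have prodl' : \prod_j l' j = eps ^- \dim H * P by rewrite PE prod_stretch.
have gF : g \in F by exact: (subvP (V_sub_F dot F Gamma)).
have Tcy : T eps c - y \in Vp.
  have -> : T eps c - y = T eps (c - g) - (y - g).
    by rewrite stretchB (stretchF _ _ gF) opprB addrA subrK.
  by rewrite rpredB // stretch_Vp.
have AE : A = cuboid (T eps c) e l' `&` [set y + z | z in zspan b].
  have TK : T eps @` (slice g `&` S) = cuboid (T eps c) e l' by rewrite KE (stretch_cuboid _ c l oe eFH).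
  rewrite /A TK; have [b0 [_ GE]] := lat; apply/seteqP; split=> x [Kx].
    move=> Gx; split=> //; exists (x - y); last by rewrite addrC subrK.
    have : Gp (x - y).
      split; last first.
        have /(cuboidP oe)[xc _] := Kx.
        have -> : x - y = (x - T eps c) + (T eps c - y) by rewrite addrA subrK.
        by rewrite /= rpredD.
      move: Gx Gy; rewrite GE => -[z1 _ <-] [z2 _ <-].
      exists (fun i => z1 i - z2 i) => //; rewrite -sumrB; apply: eq_bigr => i _.
      by rewrite intrB scalerBl.
    by rewrite GpE.
  move=> [z]; rewrite -GpE => -[Gz _] zE; split => //; rewrite -zE.
  move: Gz Gy; rewrite GE => -[z1 _ <-] [z2 _ <-].
  exists (fun i => z2 i + z1 i) => //; rewrite -big_split; apply: eq_bigr => i _ /=.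
  by rewrite intrD scalerDl.
have [fA bA] := HC (T eps c) l' y m l'0 Tcy (eq_ind_r (fun v => v < _) Vm prodl').
by rewrite AE; split=> //; rewrite covE mulrAC -prodl'.
Qed.

(** One finite set of slices serves for all [eps], since [stretch eps]
    preserves slices. *)
Lemma count_slices : exists X : seq E,
  [/\ uniq X, forall g, g \in X <-> Gd g /\ slice g `&` S !=set0,
   forall eps, 0 < eps -> npoints dot F Gamma eps S =
     (\sum_(g <- X) cnt ((T eps @` (slice g `&` S)) `&` Gamma))%N &
   \sum_(g \in Gd) fine (vol dot Vp (slice g `&` S)) =
     \sum_(g <- X) fine (vol dot Vp (slice g `&` S))].
Proof.
pose G := [set g | Gd g /\ slice g `&` S !=set0].
have fG : finite_set G by exact: finite_slices.
have XG g : g \in (fset_set G : seq E) <-> G g.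
  by have := in_fset_set fG g; rewrite /= => ->; rewrite inE.
exists (fset_set G); split=> //; first exact: fset_uniq.
  move=> eps eps0; rewrite /npoints -/(cnt _).
  have -> : (T eps @` S) `&` Gamma =
      \bigcup_(g in [set` (fset_set G : seq E)]) ((T eps @` (slice g `&` S)) `&` Gamma).
    apply/seteqP; split=> x.
      move=> [[s Ss <-] Gx]; have [g Gg xg] := proj_dual dot F Gx.
      have gV : g \in V by have [] := Gg.
      have sg : slice g s by apply/(stretch_slice eps _ gV)/sliceP.
      exists g; first by apply/XG; split=> //; exists s.
      by split=> //; exists s.
    by move=> [g _ [[s [_ Ss] <-] Gx]]; split=> //; exists s.
  apply: cnt_bigcup; first exact: fset_uniq.
    move=> g /XG[Gg ne]; have [C _ HC] := slice_count Gg ne.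
    pose P := fine (vol dot Vp (slice g `&` S)).
    pose m := Num.truncn (eps ^- \dim H * P).
    suff /(HC eps m eps0)[] : eps ^- \dim H * P < 2 ^+ m.+1 by [].
    apply: lt_le_trans (truncnS_gt _) _.
    by rewrite -natrX ler_nat; apply: ltnW; exact: ltn_expl.
  move=> g g' x /XG[Gg _] /XG[Gg' _] [[s [sg _] <-] _] [[s' [sg' _] ss'] _].
  have [gV _] := Gg; have [gV' _] := Gg'.
  apply: (@dual_inj _ _ dot F Gamma g g' (T eps s) Gg Gg'); first exact/stretch_slice.
  by rewrite -ss'; exact/stretch_slice.
rewrite -(fsbig_finite _ (fun g => fine (vol dot Vp (slice g `&` S))) fG).
symmetry; apply: fsbig_widen; first by move=> g [].
move=> g [Gg nG]; rewrite /= (_ : slice g `&` S = set0) ?fine_vol_set0 //.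
by apply/eqP; apply: contrapT => /negP/set0P ne; apply: nG.
Qed.

(** For [eps] below [expR (-1)], [y = - ln eps] is at least 1, so that the
    number [m.+1] of scales of a slice is at most a constant times [y]. *)
Lemma remainder_bound : exists2 C, 0 <= C & \forall eps \near 0^'+,
  `|remainder dot F Gamma S eps| <=
  if \dim Vp == 0%N then 0 else C * `|ln eps| ^+ (\dim Vp).-1.
Proof.
have [X [uX XP nE volE]] := count_slices.
pose P g := fine (vol dot Vp (slice g `&` S)).
have [N HN] := expR_lt_pow2 R.
pose q := \dim H; pose k g : R := (N.+1)%:R * (q%:R + `|P g| + 1).
pose Q g : set R := [set C : R | 0 <= C /\ forall eps m, 0 < eps -> eps ^- \dim H * P g < 2 ^+ m.+1 ->
    `|(cnt ((T eps @` (slice g `&` S)) `&` Gamma))%:R - eps ^- \dim H / covolume dot Vp Gp * P g| <=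
      errbound (\dim Vp) C m].
pose D g := xget 0 (Q g).
have DP g : g \in X -> Q g (D g).
  move=> /XP[Gg ne]; have [C C0 HC] := slice_count Gg ne; apply: (@xgetI _ 0 (Q g) C).
  by split=> // eps m eps0 /(HC eps m eps0)[].
have k0 g : 0 <= k g by rewrite mulr_ge0 // !addr_ge0.
exists (\sum_(g <- X) (D g * k g ^+ (\dim Vp).-1)).
  rewrite big_seq sumr_ge0 // => g gX; have [D0 _] := DP g gX.
  by rewrite mulr_ge0 // exprn_ge0.
near=> eps.
have eps0 : 0 < eps by near: eps; exact: nbhs_right_gt.
have eps1 : eps < expR (- 1) by near: eps; apply: nbhs_right_lt; exact: expR_gt0.
pose y := - ln eps.
have epsE : eps = expR (- y) by rewrite /y opprK lnK // posrE.
have y1 : 1 <= y by move: eps1; rewrite epsE ltr_expR ltrN2 => /ltW.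
have y0 : 0 <= y by exact: le_trans y1.
have lnE : `|ln eps| = y by rewrite /y ler0_norm // -oppr_ge0 -/y; lra.
have rE : remainder dot F Gamma S eps = \sum_(g <- X)
    ((cnt ((T eps @` (slice g `&` S)) `&` Gamma))%:R - eps ^- \dim H / covolume dot Vp Gp * P g).
  by rewrite /remainder nE // volE natr_sum mulr_sumr sumrB.
have term g : g \in X ->
    `|(cnt ((T eps @` (slice g `&` S)) `&` Gamma))%:R - eps ^- \dim H / covolume dot Vp Gp * P g|
    <= if \dim Vp == 0%N then 0 else (D g * k g ^+ (\dim Vp).-1) * y ^+ (\dim Vp).-1.
  move=> gX; have [D0 HD] := DP g gX.
  pose t := q%:R * y + `|P g|; pose m := (N.+1 * (Num.truncn t).+1).-1.
  have t0 : 0 <= t by rewrite addr_ge0 // mulr_ge0.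
  have mE : m.+1 = (N.+1 * (Num.truncn t).+1)%N by rewrite prednK // muln_gt0.
  have Vm : eps ^- \dim H * P g < 2 ^+ m.+1.
    apply: (@le_lt_trans _ _ (expR t)); last first.
      apply: lt_le_trans (HN t t0) _; rewrite mE ler_eXn2l ?ltr1n //.
      by rewrite leq_mul2r leqnSn orbT.
    rewrite /t expRD epsE -exprVn -expRN opprK expRM_natl.
    rewrite ler_wpM2l ?exprn_ge0 ?expR_ge0 //.
    by apply: le_trans (ler_norm _) _; apply: le_trans (expR_ge1Dx _); rewrite lerDr.
  apply: le_trans (HD eps m eps0 Vm) _; rewrite /errbound; case: ifP => // _.
  rewrite -mulrA -exprMn; apply: ler_wpM2l => //.
  apply: lerXn2r; rewrite ?nnegrE ?mulr_ge0 //.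
  rewrite mE natrM /k -mulrA ler_wpM2l // -natr1.
  have ht : (Num.truncn t)%:R <= t by rewrite truncn_le.
  have hP : `|P g| <= `|P g| * y by rewrite ler_peMr.
  by rewrite !mulrDl mul1r lerD // (le_trans ht) // lerD2l.
rewrite rE; apply: le_trans (ler_norm_sum _ _ _) _.
rewrite big_seq; apply: (le_trans (ler_sum _ term)); rewrite -big_seq.
by case: ifP => _; [rewrite big1|rewrite lnE mulr_suml].
Unshelve. all: by end_near.
Qed.

Lemma remainder_bigO : remainder dot F Gamma S =O_ (0^'+)
    (fun eps : R => `|ln eps| ^ ((\dim {: E})%:Z - (\dim V)%:Z - 1)).
Proof.
have [C C0 HC] := remainder_bound.
have [nE _] := perp_lattice dot F lat.
apply/eqO_exP; exists (C + 1); first by lra.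
near=> eps.
have : `|remainder dot F Gamma S eps| <=
  if \dim Vp == 0%N then 0 else C * `|ln eps| ^+ (\dim Vp).-1 by near: eps.
move=> h; apply: le_trans h _; rewrite nE PoszD (addrC (Posz (\dim V))) addrK.
case: ifPn => [_|]; first by rewrite mulr_ge0 //; lra.
rewrite -lt0n; case: (\dim Vp) => // p _; rewrite /= -addn1 PoszD addrK.
by rewrite -exprnP normrX normr_id ler_wpM2r ?exprn_ge0 //; lra.
Unshelve. all: by end_near.
Qed.
End Main.

Theorem theorem2p5 (R : realType) (E : vectType R) (dot : {dot E for idfun})
    (F : {vspace E}) (Gamma : set E) (S : set E) :
  lattice_in fullv Gamma ->
  ebounded dot S -> eopen dot S ->
  (forall g, GammaF_dual dot F Gamma g -> slice dot F Gamma g `&` S !=set0 ->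
    exists e : (\dim (Vperp dot F Gamma)).-tuple E,
      [/\ orthobasis dot e,
          forall j, tnth e j \in (F :&: Vperp dot F Gamma)%VS \/
                    tnth e j \in Hperp dot F &
          cuboid_along e (slice dot F Gamma g `&` S)]) ->
  (forall g, GammaF_dual dot F Gamma g -> slice dot F Gamma g `&` S !=set0 ->
    good_position dot (Vperp dot F Gamma) (Gamma_perp dot F Gamma)
      (slice dot F Gamma g `&` S)) ->
  remainder dot F Gamma S =O_ (0^'+)
    (fun eps : R => `|ln eps| ^ ((\dim {: E})%:Z - (\dim (V dot F Gamma))%:Z - 1)).
Proof.
by move=> lat bS _ edges good; exact: remainder_bigO.
Qed.
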